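(* Let $1<p<\infty$ and let $\Lambda$ be a countable set. For each $t\in[0,1]$ let $\psi_t:\Lambda\to B(l^p)$, $\varphi_t:\Lambda\to B(l^p)$ and $\rho_t:\Lambda\to B(l^p\oplus l^p)$ be maps such that (1) $\rho_0(a)=\psi_0(a)\oplus\varphi_0(a)$ for all $a\in\Lambda$; (2) $\rho_t(a)-\psi_t(a)\oplus\varphi_t(a)$ is compact for all $t\in[0,1]$, $a\in\Lambda$; (3) for each $a\in\Lambda$, $t\mapsto\pi(\psi_t(a))$ is continuous from $[0,1]$ to $B(l^p)/K(l^p)$; (4) $\sup_{t\in[0,1]}\|\rho_t(a)\|<\infty$ for every $a\in\Lambda$. Then there exist dyadic numbers $v(1),v(2),\ldots$ in $[0,1]$ such that $\bigoplus_{k\ge1}\rho_{v(k)}$ is $16$-similar modulo compact operators to $\psi_1\oplus\big(\bigoplus_{k\ge1}\rho_{v(k)}\big)$. Moreover, if $p=2$, the implementing operator can be taken unitary (unitary equivalence modulo compact operators).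
   Context: $\pi:B(l^p)\to B(l^p)/K(l^p)$ is the quotient map. Direct sums are $l^p$-direct sums; $(\bigoplus_k\rho_{v(k)})(a)=\bigoplus_k\rho_{v(k)}(a)$, which is bounded by (4). Maps $\rho_1:\Lambda\to B(\mathcal{Y}_1)$, $\rho_2:\Lambda\to B(\mathcal{Y}_2)$ are $\lambda$-similar modulo compact operators if there is an invertible $S:\mathcal{Y}_1\to\mathcal{Y}_2$ with $\|S\|\|S^{-1}\|\le\lambda$ and $\rho_2(a)-S\rho_1(a)S^{-1}$ compact for all $a\in\Lambda$. *)

(* Defs.v *)
From Stdlib Require Import Reals Lra Lia List Classical ClassicalEpsilon.
Open Scope R_scope.

Definition C := (R * R)%type.
Definition C0 : C := (0, 0).
Definition Cadd (z w : C) : C := (fst z + fst w, snd z + snd w).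
Definition Copp (z : C) : C := (- fst z, - snd z).
Definition Csub (z w : C) : C := Cadd z (Copp w).
Definition Cmul (z w : C) : C :=
  (fst z * fst w - snd z * snd w, fst z * snd w + snd z * fst w).
Definition Cmod (z : C) : R := sqrt (fst z ^ 2 + snd z ^ 2).

Definition vec (I : Type) := I -> C.
(* An operator from l^p(I) to l^p(J) is represented by a map vec I -> vec J;
   only its behaviour on l^p(I) matters in all the predicates below. *)
Definition op (I J : Type) := vec I -> vec J.

Definition vadd {I} (x y : vec I) : vec I := fun i => Cadd (x i) (y i).
Definition vsub {I} (x y : vec I) : vec I := fun i => Csub (x i) (y i).
Definition vscale {I} (c : C) (x : vec I) : vec I := fun i => Cmul c (x i).

Definition opsub {I J} (S T : op I J) : op I J := fun x => vsub (S x) (T x).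

(* x^a for x >= 0, a > 0 (with 0^a = 0). *)
Definition rpow (x a : R) : R := if Rle_dec x 0 then 0 else Rpower x a.

Definition lsum {I} (f : I -> R) (l : list I) : R :=
  fold_right (fun i acc => f i + acc) 0 l.

(* least upper bound (junk value if it does not exist) *)
Definition rsup (E : R -> Prop) : R := epsilon (inhabits 0) (fun r => is_lub E r).

(* sum over I of a nonnegative family = sup of finite partial sums *)
Definition psum {I} (f : I -> R) : R :=
  rsup (fun s => exists l, NoDup l /\ s = lsum f l).

Definition in_lp {I} (p : R) (x : vec I) : Prop :=
  exists M, forall l, NoDup l -> lsum (fun i => rpow (Cmod (x i)) p) l <= M.

Definition lp_norm {I} (p : R) (x : vec I) : R :=
  rpow (psum (fun i => rpow (Cmod (x i)) p)) (/ p).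

Definition is_bounded_op {I J} (p : R) (T : op I J) : Prop :=
  (forall x, in_lp p x -> in_lp p (T x)) /\
  (forall (c : C) (x y : vec I), in_lp p x -> in_lp p y ->
     forall j, T (vadd (vscale c x) y) j = vadd (vscale c (T x)) (T y) j) /\
  (exists M, forall x, in_lp p x -> lp_norm p (T x) <= M * lp_norm p x).

Definition opnorm {I J} (p : R) (T : op I J) : R :=
  rsup (fun r => exists x, in_lp p x /\ lp_norm p x <= 1 /\ r = lp_norm p (T x)).

Definition is_compact_op {I J} (p : R) (T : op I J) : Prop :=
  is_bounded_op p T /\
  forall xs : nat -> vec I,
    (forall n, in_lp p (xs n)) ->
    (exists M, forall n, lp_norm p (xs n) <= M) ->
    exists (phi : nat -> nat) (y : vec J),
      (forall n, (phi n < phi (S n))%nat) /\ in_lp p y /\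
      Un_cv (fun n => lp_norm p (vsub (T (xs (phi n))) y)) 0.

(* norm of pi(A) in the Calkin algebra B/K: inf over compact K of ||A - K|| *)
Definition calkin_norm {I} (p : R) (A : op I I) : R :=
  - rsup (fun r => exists K : op I I, is_compact_op p K /\ r = - opnorm p (opsub A K)).

Definition calkin_continuous {I} (p : R) (F : R -> op I I) : Prop :=
  forall t, 0 <= t <= 1 -> forall eps, eps > 0 ->
    exists delta, delta > 0 /\
      forall s, 0 <= s <= 1 -> Rabs (s - t) < delta ->
        calkin_norm p (opsub (F s) (F t)) < eps.

(* l^p(I1) (+) l^p(I2) = l^p(I1 + I2) *)
Definition dsum2 {I1 J1 I2 J2} (T1 : op I1 J1) (T2 : op I2 J2)
  : op (I1 + I2) (J1 + J2) :=
  fun x j => match j with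
             | inl j1 => T1 (fun i => x (inl i)) j1
             | inr j2 => T2 (fun i => x (inr i)) j2
             end.

(* (+)_{k in nat} l^p(I) = l^p(nat * I) *)
Definition dsumN {I J} (T : nat -> op I J) : op (nat * I) (nat * J) :=
  fun x kj => T (fst kj) (fun i => x (fst kj, i)) (snd kj).

Definition invertible_pair {I J} (p : R) (S : op I J) (Sinv : op J I) : Prop :=
  is_bounded_op p S /\ is_bounded_op p Sinv /\
  (forall x, in_lp p x -> forall i, Sinv (S x) i = x i) /\
  (forall y, in_lp p y -> forall j, S (Sinv y) j = y j).

Definition similar_mod_compact {L I J} (p lam : R)
  (r1 : L -> op I I) (r2 : L -> op J J) : Prop :=
  exists (S : op I J) (Sinv : op J I),
    invertible_pair p S Sinv /\
    opnorm p S * opnorm p Sinv <= lam /\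
    forall a, is_compact_op p (opsub (r2 a) (fun y => S (r1 a (Sinv y)))).

(* unitary = surjective linear isometry (here used with p = 2) *)
Definition unitarily_equiv_mod_compact {L I J} (p : R)
  (r1 : L -> op I I) (r2 : L -> op J J) : Prop :=
  exists (U : op I J) (Uinv : op J I),
    invertible_pair p U Uinv /\
    (forall x, in_lp p x -> lp_norm p (U x) = lp_norm p x) /\
    forall a, is_compact_op p (opsub (r2 a) (fun y => U (r1 a (Uinv y)))).

Definition dyadic (x : R) : Prop := exists m n : nat, x = INR m / 2 ^ n.

(* Main.v *)
Require Import Defs.
From Stdlib Require Import Reals Lra Lia List Classical ClassicalEpsilon.
From Stdlib Require Import FunctionalExtensionality Permutation Cantor.
Open Scope R_scope.

(** Index the summands [rho_{v(k)}] by nodes [k = (n, j)] with [v(n, j)] close to [1 - j/n], so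
    that [v(n, 0) = 1] and [v(n, n) = 0].  Along the chain
    [(n, 0) -> (n, 1) -> ... -> (n, n) -> (n+1, n+1) -> ...] the parameter runs from 1 to 0 in
    steps of size about [1/n] and stays at 0 afterwards, where [rho_0] is exactly block diagonal.
    On the [psi]-components the implementing operator moves [psi_1] into the head of such a chain
    and shifts along it; everything else is fixed.  A coordinate [e] of l^p in the [i]-th block of
    a sparse sequence [E_0 < E_1 < ...] uses the chain with [n] about [sqrt i], passing from chain
    [n] to chain [n + 1] by slow rotations between corresponding nodes.  Each chain is thus only
    used far out in l^p: there the compact operators [rho_t - psi_t (+) phi_t] are negligible
    and neighbouring [psi_s], [psi_t] are close in norm, and the blocks are so sparse that
    every operator involved is almost block tridiagonal, hence almost commutes with multipliers
    that vary slowly from block to block.  The operator is a product of two rotations (norm at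
    most 2 each, isometric for [p = 2]) and a permutation of coordinates. *)

(** Compactness asks for two things: the error must be small far out in l^p, and on the finitely
    many remaining blocks it must live on finitely many nodes. The second is met exactly, not
    approximately: in a column beyond [sqrt i] the weights no longer depend on the block [i] and sit
    on diagonal nodes, where the parameter is 0 and the operators are block diagonal, so the entries
    there are zero. The first splits by the two blocks that an entry joins. For adjacent blocks the
    weights differ by at most the square root of [sqrt (i + 1) - sqrt i], which tends to 0 although
    the chains used get arbitrarily long; this is what [sqrt i] achieves. Non-adjacent blocks are
    separated by the sparse choice of [E], with a geometric bound that can be summed over all pairs.
    That choice needs the rows of bounded operators to have small tails, which is where p > 1
    enters. It also handles the countable set Lambda: the operators attached to [a] are controlled
    only from block [f a] on. The constant 16 is 4 for the operator times 4 for its inverse. *)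

(** * The modulus of complex numbers *)

Lemma sqrt_sum_sq_triangle a b c d :
  sqrt ((a + c) ^ 2 + (b + d) ^ 2) <= sqrt (a ^ 2 + b ^ 2) + sqrt (c ^ 2 + d ^ 2).
Proof.
  assert (Hs : forall u w : R, 0 <= u ^ 2 + w ^ 2) by (intros; nra).
  pose proof (sqrt_pos (a ^ 2 + b ^ 2)) as P1.
  pose proof (sqrt_pos (c ^ 2 + d ^ 2)) as P2.
  pose proof (sqrt_sqrt _ (Hs a b)) as S1.
  pose proof (sqrt_sqrt _ (Hs c d)) as S2.
  set (u := sqrt (a ^ 2 + b ^ 2)) in *. set (w := sqrt (c ^ 2 + d ^ 2)) in *.
  assert (CS : a * c + b * d <= u * w).
  { apply Rsqr_incr_0_var; [|nra]. unfold Rsqr.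
    replace (u * w * (u * w)) with ((u * u) * (w * w)) by ring.
    rewrite S1, S2. pose proof (Rle_0_sqr (a * d - b * c)) as Q. unfold Rsqr in Q. nra. }
  rewrite <- (sqrt_Rsqr (u + w)) by lra.
  apply sqrt_le_1_alt. unfold Rsqr. nra.
Qed.

Lemma Cmod_nonneg z : 0 <= Cmod z.
Proof. apply sqrt_pos. Qed.

Lemma Cmod_add z w : Cmod (Cadd z w) <= Cmod z + Cmod w.
Proof. apply sqrt_sum_sq_triangle. Qed.

Lemma Cmod_mul z w : Cmod (Cmul z w) = Cmod z * Cmod w.
Proof.
  unfold Cmod, Cmul; simpl fst; simpl snd.
  rewrite <- sqrt_mult_alt by nra. f_equal. ring.
Qed.

Lemma Cmod_opp z : Cmod (Copp z) = Cmod z.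
Proof. unfold Cmod, Copp; simpl fst; simpl snd. f_equal. ring. Qed.

Lemma Cmod_sub z w : Cmod (Csub z w) <= Cmod z + Cmod w.
Proof. unfold Csub. rewrite <- (Cmod_opp w). apply Cmod_add. Qed.

Lemma Cmod_C0 : Cmod C0 = 0.
Proof. unfold Cmod, C0; simpl. replace (0 * (0 * 1) + 0 * (0 * 1)) with 0 by ring. apply sqrt_0. Qed.

Lemma Cmod_real r : Cmod (r, 0) = Rabs r.
Proof.
  unfold Cmod; simpl fst; simpl snd. rewrite <- sqrt_Rsqr_abs. f_equal. unfold Rsqr. ring.
Qed.

Lemma Cmod_fst z : Rabs (fst z) <= Cmod z.
Proof.
  unfold Cmod. rewrite <- sqrt_Rsqr_abs. apply sqrt_le_1_alt. unfold Rsqr. nra.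
Qed.

Lemma Cmod_snd z : Rabs (snd z) <= Cmod z.
Proof.
  unfold Cmod. rewrite <- sqrt_Rsqr_abs. apply sqrt_le_1_alt. unfold Rsqr. nra.
Qed.

Lemma Cmod_le_parts z : Cmod z <= Rabs (fst z) + Rabs (snd z).
Proof.
  destruct z as [a b]; simpl fst; simpl snd.
  pose proof (Rabs_pos a). pose proof (Rabs_pos b).
  unfold Cmod; simpl fst; simpl snd.
  rewrite <- (sqrt_Rsqr (Rabs a + Rabs b)) by lra.
  apply sqrt_le_1_alt. unfold Rsqr.
  assert (Rabs a * Rabs a = a * a) by (rewrite <- Rabs_mult; apply Rabs_right; nra).
  assert (Rabs b * Rabs b = b * b) by (rewrite <- Rabs_mult; apply Rabs_right; nra).
  nra.
Qed.

Lemma Cmod_eq_0 z : Cmod z = 0 -> z = C0.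
Proof.
  intros H. pose proof (Cmod_fst z) as H1. pose proof (Cmod_snd z) as H2. rewrite H in H1, H2.
  destruct z as [a b]; simpl in H1, H2. unfold C0.
  assert (a = 0) by (revert H1; unfold Rabs; destruct (Rcase_abs a); lra).
  assert (b = 0) by (revert H2; unfold Rabs; destruct (Rcase_abs b); lra).
  subst; reflexivity.
Qed.

Lemma Ceq (z w : Defs.C) : fst z = fst w -> snd z = snd w -> z = w.
Proof. destruct z, w; simpl; intros; subst; reflexivity. Qed.

(** * Powers *)

Lemma rpow_0 a : rpow 0 a = 0.
Proof. unfold rpow. destruct (Rle_dec 0 0); [reflexivity|lra]. Qed.

Lemma rpow_pos x a : 0 < x -> 0 < rpow x a.
Proof. intros H. unfold rpow. destruct (Rle_dec x 0); [lra|]. apply exp_pos. Qed.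

Lemma rpow_nonneg x a : 0 <= rpow x a.
Proof. unfold rpow. destruct (Rle_dec x 0); [lra|]. left; apply exp_pos. Qed.

Lemma rpow_Rpower x a : 0 < x -> rpow x a = Rpower x a.
Proof. intros H. unfold rpow. destruct (Rle_dec x 0); [lra|reflexivity]. Qed.

Lemma rpow_le x y a : 0 <= a -> 0 <= x <= y -> rpow x a <= rpow y a.
Proof.
  intros Ha [H0 H]. destruct (Req_dec x 0) as [->|Hx].
  - rewrite rpow_0. apply rpow_nonneg.
  - rewrite !rpow_Rpower by lra. apply Rle_Rpower_l; lra.
Qed.

Lemma rpow_mult x y a : 0 <= x -> 0 <= y -> rpow (x * y) a = rpow x a * rpow y a.
Proof.
  intros Hx Hy. destruct (Req_dec x 0) as [->|Nx].
  { rewrite Rmult_0_l, rpow_0. ring. }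
  destruct (Req_dec y 0) as [->|Ny].
  { rewrite Rmult_0_r, rpow_0. ring. }
  rewrite !rpow_Rpower by nra. symmetry. apply Rpower_mult_distr; lra.
Qed.

Lemma rpow_inv_r x a : 0 < a -> 0 <= x -> rpow (rpow x (/ a)) a = x.
Proof.
  intros Ha Hx. destruct (Req_dec x 0) as [->|Nx]; [now rewrite !rpow_0|].
  rewrite (rpow_Rpower x) by lra. rewrite rpow_Rpower by apply exp_pos.
  rewrite Rpower_mult, Rinv_l by lra. apply Rpower_1; lra.
Qed.

Lemma rpow_inv_l x a : 0 < a -> 0 <= x -> rpow (rpow x a) (/ a) = x.
Proof.
  intros Ha Hx. rewrite <- (Rinv_inv a) at 1. apply rpow_inv_r; trivial.
  now apply Rinv_0_lt_compat.
Qed.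

Lemma rpow_le_inv x y a : 0 < a -> 0 <= x -> 0 <= y -> rpow x a <= rpow y a -> x <= y.
Proof.
  intros Ha Hx Hy H. rewrite <- (rpow_inv_l x a), <- (rpow_inv_l y a) by lra.
  apply rpow_le; [left; now apply Rinv_0_lt_compat|]. split; [apply rpow_nonneg|trivial].
Qed.

Lemma rpow_2 x : 0 <= x -> rpow x 2 = x ^ 2.
Proof.
  intros Hx. destruct (Req_dec x 0) as [->|Nx]; [rewrite rpow_0; ring|].
  rewrite rpow_Rpower by lra. replace 2 with (INR 2) by (simpl; ring). apply Rpower_pow; lra.
Qed.

(* Weighted AM-GM with exponents [1/p] and [1 - 1/p], from [exp z >= 1 + z]. *)
Lemma rpow_bernoulli p u : 1 <= p -> 0 <= u -> 1 + p * (u - 1) <= rpow u p.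
Proof.
  intros Hp Hu. destruct (Req_dec u 0) as [->|Nu].
  { rewrite rpow_0. lra. }
  rewrite rpow_Rpower by lra. unfold Rpower. set (s := ln u).
  assert (Eu : u = exp s) by (unfold s; rewrite exp_ln; lra).
  pose proof (exp_ineq1_le ((p - 1) * s)) as E1.
  pose proof (exp_ineq1_le (- s)) as E2.
  replace (p * s) with (s + (p - 1) * s) by ring.
  rewrite exp_plus. rewrite exp_Ropp, <- Eu in E2. rewrite <- Eu.
  apply (Rmult_le_compat_l u) in E1; [|lra].
  apply (Rmult_le_compat_l u) in E2; [|lra].
  rewrite Rinv_r in E2 by lra.
  nra.
Qed.

(** Convexity from the tangent line at the mean: after division by [m], the weighted Bernoulli
    bounds at [a / m] and [b / m] have linear terms that cancel. *)
Lemma rpow_jensen p w a b :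
  1 <= p -> 0 <= w <= 1 -> 0 <= a -> 0 <= b ->
  rpow (w * a + (1 - w) * b) p <= w * rpow a p + (1 - w) * rpow b p.
Proof.
  intros Hp Hw Ha Hb. set (m := w * a + (1 - w) * b).
  assert (Hm : 0 <= m) by (unfold m; nra).
  destruct (Req_dec m 0) as [E|Nm].
  { rewrite E, rpow_0. pose proof (rpow_nonneg a p). pose proof (rpow_nonneg b p). nra. }
  assert (Ea : rpow a p = rpow m p * rpow (a / m) p).
  { rewrite <- rpow_mult; [f_equal; field; lra|lra|].
    apply Rmult_le_pos; [lra|left; apply Rinv_0_lt_compat; lra]. }
  assert (Eb : rpow b p = rpow m p * rpow (b / m) p).
  { rewrite <- rpow_mult; [f_equal; field; lra|lra|].
    apply Rmult_le_pos; [lra|left; apply Rinv_0_lt_compat; lra]. }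
  rewrite Ea, Eb.
  assert (Hi : 0 < / m) by (apply Rinv_0_lt_compat; lra).
  pose proof (rpow_bernoulli p (a / m) Hp ltac:(unfold Rdiv; nra)) as B1.
  pose proof (rpow_bernoulli p (b / m) Hp ltac:(unfold Rdiv; nra)) as B2.
  assert (S : w * (a / m) + (1 - w) * (b / m) = 1) by (unfold m in *; field; trivial).
  assert (1 <= w * rpow (a / m) p + (1 - w) * rpow (b / m) p).
  { assert (w * (1 + p * (a / m - 1)) <= w * rpow (a / m) p) by (apply Rmult_le_compat_l; lra).
    assert ((1 - w) * (1 + p * (b / m - 1)) <= (1 - w) * rpow (b / m) p) by (apply Rmult_le_compat_l; lra).
    nra. }
  pose proof (rpow_nonneg m p). nra.
Qed.

(** * Finite sums *)

Lemma lsum_app {I} (f : I -> R) l1 l2 : lsum f (l1 ++ l2) = lsum f l1 + lsum f l2.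
Proof. induction l1; simpl; [ring|]. fold (lsum f (l1 ++ l2)) (lsum f l1). rewrite IHl1. ring. Qed.

Lemma lsum_le {I} (f g : I -> R) l : (forall i, In i l -> f i <= g i) -> lsum f l <= lsum g l.
Proof.
  induction l; simpl; intros H; [lra|]. fold (lsum f l) (lsum g l).
  apply Rplus_le_compat; auto.
Qed.

Lemma lsum_ext {I} (f g : I -> R) l : (forall i, In i l -> f i = g i) -> lsum f l = lsum g l.
Proof. intros H. apply Rle_antisym; apply lsum_le; intros; rewrite H by trivial; lra. Qed.

Lemma lsum_nonneg {I} (f : I -> R) l : (forall i, 0 <= f i) -> 0 <= lsum f l.
Proof. intros H. induction l; simpl; [lra|]. fold (lsum f l). specialize (H a). lra. Qed.

Lemma lsum_plus {I} (f g : I -> R) l : lsum (fun i => f i + g i) l = lsum f l + lsum g l.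
Proof. induction l; simpl; [ring|]. unfold lsum in *. rewrite IHl. ring. Qed.

Lemma lsum_scale {I} c (f : I -> R) l : lsum (fun i => c * f i) l = c * lsum f l.
Proof. induction l; simpl; [ring|]. unfold lsum in *. rewrite IHl. ring. Qed.

Lemma lsum_zero {I} (f : I -> R) l : (forall i, In i l -> f i = 0) -> lsum f l = 0.
Proof.
  induction l as [|a l IH]; simpl; intros H; [reflexivity|].
  change (f a + lsum f l = 0). rewrite IH, H; [ring|simpl; auto|simpl; auto].
Qed.

Lemma lsum_map {I J} (f : I -> R) (g : J -> I) l : lsum f (map g l) = lsum (fun j => f (g j)) l.
Proof. induction l; simpl; [ring|]. unfold lsum in *. rewrite IHl. ring. Qed.

Lemma lsum_incl {I} (f : I -> R) l l' :
  (forall i, 0 <= f i) -> NoDup l -> (forall i, In i l -> f i <> 0 -> In i l') -> lsum f l <= lsum f l'.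
Proof.
  intros Hf Hl. revert l'. induction Hl as [|a l Ha Hl IH]; intros l' Hin.
  { apply lsum_nonneg; trivial. }
  simpl; fold (lsum f l).
  destruct (Req_dec (f a) 0) as [E|N].
  { rewrite E, Rplus_0_l. apply IH. intros; apply Hin; simpl; auto. }
  destruct (in_split a l') as (l1 & l2 & ->); [apply Hin; simpl; auto|].
  rewrite lsum_app; simpl; fold (lsum f l2).
  assert (lsum f l <= lsum f (l1 ++ l2)).
  { apply IH. intros i Hi Hn. assert (Hx : In i (l1 ++ a :: l2)) by (apply Hin; simpl; auto).
    rewrite in_app_iff in *. simpl in Hx. destruct Hx as [|[<-|]]; auto. contradiction. }
  rewrite lsum_app in H. lra.
Qed.

(** * Restriction of vectors *)

Definition restr {I} (P : I -> Prop) (x : vec I) : vec I :=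
  fun i => if excluded_middle_informative (P i) then x i else C0.

Lemma restr_in {I} (P : I -> Prop) x i : P i -> restr P x i = x i.
Proof. intros H. unfold restr. destruct excluded_middle_informative; tauto. Qed.

Lemma restr_out {I} (P : I -> Prop) x i : ~ P i -> restr P x i = C0.
Proof. intros H. unfold restr. destruct excluded_middle_informative; tauto. Qed.

Lemma restr_ext {I} (P Q : I -> Prop) (x : vec I) : (forall i, P i <-> Q i) -> restr P x = restr Q x.
Proof.
  intros H. extensionality i. unfold restr.
  destruct (excluded_middle_informative (P i)), (excluded_middle_informative (Q i)); firstorder.
Qed.

Lemma restr_restr {I} (P Q : I -> Prop) (x : vec I) : restr P (restr Q x) = restr (fun i => P i /\ Q i) x.
Proof.
  extensionality i. unfold restr.
  destruct (excluded_middle_informative (P i)), (excluded_middle_informative (Q i)),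
    (excluded_middle_informative (P i /\ Q i)); tauto.
Qed.

Lemma Cmod_restr {I} (P : I -> Prop) (x : vec I) i : Cmod (restr P x i) <= Cmod (x i).
Proof.
  unfold restr. destruct excluded_middle_informative; [lra|]. rewrite Cmod_C0. apply Cmod_nonneg.
Qed.

Lemma restr_vadd {I} (P : I -> Prop) (x y : vec I) : restr P (vadd x y) = vadd (restr P x) (restr P y).
Proof.
  extensionality i. unfold restr, vadd. destruct excluded_middle_informative; trivial.
  apply Ceq; simpl; ring.
Qed.

Lemma restr_vscale {I} (P : I -> Prop) c (x : vec I) : restr P (vscale c x) = vscale c (restr P x).
Proof.
  extensionality i. unfold restr, vscale. destruct excluded_middle_informative; trivial.
  apply Ceq; simpl; ring.
Qed.

Lemma restr_vsub {I} (P : I -> Prop) (x y : vec I) : restr P (vsub x y) = vsub (restr P x) (restr P y).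
Proof.
  extensionality i. unfold restr, vsub. destruct excluded_middle_informative; trivial.
  apply Ceq; simpl; ring.
Qed.

Lemma restr_compl {I} (P : I -> Prop) (x : vec I) : vadd (restr P x) (restr (fun i => ~ P i) x) = x.
Proof.
  extensionality i. unfold vadd, restr.
  destruct (excluded_middle_informative (P i)), (excluded_middle_informative (~ P i)); try tauto;
    apply Ceq; simpl; ring.
Qed.

(** * Norm bounds *)

Definition pmod {I} (p : R) (x : vec I) (i : I) : R := rpow (Cmod (x i)) p.

Lemma pmod_nonneg {I} p (x : vec I) i : 0 <= pmod p x i.
Proof. apply rpow_nonneg. Qed.

(* [nbound p x c] says that [x] lies in l^p with norm at most [c]. *)
Definition nbound {I} (p : R) (x : vec I) (c : R) : Prop :=
  0 <= c /\ forall l, NoDup l -> lsum (pmod p x) l <= rpow c p.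

Section Norm.
Context (p : R) (Hp : 1 < p).

Lemma rsup_lub (E : R -> Prop) : (exists x, E x) -> (exists M, forall x, E x -> x <= M) -> is_lub E (rsup E).
Proof.
  intros Hne [M HM]. unfold rsup. apply epsilon_spec.
  destruct (completeness E) as [m Hm]; [now exists M|trivial|now exists m].
Qed.

Lemma psum_lub {I} (x : vec I) :
  in_lp p x -> is_lub (fun s => exists l, NoDup l /\ s = lsum (pmod p x) l) (psum (pmod p x)).
Proof.
  intros [M HM]. apply rsup_lub.
  - exists 0, nil. split; [constructor|reflexivity].
  - exists M. intros s (l & Hl & ->). apply HM; trivial.
Qed.

Lemma nbound_lp_norm {I} (x : vec I) : in_lp p x -> nbound p x (lp_norm p x).
Proof.
  intros H. pose proof (psum_lub x H) as [Hu _]. split; [apply rpow_nonneg|]. intros l Hl.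
  unfold lp_norm. fold (pmod p x). rewrite rpow_inv_r; [apply Hu; eauto|lra|].
  apply Hu. exists nil. split; [constructor|reflexivity].
Qed.

Lemma nbound_in_lp {I} (x : vec I) c : nbound p x c -> in_lp p x.
Proof. intros [_ H]. exists (rpow c p). exact H. Qed.

Lemma nbound_norm_le {I} (x : vec I) c : nbound p x c -> lp_norm p x <= c.
Proof.
  intros H. pose proof (psum_lub x (nbound_in_lp x c H)) as [Hu Hl]. destruct H as [Hc H].
  rewrite <- (rpow_inv_l c p) by lra. unfold lp_norm. fold (pmod p x).
  apply rpow_le; [left; apply Rinv_0_lt_compat; lra|]. split.
  - apply Hu. exists nil. split; [constructor|reflexivity].
  - apply Hl. intros s (l & Hn & ->). now apply H.
Qed.

Lemma lp_norm_nonneg {I} (x : vec I) : 0 <= lp_norm p x.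
Proof. apply rpow_nonneg. Qed.

Lemma nbound_weaken {I} (x : vec I) c c' : c <= c' -> nbound p x c -> nbound p x c'.
Proof.
  intros H [Hc Hb]. split; [lra|]. intros l Hl. eapply Rle_trans; [apply Hb; trivial|].
  apply rpow_le; lra.
Qed.

Lemma nbound_le_norm {I} (x : vec I) c : in_lp p x -> lp_norm p x <= c -> nbound p x c.
Proof. intros H Hc. eapply nbound_weaken; [apply Hc|]. now apply nbound_lp_norm. Qed.

Lemma nbound_coord {I} (x : vec I) c i : nbound p x c -> Cmod (x i) <= c.
Proof.
  intros [Hc H]. apply (rpow_le_inv _ _ p); trivial; [lra|apply Cmod_nonneg|].
  specialize (H (i :: nil)). simpl in H. rewrite Rplus_0_r in H. apply H.
  repeat constructor. intros [].
Qed.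

(** Changes of coordinates go through this bound. Domination and injectivity are asked only on the
    support of [y], so [f] may take junk values elsewhere. *)
Lemma nbound_reindex {I J} (x : vec I) (y : vec J) (f : J -> I) r c :
  0 <= r ->
  (forall j, y j <> C0 -> Cmod (y j) <= r * Cmod (x (f j))) ->
  (forall j j', y j <> C0 -> y j' <> C0 -> f j = f j' -> j = j') ->
  nbound p x c -> nbound p y (r * c).
Proof.
  intros Hr Hy Hinj [Hc H]. split; [nra|]. intros l Hl.
  set (l' := filter (fun j => if excluded_middle_informative (y j = C0) then false else true) l).
  assert (Hin : forall j, In j l' <-> In j l /\ y j <> C0).
  { intros j. unfold l'. rewrite filter_In. destruct excluded_middle_informative; intuition discriminate. }
  apply Rle_trans with (lsum (pmod p y) l').
  { apply lsum_incl; trivial; [apply pmod_nonneg|]. intros j Hj Hn. apply Hin. split; trivial.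
    intros E. apply Hn. unfold pmod. rewrite E, Cmod_C0. apply rpow_0. }
  apply Rle_trans with (lsum (fun j => rpow r p * pmod p x (f j)) l').
  { apply lsum_le. intros j Hj. apply Hin in Hj. unfold pmod. rewrite <- rpow_mult; trivial; [|apply Cmod_nonneg].
    apply rpow_le; [lra|]. split; [apply Cmod_nonneg|apply Hy; tauto]. }
  rewrite lsum_scale, <- lsum_map, rpow_mult by trivial.
  apply Rmult_le_compat_l; [apply rpow_nonneg|]. apply H.
  assert (Nl : NoDup l') by now apply NoDup_filter.
  clear - Nl Hin Hinj. assert (Hy : forall j, In j l' -> y j <> C0) by (intros; now apply Hin).
  clear Hin. induction Nl as [|j0 l0 Hj0 Nl IHNl]; simpl; constructor.
  - rewrite in_map_iff. intros (j & E & Hj). assert (j = j0) by (apply Hinj; simpl in *; auto). subst; contradiction.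
  - apply IHNl. simpl in Hy; auto.
Qed.

Lemma nbound_dom {I} (x y : vec I) r c :
  0 <= r -> (forall i, Cmod (y i) <= r * Cmod (x i)) -> nbound p x c -> nbound p y (r * c).
Proof. intros Hr H. apply (nbound_reindex x y (fun i => i)); auto. Qed.

Lemma nbound_le {I} (x y : vec I) c :
  (forall i, Cmod (y i) <= Cmod (x i)) -> nbound p x c -> nbound p y c.
Proof. intros H Hx. rewrite <- (Rmult_1_l c). apply (nbound_dom x); trivial; [lra|]. intros; rewrite Rmult_1_l; auto. Qed.

Lemma nbound_restr {I} (P : I -> Prop) (x : vec I) c : nbound p x c -> nbound p (restr P x) c.
Proof. apply nbound_le. intros. apply Cmod_restr. Qed.

Lemma nbound_vscale {I} z (x : vec I) c : nbound p x c -> nbound p (vscale z x) (Cmod z * c).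
Proof.
  apply nbound_dom; [apply Cmod_nonneg|]. intros i. unfold vscale. rewrite Cmod_mul. lra.
Qed.

Lemma nbound_zero {I} (x : vec I) c : 0 <= c -> (forall i, x i = C0) -> nbound p x c.
Proof.
  intros Hc H. split; trivial. intros l _. rewrite lsum_zero; [apply rpow_nonneg|].
  intros i _. unfold pmod. rewrite H, Cmod_C0. apply rpow_0.
Qed.

Lemma nbound_0_inv {I} (x : vec I) : nbound p x 0 -> forall i, x i = C0.
Proof.
  intros H i. apply Cmod_eq_0. pose proof (nbound_coord x 0 i H). pose proof (Cmod_nonneg (x i)). lra.
Qed.

(* Minkowski: [|x + y| / (a + b)] is dominated by a convex combination of [|x| / a] and [|y| / b]. *)
Lemma nbound_vadd {I} (x y : vec I) a b : nbound p x a -> nbound p y b -> nbound p (vadd x y) (a + b).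
Proof.
  intros Hx Hy. pose proof (proj1 Hx) as Ha. pose proof (proj1 Hy) as Hb.
  destruct (Req_dec a 0) as [Ea|Na].
  { subst. rewrite Rplus_0_l. revert Hy. apply nbound_le. intros i. unfold vadd.
    rewrite (nbound_0_inv x Hx i). eapply Rle_trans; [apply Cmod_add|]. rewrite Cmod_C0. lra. }
  destruct (Req_dec b 0) as [Eb|Nb].
  { subst. rewrite Rplus_0_r. revert Hx. apply nbound_le. intros i. unfold vadd.
    rewrite (nbound_0_inv y Hy i). eapply Rle_trans; [apply Cmod_add|]. rewrite Cmod_C0. lra. }
  split; [lra|]. intros l Hl. destruct Hx as [_ Hx], Hy as [_ Hy]. specialize (Hx l Hl). specialize (Hy l Hl).
  set (w := a / (a + b)).
  assert (Hw : 0 <= w <= 1).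
  { unfold w. split; [apply Rmult_le_pos; [lra|left; apply Rinv_0_lt_compat; lra]|].
    apply Rmult_le_reg_r with (a + b); [lra|]. unfold Rdiv. rewrite Rmult_assoc, Rinv_l; lra. }
  assert (Hia : 0 < / a) by (apply Rinv_0_lt_compat; lra).
  assert (Hib : 0 < / b) by (apply Rinv_0_lt_compat; lra).
  apply Rle_trans with
    (lsum (fun i => rpow (a + b) p * (w * (rpow (/ a) p * pmod p x i) + (1 - w) * (rpow (/ b) p * pmod p y i))) l).
  - apply lsum_le. intros i _. unfold pmod.
    pose proof (Cmod_nonneg (x i)). pose proof (Cmod_nonneg (y i)).
    assert (0 <= / a * Cmod (x i)) by (apply Rmult_le_pos; lra).
    assert (0 <= / b * Cmod (y i)) by (apply Rmult_le_pos; lra).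
    rewrite <- !(rpow_mult (/ _)) by lra.
    eapply Rle_trans; [|apply Rmult_le_compat_l; [apply rpow_nonneg|apply rpow_jensen; lra]].
    rewrite <- rpow_mult; [|lra|apply Rplus_le_le_0_compat; apply Rmult_le_pos; lra].
    apply rpow_le; [lra|]. split; [apply Cmod_nonneg|].
    eapply Rle_trans; [apply Cmod_add|]. right. unfold w. field. lra.
  - rewrite lsum_scale, lsum_plus, !lsum_scale.
    assert (Ia : rpow (/ a) p * rpow a p = 1).
    { rewrite <- rpow_mult, Rinv_l by lra. rewrite rpow_Rpower by lra. unfold Rpower. rewrite ln_1, Rmult_0_r. apply exp_0. }
    assert (Ib : rpow (/ b) p * rpow b p = 1).
    { rewrite <- rpow_mult, Rinv_l by lra. rewrite rpow_Rpower by lra. unfold Rpower. rewrite ln_1, Rmult_0_r. apply exp_0. }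
    assert (Ba : rpow (/ a) p * lsum (pmod p x) l <= 1).
    { rewrite <- Ia. apply Rmult_le_compat_l; [apply rpow_nonneg|trivial]. }
    assert (Bb : rpow (/ b) p * lsum (pmod p y) l <= 1).
    { rewrite <- Ib. apply Rmult_le_compat_l; [apply rpow_nonneg|trivial]. }
    change (lsum (fun i => pmod p x i) l) with (lsum (pmod p x) l).
    change (lsum (fun i => pmod p y i) l) with (lsum (pmod p y) l).
    pose proof (rpow_nonneg (a + b) p). rewrite <- (Rmult_1_r (rpow (a + b) p)) at 2.
    apply Rmult_le_compat_l; trivial. nra.
Qed.

Lemma nbound_vsub {I} (x y : vec I) a b : nbound p x a -> nbound p y b -> nbound p (vsub x y) (a + b).
Proof.
  intros Hx Hy. apply (nbound_vadd x (fun i => Copp (y i))); trivial.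
  revert Hy. apply nbound_le. intros i. rewrite Cmod_opp. lra.
Qed.

(** A pointwise majorant of moduli suffices, so sums of error terms can be estimated without writing
    [z] as an exact sum. *)
Lemma nbound_add_dom {I} (x y z : vec I) a b :
  (forall i, Cmod (z i) <= Cmod (x i) + Cmod (y i)) ->
  nbound p x a -> nbound p y b -> nbound p z (a + b).
Proof.
  intros Hz Hx Hy.
  apply (nbound_le (vadd (fun i => (Cmod (x i), 0)) (fun i => (Cmod (y i), 0)))).
  - intros i. unfold vadd, Cadd; simpl. replace (0 + 0) with 0 by ring. rewrite Cmod_real.
    eapply Rle_trans; [apply Hz|]. apply Rle_abs.
  - apply nbound_vadd; [apply (nbound_le x)|apply (nbound_le y)]; trivial;
      intros i; rewrite Cmod_real, Rabs_right; try lra; apply Rle_ge, Cmod_nonneg.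
Qed.

Lemma nbound_lsum_dom {I A} (l : list A) (f : A -> vec I) (c : A -> R) (z : vec I) :
  (forall i, Cmod (z i) <= lsum (fun a => Cmod (f a i)) l) ->
  (forall a, In a l -> nbound p (f a) (c a)) -> nbound p z (lsum c l).
Proof.
  revert z. induction l as [|a l IH]; intros z Hz Hf.
  - apply nbound_zero; [simpl; lra|]. intros i. apply Cmod_eq_0. apply Rle_antisym; [apply Hz|apply Cmod_nonneg].
  - simpl; fold (lsum c l).
    set (g := (fun i => (lsum (fun a => Cmod (f a i)) l, 0)) : vec I).
    assert (Hg : forall i, Cmod (g i) = lsum (fun a => Cmod (f a i)) l).
    { intros i. unfold g. rewrite Cmod_real. apply Rabs_right, Rle_ge, lsum_nonneg. intros; apply Cmod_nonneg. }
    apply (nbound_add_dom (f a) g).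
    + intros i. rewrite Hg. apply Hz.
    + apply Hf; simpl; auto.
    + apply IH; [|intros; apply Hf; simpl; auto]. intros i. rewrite Hg. lra.
Qed.

(** * Tails, splittings and block decompositions of vectors *)

(** A finite set that nearly attains the supremum leaves almost nothing: further coordinates would
    push a partial sum above [psum]. *)
Lemma nbound_tail {I} (x : vec I) c eps :
  nbound p x c -> 0 < eps -> exists l, nbound p (restr (fun i => ~ In i l) x) eps.
Proof.
  intros Hx He. pose proof (psum_lub x (nbound_in_lp x c Hx)) as [Hu Hl].
  set (s := psum (pmod p x)) in *.
  assert (Hpos : 0 < rpow eps p) by now apply rpow_pos.
  destruct (classic (exists l, NoDup l /\ s - rpow eps p < lsum (pmod p x) l)) as [(l & Nl & Hs)|N].
  2:{ exfalso. assert (s <= s - rpow eps p); [|lra]. apply Hl. intros r (l & Nl & ->).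
      apply Rnot_lt_le. intros H. apply N. eauto. }
  exists l. split; [lra|]. intros l' Nl'.
  set (l2 := filter (fun i => if excluded_middle_informative (In i l) then false else true) l').
  assert (H2 : forall i, In i l2 <-> In i l' /\ ~ In i l).
  { intros i. unfold l2. rewrite filter_In. destruct excluded_middle_informative; intuition discriminate. }
  assert (Hsum : lsum (pmod p (restr (fun i => ~ In i l) x)) l' <= lsum (pmod p x) l2).
  { apply Rle_trans with (lsum (pmod p (restr (fun i => ~ In i l) x)) l2).
    - apply lsum_incl; trivial; [apply pmod_nonneg|]. intros i Hi Hn. apply H2. split; trivial.
      intros Hil. apply Hn. unfold pmod. rewrite restr_out by tauto. rewrite Cmod_C0. apply rpow_0.
    - apply lsum_le. intros i Hi. unfold pmod. apply rpow_le; [lra|]. split; [apply Cmod_nonneg|apply Cmod_restr]. }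
  assert (lsum (pmod p x) (l ++ l2) <= s).
  { apply Hu. eexists; split; [|reflexivity]. apply NoDup_app; trivial; [now apply NoDup_filter|].
    intros i Hi Hi2. apply H2 in Hi2. tauto. }
  rewrite lsum_app in H. lra.
Qed.

Lemma nbound_closed {I} (x : vec I) c : (forall eps, 0 < eps -> nbound p x (c + eps)) -> nbound p x c.
Proof.
  intros H.
  assert (Hc : 0 <= c).
  { apply Rnot_lt_le. intros Hc. destruct (H (- c / 2)); lra. }
  apply nbound_le_norm; [apply (nbound_in_lp x (c + 1)), H; lra|].
  apply le_epsilon. intros eps He. apply nbound_norm_le, H, He.
Qed.

(** Additivity of the p-th power of the norm over complementary sets. The complement is given
    whatever the supremum over [P] leaves of [rpow c p]. *)
Lemma nbound_split {I} (P : I -> Prop) (x : vec I) c :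
  nbound p x c ->
  exists a b, nbound p (restr P x) a /\ nbound p (restr (fun i => ~ P i) x) b /\ rpow a p + rpow b p <= rpow c p.
Proof.
  intros Hx. pose proof (nbound_restr P x c Hx) as Hr.
  assert (Ha : nbound p (restr P x) (lp_norm p (restr P x))) by (apply nbound_lp_norm; eapply nbound_in_lp; eauto).
  pose proof (psum_lub _ (nbound_in_lp _ _ Hr)) as [Hu Hl].
  assert (E : rpow (lp_norm p (restr P x)) p = psum (pmod p (restr P x))).
  { unfold lp_norm. fold (pmod p (restr P x)). apply rpow_inv_r; [lra|]. apply Hu. exists nil. split; [constructor|reflexivity]. }
  set (s := psum (pmod p (restr P x))) in *.
  assert (Hs : forall l, NoDup l -> lsum (pmod p (restr (fun i => ~ P i) x)) l <= rpow c p - s).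
  { intros l Nl. assert (s <= rpow c p - lsum (pmod p (restr (fun i => ~ P i) x)) l); [|lra].
    apply Hl. intros r (l' & Nl' & ->).
    set (g := fun i => if excluded_middle_informative (P i) then true else false).
    assert (H1 : lsum (pmod p (restr P x)) l' <= lsum (pmod p x) (filter g l')).
    { apply Rle_trans with (lsum (pmod p (restr P x)) (filter g l')).
      - apply lsum_incl; trivial; [apply pmod_nonneg|]. intros i Hi Hn. apply filter_In. split; trivial.
        unfold g. destruct excluded_middle_informative; trivial. exfalso. apply Hn. unfold pmod.
        rewrite restr_out, Cmod_C0 by trivial. apply rpow_0.
      - apply lsum_le. intros i Hi. apply rpow_le; [lra|]. split; [apply Cmod_nonneg|apply Cmod_restr]. }
    assert (H2 : lsum (pmod p (restr (fun i => ~ P i) x)) l <= lsum (pmod p x) (filter (fun i => negb (g i)) l)).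
    { apply Rle_trans with (lsum (pmod p (restr (fun i => ~ P i) x)) (filter (fun i => negb (g i)) l)).
      - apply lsum_incl; trivial; [apply pmod_nonneg|]. intros i Hi Hn. apply filter_In. split; trivial.
        unfold g. destruct excluded_middle_informative; trivial. exfalso. apply Hn. unfold pmod.
        rewrite restr_out, Cmod_C0 by tauto. apply rpow_0.
      - apply lsum_le. intros i Hi. apply rpow_le; [lra|]. split; [apply Cmod_nonneg|apply Cmod_restr]. }
    assert (H3 : lsum (pmod p x) (filter g l' ++ filter (fun i => negb (g i)) l) <= rpow c p).
    { apply Hx. apply NoDup_app; try now apply NoDup_filter.
      intros i Hi Hi2. apply filter_In in Hi, Hi2. destruct Hi as [_ Hi], Hi2 as [_ Hi2]. rewrite Hi in Hi2. discriminate. }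
    rewrite lsum_app in H3. lra. }
  assert (H0 : 0 <= rpow c p - s) by (apply (Hs nil); constructor).
  exists (lp_norm p (restr P x)), (rpow (rpow c p - s) (/ p)).
  split; [trivial|]. rewrite E, rpow_inv_r by lra. split; [|lra].
  split; [apply rpow_nonneg|]. intros l Nl. rewrite rpow_inv_r by lra. auto.
Qed.

Lemma nbound_join {I} (P : I -> Prop) (x : vec I) a b c :
  0 <= c -> nbound p (restr P x) a -> nbound p (restr (fun i => ~ P i) x) b -> rpow a p + rpow b p <= rpow c p ->
  nbound p x c.
Proof.
  intros Hc [_ Ha] [_ Hb] H. split; trivial. intros l Nl.
  specialize (Ha l Nl). specialize (Hb l Nl).
  rewrite (lsum_ext _ (fun i => pmod p (restr P x) i + pmod p (restr (fun i => ~ P i) x) i)).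
  - rewrite lsum_plus. unfold lsum in *. lra.
  - intros i _. unfold pmod, restr.
    destruct (excluded_middle_informative (P i)), (excluded_middle_informative (~ P i)); try tauto;
      rewrite Cmod_C0, rpow_0; ring.
Qed.

(** The labels match each block of [x] with the block of [y] that it controls, and p-additivity
    keeps the constant from growing with the number of blocks. Finitely many labels suffice, since a
    finite partial sum meets only finitely many blocks. *)
Lemma nbound_blocks {I J K} (b' : I -> K) (b : J -> K) (x : vec I) (y : vec J) r c :
  0 <= r ->
  (forall k m, nbound p (restr (fun i => b' i = k) x) m -> nbound p (restr (fun j => b j = k) y) (r * m)) ->
  nbound p x c -> nbound p y (r * c).
Proof.
  intros Hr H Hx.
  assert (Hk : forall ks c, nbound p (restr (fun i => In (b' i) ks) x) c ->
                            nbound p (restr (fun j => In (b j) ks) y) (r * c)).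
  { induction ks as [|k ks IH]; intros d Hd.
    - apply nbound_zero; [destruct Hd; nra|]. intros j. apply restr_out. intros [].
    - destruct (classic (In k ks)) as [Hin|Hn].
      + rewrite (restr_ext _ (fun j => In (b j) ks)). apply IH.
        rewrite (restr_ext _ (fun i => In (b' i) (k :: ks))); trivial.
        * intros i; simpl; intuition congruence.
        * intros j; simpl; intuition congruence.
      + pose proof (proj1 Hd) as Hd0.
        destruct (nbound_split (fun i => b' i = k) _ _ Hd) as (m1 & m2 & H1 & H2 & Hm).
        rewrite restr_restr in H1, H2.
        rewrite (restr_ext _ (fun i => b' i = k)) in H1 by (intros i; simpl; intuition congruence).
        rewrite (restr_ext _ (fun i => In (b' i) ks)) in H2 by (intros i; simpl; intuition congruence).
        pose proof (proj1 H1). pose proof (proj1 H2).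
        apply (nbound_join (fun j => b j = k) _ (r * m1) (r * m2)); [nra| | |].
        * rewrite restr_restr, (restr_ext _ (fun i => b i = k)) by (intros i; simpl; intuition congruence). auto.
        * rewrite restr_restr, (restr_ext _ (fun i => In (b i) ks)) by (intros i; simpl; intuition congruence). auto.
        * rewrite !rpow_mult by trivial. pose proof (rpow_nonneg r p). nra. }
  split; [destruct Hx; nra|]. intros l Nl.
  specialize (Hk (map b l) c (nbound_restr _ _ _ Hx)). destruct Hk as [_ Hk]. specialize (Hk l Nl).
  erewrite lsum_ext; [apply Hk|]. intros j Hj. unfold pmod. rewrite restr_in; trivial. now apply in_map.
Qed.

(* Schur-type bound: a sparse operator matrix, with at most [A] entries in each row and
   column, has norm at most [A * A] times the largest entry. *)
Lemma nbound_sparse {K L E E'} (nbr : K -> list L) (back : L -> list K) (A : nat)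
  (x : vec (L * E')) (y : vec (K * E)) (z : K -> L -> vec E) r c :
  0 <= r ->
  (forall k, (length (nbr k) <= A)%nat) -> (forall l, (length (back l) <= A)%nat) ->
  (forall k l, In l (nbr k) -> In k (back l)) ->
  (forall k l m, In l (nbr k) -> nbound p (fun e => x (l, e)) m -> nbound p (z k l) (r * m)) ->
  (forall k e, Cmod (y (k, e)) <= lsum (fun l => Cmod (z k l e)) (nbr k)) ->
  nbound p x c -> nbound p y (INR A * (INR A * (r * c))).
Proof.
  intros Hr Hn Hb Hnb Hz Hy Hx.
  assert (Hxc : 0 <= c) by apply Hx.
  assert (Hsum : forall (f : nat -> R) d, (forall a, f a = d) -> lsum f (seq 0 A) = INR A * d).
  { intros f d Hf. rewrite (lsum_ext _ (fun _ => d)) by auto. generalize 0%nat. clear.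
    induction A; intros n; [simpl; ring|]. rewrite S_INR. simpl. unfold lsum in *. rewrite IHA. ring. }
  set (ya := fun a (ke : K * E) => match nth_error (nbr (fst ke)) a with
                                   | Some l => z (fst ke) l (snd ke) | None => C0 end).
  (* The matrix is cut into [A * A] layers by the position [a] of [l] in the row list and the
     position [b] of [k] in the column list. A layer has at most one entry in each row and column,
     so it is bounded by [r] blockwise. *)
  set (yab := fun a b (ke : K * E) =>
    match nth_error (nbr (fst ke)) a with
    | Some l => if excluded_middle_informative (nth_error (back l) b = Some (fst ke))
                then z (fst ke) l (snd ke) else C0
    | None => C0 end).
  assert (Habn : forall a b, nbound p (yab a b) (r * c)).
  { intros a b.
    (* Coordinates where the layer vanishes get the label [None], which no coordinate of [x]
       carries. *)
    apply (nbound_blocks (K := option L) (fun le => Some (fst le))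
      (fun ke => if excluded_middle_informative (yab a b ke = C0) then None else nth_error (nbr (fst ke)) a) x);
      trivial.
    intros [l|] m Hm.
    2:{ apply nbound_zero; [destruct Hm; nra|]. intros [k e].
        destruct (classic (yab a b (k, e) = C0)) as [H0|H0].
        - unfold restr. destruct excluded_middle_informative; trivial.
        - rewrite restr_out; trivial. destruct excluded_middle_informative; [contradiction|].
          intros En. apply H0. unfold yab. simpl in *. rewrite En. trivial. }
    assert (Hm' : nbound p (fun e => x (l, e)) m).
    { rewrite <- (Rmult_1_l m). apply (nbound_reindex (restr (fun i => Some (fst i) = Some l) x) _ (fun e => (l, e))); trivial; [lra| |congruence].
      intros e _. rewrite restr_in by reflexivity. lra. }
    assert (Hact : forall k e, restr (fun j => (if excluded_middle_informative (yab a b j = C0) then None else nth_error (nbr (fst j)) a) = Some l) (yab a b) (k, e) <> C0 ->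
        nth_error (nbr k) a = Some l /\ nth_error (back l) b = Some k /\ yab a b (k, e) = z k l e).
    { intros k e H. unfold restr in H. destruct excluded_middle_informative as [Q|Q]; [|contradiction].
      destruct (excluded_middle_informative (yab a b (k, e) = C0)); [discriminate|]. simpl in Q.
      unfold yab in *. simpl in *. rewrite Q in *. destruct excluded_middle_informative; [auto|contradiction]. }
    destruct (nth_error (back l) b) as [k0|] eqn:Ek.
    2:{ apply nbound_zero; [destruct Hm; nra|]. intros [k e]. apply NNPP. intros H. apply Hact in H. destruct H as (_ & H & _). discriminate. }
    destruct (classic (nth_error (nbr k0) a = Some l)) as [En|En].
    2:{ apply nbound_zero; [destruct Hm; nra|]. intros [k e]. apply NNPP. intros H. apply Hact in H. destruct H as (H1 & H2 & _). congruence. }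
    assert (Hzz : nbound p (z k0 l) (r * m)) by (apply Hz; trivial; eapply nth_error_In; eauto).
    rewrite <- (Rmult_1_l (r * m)). apply (nbound_reindex (z k0 l) _ snd); trivial; [lra| |].
    - intros [k e] H. destruct (Hact _ _ H) as (_ & H2 & H3).
      eapply Rle_trans; [apply Cmod_restr|]. rewrite H3. simpl. injection H2 as ->. lra.
    - intros [k e] [k' e'] H H' Ee. destruct (Hact _ _ H) as (_ & H2 & _). destruct (Hact _ _ H') as (_ & H2' & _).
      simpl in Ee. congruence. }
  rewrite <- (Hsum (fun _ => INR A * (r * c))) by trivial.
  apply (nbound_lsum_dom (seq 0 A) ya).
  - intros [k e]. eapply Rle_trans; [apply Hy|]. unfold ya; simpl.
    specialize (Hn k). revert Hn. clear. generalize (nbr k) as l.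
    intros l Hl.
    assert (G : forall n s, (length l <= n)%nat ->
       lsum (fun l0 => Cmod (z k l0 e)) l <= lsum (fun a => Cmod match nth_error l (a - s) with Some l0 => z k l0 e | None => C0 end) (seq s n)).
    { clear. induction l as [|b l IH]; intros n s Hl.
      - apply lsum_nonneg. intros; apply Cmod_nonneg.
      - destruct n as [|n]; [simpl in Hl; lia|]. simpl. rewrite Nat.sub_diag. simpl.
        apply Rplus_le_compat_l. simpl in Hl. eapply Rle_trans; [apply (IH n (S s)); lia|].
        apply lsum_le. intros a Ha. apply in_seq in Ha. replace (a - s)%nat with (S (a - S s)) by lia. simpl. lra. }
    eapply Rle_trans; [apply (G A 0%nat Hl)|]. apply lsum_le. intros a _. rewrite Nat.sub_0_r. lra.
  - intros a _. rewrite <- (Hsum (fun _ => r * c)) by trivial.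
    apply (nbound_lsum_dom (seq 0 A) (yab a)); [|auto].
    intros [k e]. unfold ya, yab; simpl. destruct (nth_error (nbr k) a) as [l|] eqn:El.
    + assert (Hin : In k (back l)) by (apply Hnb; eapply nth_error_In; eauto).
      apply In_nth_error in Hin. destruct Hin as [b Eb].
      assert (Hb' : (b < A)%nat). { specialize (Hb l). assert (b < length (back l))%nat by (apply nth_error_Some; congruence). lia. }
      eapply Rle_trans; [|apply (lsum_incl _ (b :: nil))].
      * simpl. rewrite Rplus_0_r. destruct excluded_middle_informative; [lra|contradiction].
      * intros; apply Cmod_nonneg.
      * repeat constructor; intros [].
      * intros i [<-|[]] _. apply in_seq. lia.
    + rewrite Cmod_C0. apply lsum_nonneg. intros; lra.
Qed.

End Norm.

(** * Bounded operators *)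

Section Operators.
Context (p : R) (Hp : 1 < p).

Definition linear_op {I J} (T : op I J) : Prop :=
  forall c x y, in_lp p x -> in_lp p y ->
    T (vadd (vscale c x) y) = vadd (vscale c (T x)) (T y).

(** Phrased through [nbound], this says at once that [T] preserves l^p and that [c] bounds it; the
    suprema hidden in the norms matter only at the interface with the definitions of the theorem. *)
Definition opbound {I J} (T : op I J) (c : R) : Prop :=
  0 <= c /\ forall x m, nbound p x m -> nbound p (T x) (c * m).

Lemma bounded_op_iff {I J} (T : op I J) :
  is_bounded_op p T <-> linear_op T /\ exists c, opbound T c.
Proof.
  split.
  - intros (H1 & H2 & [M H3]). split.
    + intros c x y Hx Hy. extensionality j. auto.
    + exists (Rmax M 0). split; [apply Rmax_r|]. intros x m Hm.
      pose proof (nbound_in_lp p x m Hm) as Hx. apply nbound_le_norm; auto.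
      eapply Rle_trans; [apply H3; trivial|]. pose proof (nbound_norm_le p Hp x m Hm).
      pose proof (lp_norm_nonneg p x). pose proof (Rmax_l M 0). pose proof (Rmax_r M 0). nra.
  - intros (H1 & c & Hc & H2). split; [|split].
    + intros x Hx. eapply nbound_in_lp, H2, nbound_lp_norm; trivial.
    + intros d x y Hx Hy j. now rewrite H1.
    + exists c. intros x Hx. apply nbound_norm_le, H2, nbound_lp_norm; trivial.
Qed.

Lemma nbound_vscale_real {I} r (x : vec I) c : 0 <= r -> nbound p x c -> nbound p (vscale (r, 0) x) (r * c).
Proof.
  intros Hr Hx. rewrite <- (Rabs_right r) at 2 by lra. rewrite <- Cmod_real. now apply nbound_vscale.
Qed.

Lemma in_lp_zero {I} : in_lp p (fun _ : I => C0).
Proof. apply (nbound_in_lp p _ 0), nbound_zero; trivial; lra. Qed.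

Lemma in_lp_vadd {I} (x y : vec I) : in_lp p x -> in_lp p y -> in_lp p (vadd x y).
Proof.
  intros Hx Hy. apply (nbound_in_lp p _ (lp_norm p x + lp_norm p y)).
  apply nbound_vadd; trivial; now apply nbound_lp_norm.
Qed.

Lemma in_lp_vscale {I} c (x : vec I) : in_lp p x -> in_lp p (vscale c x).
Proof. intros Hx. eapply nbound_in_lp, nbound_vscale, nbound_lp_norm; trivial. Qed.

Lemma in_lp_restr {I} P (x : vec I) : in_lp p x -> in_lp p (restr P x).
Proof. intros Hx. eapply nbound_in_lp, nbound_restr, nbound_lp_norm; trivial. Qed.

Lemma in_lp_opbound {I J} (T : op I J) c x : opbound T c -> in_lp p x -> in_lp p (T x).
Proof. intros [_ H] Hx. eapply nbound_in_lp, H, nbound_lp_norm; trivial. Qed.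

Lemma vscale_1 {I} (x : vec I) : vscale (1, 0) x = x.
Proof. extensionality i. unfold vscale. apply Ceq; simpl; ring. Qed.

Lemma vadd_0_r {I} (x : vec I) : vadd x (fun _ => C0) = x.
Proof. extensionality i. unfold vadd. apply Ceq; simpl; ring. Qed.

Lemma lin_vadd {I J} (T : op I J) x y : linear_op T -> in_lp p x -> in_lp p y -> T (vadd x y) = vadd (T x) (T y).
Proof. intros HT Hx Hy. rewrite <- (vscale_1 x), HT, !vscale_1; trivial. Qed.

Lemma lin_0 {I J} (T : op I J) : linear_op T -> T (fun _ => C0) = fun _ => C0.
Proof.
  intros HT. pose proof (lin_vadd T _ _ HT in_lp_zero in_lp_zero) as H.
  rewrite vadd_0_r in H. extensionality j. apply (f_equal (fun f => f j)) in H. unfold vadd in H.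
  set (z := T (fun _ : I => C0) j) in *. apply Ceq.
  - apply (f_equal fst) in H. simpl in *. lra.
  - apply (f_equal snd) in H. simpl in *. lra.
Qed.

Lemma lin_vscale {I J} (T : op I J) c x : linear_op T -> in_lp p x -> T (vscale c x) = vscale c (T x).
Proof.
  intros HT Hx. rewrite <- (vadd_0_r (vscale c x)), HT, lin_0, vadd_0_r; trivial. apply in_lp_zero.
Qed.

Lemma opbound_opnorm {I J} (T : op I J) : is_bounded_op p T -> opbound T (opnorm p T).
Proof.
  intros H. apply bounded_op_iff in H. destruct H as (HL & c & Hc & HT).
  assert (Hlub : is_lub (fun r => exists x, in_lp p x /\ lp_norm p x <= 1 /\ r = lp_norm p (T x)) (opnorm p T)).
  { apply rsup_lub.
    - exists (lp_norm p (T (fun _ => C0))), (fun _ => C0). split; [apply in_lp_zero|]. split; trivial.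
      apply nbound_norm_le; trivial. apply nbound_zero; trivial; lra.
    - exists c. intros r (x & Hx & H1 & ->). apply nbound_norm_le; trivial. rewrite <- (Rmult_1_r c). apply HT.
      apply nbound_le_norm; trivial. }
  destruct Hlub as [Hu _].
  assert (H0 : 0 <= opnorm p T).
  { eapply Rle_trans; [apply (lp_norm_nonneg p (T (fun _ => C0)))|]. apply Hu.
    exists (fun _ => C0). split; [apply in_lp_zero|]. split; trivial.
    apply nbound_norm_le; trivial. apply nbound_zero; trivial; lra. }
  split; trivial. intros x m Hx. destruct (Req_dec m 0) as [->|Hm].
  { rewrite Rmult_0_r. specialize (HT x 0 Hx). now rewrite Rmult_0_r in HT. }
  assert (Hm' : 0 < m) by (destruct Hx; lra).
  pose proof (Rinv_0_lt_compat m Hm') as Hi.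
  assert (Hxl : in_lp p x) by (eapply nbound_in_lp; eauto).
  pose proof (nbound_vscale p Hp (/ m, 0) x m Hx) as Hy. rewrite Cmod_real, Rabs_right, Rinv_l in Hy by lra.
  assert (E : T x = vscale (m, 0) (T (vscale (/ m, 0) x))).
  { rewrite <- lin_vscale; trivial; [|eapply nbound_in_lp; eauto]. f_equal.
    extensionality i. unfold vscale. apply Ceq; simpl; field; lra. }
  rewrite E, Rmult_comm. apply nbound_vscale_real; [lra|]. apply nbound_le_norm; trivial.
  - eapply nbound_in_lp, HT; eauto.
  - apply Hu. exists (vscale (/ m, 0) x). split; [eapply nbound_in_lp; eauto|]. split; trivial.
    apply nbound_norm_le; trivial.
Qed.

Lemma opnorm_le {I J} (T : op I J) c : opbound T c -> opnorm p T <= c.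
Proof.
  intros [Hc HT]. apply (rsup_lub (fun r => exists x, in_lp p x /\ lp_norm p x <= 1 /\ r = lp_norm p (T x))).
  - exists (lp_norm p (T (fun _ => C0))), (fun _ => C0). split; [apply in_lp_zero|]. split; trivial.
    apply nbound_norm_le; trivial. apply nbound_zero; trivial; lra.
  - exists c. intros r (x & Hx & H1 & ->). apply nbound_norm_le; trivial. rewrite <- (Rmult_1_r c). apply HT.
    apply nbound_le_norm; trivial.
  - intros r (x & Hx & H1 & ->). apply nbound_norm_le; trivial. rewrite <- (Rmult_1_r c). apply HT.
    apply nbound_le_norm; trivial.
Qed.

Lemma opbound_weaken {I J} (T : op I J) c d : c <= d -> opbound T c -> opbound T d.
Proof.
  intros H [Hc HT]. split; [lra|]. intros x m Hx. eapply nbound_weaken; [trivial| |apply HT, Hx].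
  destruct Hx. nra.
Qed.

Lemma opbound_comp {I J K} (S : op J K) (T : op I J) c d :
  opbound S c -> opbound T d -> opbound (fun x => S (T x)) (c * d).
Proof.
  intros [Hc HS] [Hd HT]. split; [nra|]. intros x m Hx. rewrite Rmult_assoc. auto.
Qed.

Lemma linear_comp {I J K} (S : op J K) (T : op I J) d :
  linear_op S -> linear_op T -> opbound T d -> linear_op (fun x => S (T x)).
Proof.
  intros HS HT Hd c x y Hx Hy. rewrite HT, HS; trivial; eapply in_lp_opbound; eauto.
Qed.

Lemma opbound_opsub {I J} (S T : op I J) c d : opbound S c -> opbound T d -> opbound (opsub S T) (c + d).
Proof.
  intros [Hc HS] [Hd HT]. split; [lra|]. intros x m Hx. rewrite Rmult_plus_distr_r.
  apply nbound_vsub; auto.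
Qed.

Lemma linear_opsub {I J} (S T : op I J) : linear_op S -> linear_op T -> linear_op (opsub S T).
Proof.
  intros HS HT c x y Hx Hy. unfold opsub. rewrite HS, HT; trivial. extensionality j.
  unfold vsub, vadd, vscale. apply Ceq; simpl; ring.
Qed.

(** * Coordinate injections and direct sums *)

Lemma nbound_inj {I J} (f : J -> I) (x : vec I) c :
  (forall j j', f j = f j' -> j = j') -> nbound p x c -> nbound p (fun j => x (f j)) c.
Proof.
  intros Hf Hx. rewrite <- (Rmult_1_l c). apply (nbound_reindex p Hp x _ f); trivial; [lra| |auto].
  intros; lra.
Qed.

(** A right inverse of [g] on [P] is injective, which is what reindexing asks for. Empty [J'] is
    treated apart because [epsilon] needs an inhabitant. *)
Lemma nbound_restr_image {J J'} (g : J' -> J) (P : J -> Prop) (y : vec J) c :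
  (forall j, P j -> exists j', g j' = j) -> nbound p (fun j' => y (g j')) c -> nbound p (restr P y) c.
Proof.
  intros HP Hy. destruct (classic (exists j0 : J', True)) as [[j0 _]|Hn].
  - set (inv := fun j => epsilon (inhabits j0) (fun j' => g j' = j)).
    assert (Hinv : forall j, P j -> g (inv j) = j) by (intros j Hj; apply epsilon_spec; auto).
    assert (HPy : forall j, restr P y j <> C0 -> P j) by (intros j H; apply NNPP; intros N; apply H; now apply restr_out).
    rewrite <- (Rmult_1_l c). apply (nbound_reindex p Hp (fun j' => y (g j')) _ inv); trivial; [lra| |].
    + intros j N. rewrite restr_in, Hinv by auto. lra.
    + intros j j' N N' E. rewrite <- (Hinv j), E by auto. auto.
  - apply nbound_zero; [apply Hy|]. intros j. apply restr_out. intros H. destruct (HP j H). eauto.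
Qed.

Lemma nbound_restr_inj {I I'} (f : I' -> I) (P : I -> Prop) (x : vec I) c :
  (forall i i', f i = f i' -> i = i') -> (forall i, P (f i)) -> nbound p (restr P x) c -> nbound p (fun i => x (f i)) c.
Proof.
  intros Hf HP Hx. apply (nbound_inj f) in Hx; trivial. revert Hx. apply nbound_le; trivial.
  intros i. rewrite restr_in by auto. lra.
Qed.

Lemma nbound_prod {K E E'} (x : vec (K * E)) (y : vec (K * E')) r c :
  0 <= r ->
  (forall k m, nbound p (fun e => x (k, e)) m -> nbound p (fun e => y (k, e)) (r * m)) ->
  nbound p x c -> nbound p y (r * c).
Proof.
  intros Hr H. apply (nbound_blocks p Hp fst fst); trivial. intros k m Hm.
  apply (nbound_restr_image (pair k)); [intros [k' e] <-; now exists e|].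
  apply H. apply (nbound_restr_inj (pair k)) in Hm; trivial. congruence.
Qed.

Lemma nbound_sum {I1 I2 J1 J2} (x : vec (I1 + I2)) (y : vec (J1 + J2)) r c :
  0 <= r ->
  (forall m, nbound p (fun e => x (inl e)) m -> nbound p (fun e => y (inl e)) (r * m)) ->
  (forall m, nbound p (fun e => x (inr e)) m -> nbound p (fun e => y (inr e)) (r * m)) ->
  nbound p x c -> nbound p y (r * c).
Proof.
  intros Hr H1 H2. set (side := fun (A B : Type) (i : A + B) => match i with inl _ => true | inr _ => false end).
  apply (nbound_blocks p Hp (side I1 I2) (side J1 J2)); trivial. intros [|] m Hm.
  - apply (nbound_restr_image inl); [intros [e|e] Ee; [now exists e|discriminate]|].
    apply H1. apply (nbound_restr_inj inl) in Hm; trivial. congruence.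
  - apply (nbound_restr_image inr); [intros [e|e] Ee; [discriminate|now exists e]|].
    apply H2. apply (nbound_restr_inj inr) in Hm; trivial. congruence.
Qed.

Lemma in_lp_inj {I J} (f : J -> I) (x : vec I) :
  (forall j j', f j = f j' -> j = j') -> in_lp p x -> in_lp p (fun j => x (f j)).
Proof. intros Hf Hx. eapply nbound_in_lp, nbound_inj, nbound_lp_norm; trivial. Qed.

Lemma opbound_dsum2 {I1 J1 I2 J2} (T1 : op I1 J1) (T2 : op I2 J2) c :
  opbound T1 c -> opbound T2 c -> opbound (dsum2 T1 T2) c.
Proof.
  intros [Hc H1] [_ H2]. split; trivial. intros x m Hx.
  apply (nbound_sum x); trivial; intros; [apply H1|apply H2]; trivial.
Qed.

Lemma linear_dsum2 {I1 J1 I2 J2} (T1 : op I1 J1) (T2 : op I2 J2) :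
  linear_op T1 -> linear_op T2 -> linear_op (dsum2 T1 T2).
Proof.
  intros H1 H2 c x y Hx Hy. extensionality j. destruct j as [j|j]; unfold dsum2.
  - exact (f_equal (fun f => f j) (H1 c _ _ (in_lp_inj inl x ltac:(congruence) Hx) (in_lp_inj inl y ltac:(congruence) Hy))).
  - exact (f_equal (fun f => f j) (H2 c _ _ (in_lp_inj inr x ltac:(congruence) Hx) (in_lp_inj inr y ltac:(congruence) Hy))).
Qed.

Lemma opbound_dsumN {I J} (T : nat -> op I J) c :
  0 <= c -> (forall k, opbound (T k) c) -> opbound (dsumN T) c.
Proof.
  intros Hc H. split; trivial. intros x m Hx. apply (nbound_prod x); trivial. intros k m' Hm'.
  apply (proj2 (H k) _ _ Hm').
Qed.

Lemma linear_dsumN {I J} (T : nat -> op I J) : (forall k, linear_op (T k)) -> linear_op (dsumN T).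
Proof.
  intros H c x y Hx Hy. extensionality kj. destruct kj as [k j]. unfold dsumN; simpl.
  exact (f_equal (fun f => f j) (H k c _ _ (in_lp_inj (pair k) x ltac:(congruence) Hx) (in_lp_inj (pair k) y ltac:(congruence) Hy))).
Qed.

(** * Tails *)

Lemma list_rank_bound {I} (ev : I -> nat) (l : list I) : exists N, forall i, In i l -> (ev i < N)%nat.
Proof.
  induction l as [|a l [N HN]]; [exists 0%nat; intros i []|]. exists (S (max N (ev a))).
  intros i [<-|Hi]; [lia|]. specialize (HN i Hi). lia.
Qed.

Lemma nbound_rank_tail {I} (ev : I -> nat) (x : vec I) c eps :
  nbound p x c -> 0 < eps -> exists N, forall n, (N <= n)%nat -> nbound p (restr (fun i => n <= ev i)%nat x) eps.
Proof.
  intros Hx He. destruct (nbound_tail p Hp x c eps Hx He) as [l Hl].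
  destruct (list_rank_bound ev l) as [N HN]. exists N. intros n Hn. revert Hl. apply nbound_le; trivial.
  intros i. unfold restr.
  destruct excluded_middle_informative as [H|H], excluded_middle_informative as [H'|H'];
    try lra; [|rewrite Cmod_C0; apply Cmod_nonneg].
  exfalso. apply H'. intros Hi. specialize (HN i Hi). lia.
Qed.

(** Otherwise there are vectors of norm at most 1 whose images keep more than [eps] beyond rank [n],
    for every [n]. The limit [y] of a convergent subsequence of images has tails below [eps / 2],
    and the distance to [y] accounts for the other half. *)
Lemma compact_rank_tail {I J} (T : op I J) (ev : J -> nat) eps :
  is_compact_op p T -> 0 < eps ->
  exists N, forall n, (N <= n)%nat -> forall x m, nbound p x m ->
    nbound p (restr (fun j => n <= ev j)%nat (T x)) (eps * m).
Proof.
  intros [HB HT] He. apply NNPP. intros Hn.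
  pose proof (proj1 (bounded_op_iff T) HB) as (HL & c & Hc & HTc).
  assert (Hx : forall n, exists x, nbound p x 1 /\ ~ nbound p (restr (fun j => n <= ev j)%nat (T x)) eps).
  { intros n. apply NNPP. intros H. apply Hn. exists n. intros n' Hn' x m Hx.
    destruct (Req_dec m 0) as [->|Hm].
    { specialize (HTc x 0 Hx). rewrite Rmult_0_r in *. apply nbound_restr; trivial. }
    assert (Hm' : 0 < m) by (destruct Hx; lra).
    pose proof (Rinv_0_lt_compat m Hm') as Hi.
    pose proof (nbound_vscale p Hp (/ m, 0) x m Hx) as Hy. rewrite Cmod_real, Rabs_right, Rinv_l in Hy by lra.
    assert (E : T x = vscale (m, 0) (T (vscale (/ m, 0) x))).
    { rewrite <- lin_vscale; trivial; [|eapply nbound_in_lp; eauto]. f_equal.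
      extensionality i. unfold vscale. apply Ceq; simpl; field; lra. }
    rewrite E, restr_vscale, Rmult_comm. apply nbound_vscale_real; [lra|].
    assert (Hg : nbound p (restr (fun j => n <= ev j)%nat (T (vscale (/ m, 0) x))) eps).
    { apply NNPP. intros H'. apply H. eauto. }
    revert Hg. apply nbound_le; trivial. intros i. unfold restr.
    destruct excluded_middle_informative, excluded_middle_informative; try lra; try lia.
    rewrite Cmod_C0; apply Cmod_nonneg. }
  set (xs := fun n => proj1_sig (constructive_indefinite_description _ (Hx n))).
  assert (Hxs : forall n, nbound p (xs n) 1 /\ ~ nbound p (restr (fun j => n <= ev j)%nat (T (xs n))) eps).
  { intros n. exact (proj2_sig (constructive_indefinite_description _ (Hx n))). }
  destruct (HT xs) as (phi & y & Hphi & Hy & Hcv).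
  { intros n. eapply nbound_in_lp. apply Hxs. }
  { exists 1. intros n. apply nbound_norm_le; trivial. apply Hxs. }
  destruct (nbound_rank_tail ev y _ (eps / 2) (nbound_lp_norm p Hp y Hy) ltac:(lra)) as [N HN].
  destruct (Hcv (eps / 2) ltac:(lra)) as [N' HN'].
  set (n := max N N'). specialize (HN' n ltac:(unfold n; lia)).
  assert (Hge : forall k, (k <= phi k)%nat). { induction k; [lia|]. specialize (Hphi k). lia. }
  apply (proj2 (Hxs (phi n))).
  assert (Hd : nbound p (vsub (T (xs (phi n))) y) (eps / 2)).
  { apply nbound_le_norm; trivial.
    - eapply nbound_in_lp, nbound_vsub; trivial; [apply HTc, Hxs|now apply nbound_lp_norm].
    - unfold Rdist in HN'. rewrite Rminus_0_r, Rabs_right in HN'; [lra|]. apply Rle_ge, lp_norm_nonneg. }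
  replace (T (xs (phi n))) with (vadd (vsub (T (xs (phi n))) y) y).
  2:{ extensionality j. unfold vadd, vsub. apply Ceq; simpl; ring. }
  rewrite restr_vadd. replace eps with (eps / 2 + eps / 2) by field. apply nbound_vadd; trivial.
  - now apply nbound_restr.
  - apply HN. specialize (Hge n). unfold n in *. lia.
Qed.

(* If unit vectors supported arbitrarily far out had [g >= t], then adding two of them with
   (almost) disjoint supports and normalising by [2 ^ (1/p)] would improve [t] by a factor [> 1]. *)
Lemma functional_rank_tail {I} (g : vec I -> R) (ev : I -> nat) c eps :
  (forall x y, in_lp p x -> in_lp p y -> g (vadd x y) = g x + g y) ->
  (forall r x, in_lp p x -> g (vscale (r, 0) x) = r * g x) ->
  (forall x m, nbound p x m -> Rabs (g x) <= c * m) ->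
  0 < eps ->
  exists N, forall n, (N <= n)%nat -> forall x m, nbound p x m ->
    Rabs (g (restr (fun i => n <= ev i)%nat x)) <= eps * m.
Proof.
  intros Hadd Hsc Hb He. apply NNPP. intros Hn.
  set (far := fun t => forall N, exists x, nbound p x 1 /\ (forall i, (ev i < N)%nat -> x i = C0) /\ t <= g x).
  assert (H0 : far eps).
  { intros N. apply NNPP. intros H. apply Hn. exists N. intros n Hnn x m Hx.
    apply Rnot_lt_le. intros Hlt. apply H.
    set (y := restr (fun i => n <= ev i)%nat x) in *.
    assert (Hy : nbound p y m) by now apply nbound_restr.
    assert (Hyl : in_lp p y) by (eapply nbound_in_lp; eauto).
    assert (Hm : 0 < m).
    { destruct (Req_dec m 0) as [->|]; [|destruct Hx; lra]. specialize (Hb y 0 Hy). lra. }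
    pose proof (Rinv_0_lt_compat m Hm) as Hi.
    assert (Hs : exists s, Rabs s = 1 /\ s * g y = Rabs (g y)).
    { destruct (Rle_lt_dec 0 (g y)); [exists 1|exists (-1)]; split.
      - apply Rabs_right; lra. - rewrite Rabs_right; lra.
      - rewrite Rabs_left; lra. - rewrite Rabs_left; lra. }
    destruct Hs as (s & Hs1 & Hs2).
    exists (vscale (s * / m, 0) y). split; [|split].
    - pose proof (nbound_vscale p Hp (s * / m, 0) y m Hy) as Hz.
      rewrite Cmod_real, Rabs_mult, Hs1, (Rabs_right (/ m)), Rmult_1_l, Rinv_l in Hz by lra. trivial.
    - intros i Hi'. unfold vscale, y. rewrite restr_out by lia. apply Ceq; simpl; ring.
    - rewrite Hsc by trivial. replace (s * / m * g y) with (/ m * (s * g y)) by ring. rewrite Hs2.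
      apply Rmult_le_reg_l with m; trivial. rewrite <- Rmult_assoc, Rinv_r by lra. lra. }
  assert (Hip : 0 < / p < 1).
  { split; [apply Rinv_0_lt_compat; lra|]. rewrite <- Rinv_1. apply Rinv_lt_contravar; lra. }
  (* Two unit vectors with disjoint supports have a sum of norm at most [q], and p > 1 makes
     [q < 2]. With [lam] strictly between 1 and [2 / q], the margin [2 - lam * q] pays for the tail
     that is cut off from the first vector. *)
  set (q := rpow 2 (/ p)).
  assert (Hq : 0 < q < 2).
  { unfold q. rewrite rpow_Rpower by lra. split; [apply exp_pos|].
    rewrite <- (Rpower_1 2) at 2 by lra. apply Rpower_lt; lra. }
  set (lam := (1 + 2 / q) / 2).
  assert (H2q : 1 < 2 / q).
  { apply Rmult_lt_reg_r with q; [lra|]. unfold Rdiv. rewrite Rmult_assoc, Rinv_l; lra. }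
  assert (Hlam : 1 < lam < 2 / q) by (unfold lam; lra).
  assert (Hstep : forall t, 0 < t -> far t -> far (lam * t)).
  { intros t Ht Hf N.
    destruct (Hf N) as (x1 & Hx1 & Hs1 & Hg1).
    set (eta := (2 - lam * q) * t / (Rabs c + 1)).
    pose proof (Rabs_pos c) as Hc0.
    assert (Hlq : 0 < 2 - lam * q).
    { assert (lam * q < 2 / q * q) by (apply Rmult_lt_compat_r; lra). replace (2 / q * q) with 2 in H by (field; lra). lra. }
    assert (Heta : 0 < eta).
    { unfold eta. apply Rmult_lt_0_compat; [nra|]. apply Rinv_0_lt_compat; lra. }
    destruct (nbound_rank_tail ev x1 1 eta Hx1 Heta) as [N1 HN1].
    set (N2 := max N N1). specialize (HN1 N2 ltac:(unfold N2; lia)).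
    destruct (Hf N2) as (x2 & Hx2 & Hs2 & Hg2).
    set (y1 := restr (fun i => ~ (N2 <= ev i)%nat) x1).
    assert (Hy1 : nbound p y1 1) by now apply nbound_restr.
    assert (Hgy : g x1 = g (restr (fun i => N2 <= ev i)%nat x1) + g y1).
    { rewrite <- Hadd; [unfold y1; now rewrite restr_compl|eapply nbound_in_lp; eauto|eapply nbound_in_lp; eauto]. }
    assert (Hgr : g (restr (fun i => N2 <= ev i)%nat x1) <= (2 - lam * q) * t).
    { eapply Rle_trans; [apply Rle_abs|]. eapply Rle_trans; [apply Hb, HN1|].
      apply Rle_trans with ((Rabs c + 1) * eta).
      - apply Rmult_le_compat_r; [lra|]. pose proof (Rle_abs c). lra.
      - right. unfold eta. field. lra. }
    assert (Hz : nbound p (vadd y1 x2) q).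
    { apply (nbound_join p (fun i => ~ (N2 <= ev i)%nat) _ 1 1); [lra| | |].
      - revert Hy1. apply nbound_le; trivial. intros i. unfold restr.
        destruct excluded_middle_informative as [H|H]; [|rewrite Cmod_C0; apply Cmod_nonneg].
        unfold vadd. rewrite Hs2 by lia. replace (Cadd (y1 i) C0) with (y1 i) by (apply Ceq; simpl; ring). lra.
      - revert Hx2. apply nbound_le; trivial. intros i. unfold restr.
        destruct excluded_middle_informative as [H|H]; [|rewrite Cmod_C0; apply Cmod_nonneg].
        unfold vadd, y1. rewrite restr_out by trivial. replace (Cadd C0 (x2 i)) with (x2 i) by (apply Ceq; simpl; ring). lra.
      - unfold q. rewrite rpow_inv_r by lra. rewrite rpow_Rpower by lra. unfold Rpower. rewrite ln_1, Rmult_0_r, exp_0. lra. }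
    pose proof (Rinv_0_lt_compat q ltac:(lra)) as Hiq.
    exists (vscale (/ q, 0) (vadd y1 x2)). split; [|split].
    - pose proof (nbound_vscale p Hp (/ q, 0) _ _ Hz) as Hw. rewrite Cmod_real, Rabs_right, Rinv_l in Hw by lra. trivial.
    - intros i Hi. unfold vscale, vadd. rewrite Hs2 by (unfold N2; lia).
      assert (Ey : y1 i = C0).
      { unfold y1, restr. destruct excluded_middle_informative; trivial. now apply Hs1. }
      rewrite Ey. apply Ceq; simpl; ring.
    - rewrite Hsc by (eapply nbound_in_lp; eauto).
      rewrite Hadd by (eapply nbound_in_lp; eauto).
      apply Rmult_le_reg_l with q; [lra|]. rewrite <- (Rmult_assoc q (/ q)), Rinv_r by lra. nra. }
  assert (Hall : forall n, far (lam ^ n * eps)).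
  { induction n as [|n IH]; simpl; [now rewrite Rmult_1_l|]. rewrite Rmult_assoc. apply Hstep; trivial.
    apply Rmult_lt_0_compat; [apply pow_lt; lra|trivial]. }
  destruct (Pow_x_infinity lam ltac:(rewrite Rabs_right; lra) ((c + 1) / eps)) as [n Hnn].
  specialize (Hnn n ltac:(lia)). rewrite Rabs_right in Hnn by (apply Rle_ge, pow_le; lra).
  destruct (Hall n 0%nat) as (x & Hx & _ & Hg). specialize (Hb x 1 Hx). pose proof (Rle_abs (g x)).
  assert (c + 1 <= lam ^ n * eps).
  { apply Rmult_le_reg_r with (/ eps); [now apply Rinv_0_lt_compat|]. rewrite Rmult_assoc, Rinv_r by lra. unfold Rdiv in Hnn. lra. }
  lra.
Qed.

Lemma nbound_single {I} (x : vec I) i : nbound p (restr (fun j => j = i) x) (Cmod (x i)).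
Proof.
  split; [apply Cmod_nonneg|]. intros l Nl.
  eapply Rle_trans; [apply (lsum_incl _ l (i :: nil)); trivial; [apply pmod_nonneg|]|].
  - intros j _ Hj. left. apply NNPP. intros H. apply Hj. unfold pmod. rewrite restr_out by congruence.
    rewrite Cmod_C0. apply rpow_0.
  - simpl. rewrite Rplus_0_r. unfold pmod. rewrite restr_in by reflexivity. lra.
Qed.

Lemma nbound_list {I} (x : vec I) (l : list I) :
  nbound p (restr (fun j => In j l) x) (lsum (fun i => Cmod (x i)) l).
Proof.
  apply (nbound_lsum_dom p Hp l (fun i => restr (fun j => j = i) x)).
  - intros j. unfold restr at 1. destruct excluded_middle_informative as [Hj|Hj].
    + eapply Rle_trans; [|apply (lsum_incl _ (j :: nil))].
      * simpl. rewrite restr_in by reflexivity. lra.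
      * intros; apply Cmod_nonneg.
      * repeat constructor; intros [].
      * intros i [<-|[]] _; trivial.
    + rewrite Cmod_C0. apply lsum_nonneg. intros; apply Cmod_nonneg.
  - intros i _. apply nbound_single.
Qed.

(** A row of [T] is a complex functional; [functional_rank_tail] is applied to its real and
    imaginary parts. *)
Lemma coord_rank_tail {I J} (T : op I J) (ev : I -> nat) (j : J) c eps :
  linear_op T -> opbound T c -> 0 < eps ->
  exists N, forall n, (N <= n)%nat -> forall x m, nbound p x m ->
    Cmod (T (restr (fun i => n <= ev i)%nat x) j) <= eps * m.
Proof.
  intros HL HT He.
  assert (Hb : forall x m, nbound p x m -> Cmod (T x j) <= c * m).
  { intros x m Hx. apply (nbound_coord p Hp), HT, Hx. }
  destruct (functional_rank_tail (fun x => fst (T x j)) ev c (eps / 2)) as [N1 H1]; [..|lra|].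
  { intros x y Hx Hy. rewrite lin_vadd; trivial. }
  { intros r x Hx. rewrite lin_vscale; trivial. unfold vscale. simpl. ring. }
  { intros x m Hx. eapply Rle_trans; [apply Cmod_fst|auto]. }
  destruct (functional_rank_tail (fun x => snd (T x j)) ev c (eps / 2)) as [N2 H2]; [..|lra|].
  { intros x y Hx Hy. rewrite lin_vadd; trivial. }
  { intros r x Hx. rewrite lin_vscale; trivial. unfold vscale. simpl. ring. }
  { intros x m Hx. eapply Rle_trans; [apply Cmod_snd|auto]. }
  exists (max N1 N2). intros n Hn x m Hx. eapply Rle_trans; [apply Cmod_le_parts|].
  specialize (H1 n ltac:(lia) x m Hx). specialize (H2 n ltac:(lia) x m Hx). simpl in *. lra.
Qed.

Lemma rows_rank_tail {I J} (T : op I J) (ev : I -> nat) (l : list J) c eps :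
  linear_op T -> opbound T c -> 0 < eps ->
  exists N, forall n, (N <= n)%nat -> forall x m, nbound p x m ->
    nbound p (restr (fun j => In j l) (T (restr (fun i => n <= ev i)%nat x))) (eps * m).
Proof.
  intros HL HT He.
  assert (H : exists N, forall n, (N <= n)%nat -> forall x m, nbound p x m ->
     lsum (fun j => Cmod (T (restr (fun i => n <= ev i)%nat x) j)) l <= eps * m).
  { revert eps He. induction l as [|j l IH]; intros eps He.
    - exists 0%nat. intros n _ x m [Hm _]. simpl. nra.
    - destruct (IH (eps / 2) ltac:(lra)) as [N1 H1].
      destruct (coord_rank_tail T ev j c (eps / 2) HL HT ltac:(lra)) as [N2 H2].
      exists (max N1 N2). intros n Hn x m Hx. simpl.
      specialize (H1 n ltac:(lia) x m Hx). specialize (H2 n ltac:(lia) x m Hx). unfold lsum in *. lra. }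
  destruct H as [N H]. exists N. intros n Hn x m Hx.
  eapply nbound_weaken; [trivial|apply (H n Hn x m Hx)|]. apply nbound_list.
Qed.

(** The images of finitely many basis vectors are fixed vectors of l^p, hence have small tails, and
    each coefficient [x a] has modulus at most [m]. *)
Lemma cols_rank_tail {I J} (T : op I J) (ev : J -> nat) (l : list I) c eps :
  linear_op T -> opbound T c -> 0 < eps ->
  exists N, forall n, (N <= n)%nat -> forall x m, nbound p x m ->
    nbound p (restr (fun j => n <= ev j)%nat (T (restr (fun i => In i l) x))) (eps * m).
Proof.
  intros HL HT. revert eps. induction l as [|a l IH]; intros eps He.
  - exists 0%nat. intros n _ x m Hx. apply nbound_zero; [destruct Hx; nra|]. intros j.
    replace (restr (fun i => In i nil) x) with (fun _ : I => C0).
    + rewrite lin_0; trivial. unfold restr. destruct excluded_middle_informative; trivial.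
    + extensionality i. symmetry. apply restr_out. intros [].
  - destruct (IH (eps / 2) ltac:(lra)) as [N1 H1].
    destruct (classic (In a l)) as [Ha|Ha].
    { exists N1. intros n Hn x m Hx. rewrite (restr_ext _ (fun i => In i l)).
      - pose proof (proj1 Hx). apply (nbound_weaken p Hp _ (eps / 2 * m)); [|now apply H1]. apply Rmult_le_compat_r; lra.
      - intros i; simpl; intuition congruence. }
    set (d := restr (fun i => i = a) (fun _ => (1, 0)) : vec I).
    assert (Hd : nbound p d 1).
    { pose proof (nbound_single (fun _ : I => (1, 0)) a) as H. cbv beta in H. rewrite Cmod_real, Rabs_right in H by lra. trivial. }
    destruct (nbound_rank_tail ev (T d) (c * 1) (eps / 2)) as [N2 H2]; [apply HT, Hd|lra|].
    exists (max N1 N2). intros n Hn x m Hx.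
    assert (E : restr (fun i => In i (a :: l)) x = vadd (vscale (x a) d) (restr (fun i => In i l) x)).
    { extensionality i. unfold vadd, vscale, d, restr.
      destruct (excluded_middle_informative (In i (a :: l))) as [Q|Q];
      destruct (excluded_middle_informative (i = a)) as [E|E];
      destruct (excluded_middle_informative (In i l)) as [Q'|Q']; subst; simpl in Q; try tauto;
        try (apply Ceq; simpl; ring); firstorder congruence. }
    rewrite E, HL; [|eapply nbound_in_lp; eauto|apply in_lp_restr; eapply nbound_in_lp; eauto].
    rewrite restr_vadd, restr_vscale. replace (eps * m) with (m * (eps / 2) + eps / 2 * m) by field.
    apply nbound_vadd; trivial.
    + eapply nbound_weaken; [trivial| |apply nbound_vscale; trivial; apply H2; lia].
      apply Rmult_le_compat_r; [lra|]. apply (nbound_coord p Hp), Hx.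
    + apply H1; [lia|trivial].
Qed.

(** * Compactness from uniformly small tails *)

(** Norm approximation by truncation to finitely many output coordinates; in this form the
    compactness of the error is verified. *)
Definition small_tails {I J} (T : op I J) : Prop :=
  forall eps, 0 < eps -> exists l, forall x m, nbound p x m ->
    nbound p (restr (fun j => ~ In j l) (T x)) (eps * m).

Definition subseq (phi : nat -> nat) := forall n, (phi n < phi (S n))%nat.

Lemma subseq_ge phi : subseq phi -> forall n, (n <= phi n)%nat.
Proof. intros H. induction n; [lia|]. specialize (H n). lia. Qed.

Lemma subseq_lt phi : subseq phi -> forall m n, (m < n)%nat -> (phi m < phi n)%nat.
Proof. intros H m n L. induction L; [apply H|]. specialize (H m0). lia. Qed.

Lemma bounded_subsequence (u : nat -> R) M :
  (forall n, Rabs (u n) <= M) -> exists phi l, subseq phi /\ Un_cv (fun n => u (phi n)) l.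
Proof.
  intros H. destruct (Bolzano_Weierstrass u (fun x => - M <= x <= M)) as [l Hl].
  - apply compact_P3.
  - intros n. specialize (H n). revert H. unfold Rabs. destruct (Rcase_abs (u n)); lra.
  - assert (Hs : forall N n, exists q, (N < q)%nat /\ Rabs (u q - l) < / INR (S n)).
    { intros N n. destruct (Hl (disc l (mkposreal _ (RinvN_pos n))) (S N)) as (q & Hq & Hd).
      - exists (mkposreal _ (RinvN_pos n)). intros x Hx. exact Hx.
      - exists q. split; [lia|]. rewrite S_INR. exact Hd. }
    set (f := fun N n => proj1_sig (constructive_indefinite_description _ (Hs N n))).
    assert (Hf : forall N n, (N < f N n)%nat /\ Rabs (u (f N n) - l) < / INR (S n)).
    { intros N n. exact (proj2_sig (constructive_indefinite_description _ (Hs N n))). }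
    set (phi := fix phi n := match n with O => f 0%nat 0%nat | S n => f (phi n) (S n) end).
    exists phi, l. split; [intros n; apply Hf|]. intros eps He.
    destruct (archimed_cor1 eps He) as (N & HN & HN0). exists N. intros n Hn.
    assert (Hd : Rabs (u (phi n) - l) < / INR (S n)) by (destruct n; apply Hf).
    unfold Rdist. eapply Rlt_trans; [apply Hd|]. eapply Rle_lt_trans; [|apply HN].
    apply Rinv_le_contravar; [now apply lt_0_INR|]. apply le_INR. lia.
Qed.

Lemma diagonal_subsequence (u : nat -> nat -> R) M :
  (forall n q, Rabs (u n q) <= M) -> exists phi, subseq phi /\ forall q, exists l, Un_cv (fun n => u (phi n) q) l.
Proof.
  intros H.
  assert (Hs : forall (f : nat -> nat) q, exists theta, subseq theta /\ exists l, Un_cv (fun n => u (f (theta n)) q) l).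
  { intros f q. destruct (bounded_subsequence (fun n => u (f n) q) M) as (th & l & H1 & H2); [auto|]. eauto. }
  set (th := fun f q => proj1_sig (constructive_indefinite_description _ (Hs f q))).
  assert (Hth : forall f q, subseq (th f q) /\ exists l, Un_cv (fun n => u (f (th f q n)) q) l).
  { intros f q. exact (proj2_sig (constructive_indefinite_description _ (Hs f q))). }
  (* Along [Phi k] the coordinates below [k] converge, and each [Phi (S k)] refines [Phi k]. *)
  set (Phi := fix Phi k : nat -> nat := match k with O => fun n => n | S k => fun n => Phi k (th (Phi k) k n) end).
  assert (HPhi : forall k, subseq (Phi k)).
  { induction k; intros n; simpl; [lia|]. apply (subseq_lt _ IHk). apply Hth. }
  assert (Hfac : forall m n, (m <= n)%nat -> exists s, subseq s /\ forall x, Phi n x = Phi m (s x)).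
  { intros m n L. induction L as [|n L IH].
    - exists (fun x => x). split; [intros x; lia|reflexivity].
    - destruct IH as (s & Hs1 & Hs2). exists (fun x => s (th (Phi n) n x)). split.
      + intros x. apply (subseq_lt _ Hs1). apply Hth.
      + intros x. simpl. apply Hs2. }
  exists (fun n => Phi n n). split.
  - intros n. simpl. apply (subseq_lt _ (HPhi n)).
    pose proof (subseq_ge _ (proj1 (Hth (Phi n) n)) (S n)). lia.
  - intros q. destruct (Hth (Phi q) q) as [_ [l Hl]]. exists l. intros eps He.
    destruct (Hl eps He) as [N HN]. exists (max N (S q)). intros n Hn.
    destruct (Hfac (S q) n ltac:(lia)) as (s & Hs1 & Hs2). rewrite Hs2. simpl.
    apply HN. pose proof (subseq_ge _ Hs1 n). lia.
Qed.

Definition coord_cv {I} (u : nat -> vec I) (y : vec I) : Prop :=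
  forall i eps, 0 < eps -> exists N, forall n, (N <= n)%nat -> Cmod (Csub (u n i) (y i)) < eps.

Lemma coord_cv_list {I} (u : nat -> vec I) y (l : list I) eps :
  coord_cv u y -> 0 < eps ->
  exists N, forall n, (N <= n)%nat -> lsum (fun i => Cmod (Csub (u n i) (y i))) l < eps.
Proof.
  intros H. revert eps. induction l as [|a l IH]; intros eps He.
  - exists 0%nat. intros; simpl; lra.
  - destruct (IH (eps / 2) ltac:(lra)) as [N1 H1]. destruct (H a (eps / 2) ltac:(lra)) as [N2 H2].
    exists (max N1 N2). intros n Hn. specialize (H1 n ltac:(lia)). specialize (H2 n ltac:(lia)).
    simpl. unfold lsum in *. lra.
Qed.

Lemma coord_cv_restr {I} P (u : nat -> vec I) y : coord_cv u y -> coord_cv (fun n => restr P (u n)) (restr P y).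
Proof.
  intros H i eps He. destruct (H i eps He) as [N HN]. exists N. intros n Hn.
  unfold restr. destruct excluded_middle_informative; auto.
  replace (Csub C0 C0) with C0 by (apply Ceq; simpl; ring). now rewrite Cmod_C0.
Qed.

(** Lower semicontinuity of the norm: on a finite set of coordinates the convergence is uniform. *)
Lemma nbound_coord_cv {I} (u : nat -> vec I) y m : coord_cv u y -> (forall n, nbound p (u n) m) -> nbound p y m.
Proof.
  intros H Hu. split; [apply (Hu 0%nat)|]. intros l Nl.
  assert (Hl : nbound p (restr (fun i => In i l) y) m).
  { apply nbound_closed; trivial. intros eps He. destruct (coord_cv_list u y l eps H He) as [N HN].
    specialize (HN N ltac:(lia)).
    apply (nbound_add_dom p Hp (u N) (restr (fun i => In i l) (fun i => Csub (u N i) (y i)))).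
    - intros i. unfold restr. destruct excluded_middle_informative.
      + replace (y i) with (Csub (u N i) (Csub (u N i) (y i))) at 1 by (apply Ceq; simpl; ring). apply Cmod_sub.
      + rewrite Cmod_C0. pose proof (Cmod_nonneg (u N i)). lra.
    - apply Hu.
    - eapply nbound_weaken; [trivial| |apply nbound_list]. lra. }
  erewrite lsum_ext; [apply Hl; trivial|]. intros i Hi. unfold pmod. now rewrite restr_in.
Qed.

(** The diagonal argument, run over the numbering [enc], gives coordinatewise convergence of a
    subsequence of images; uniformly small tails turn it into norm convergence. *)
Lemma small_tails_compact {I J} (enc : J -> nat) (T : op I J) :
  (forall j j', enc j = enc j' -> j = j') -> is_bounded_op p T -> small_tails T -> is_compact_op p T.
Proof.
  intros Henc HB HS. split; trivial. intros xs Hxs [M HM].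
  apply bounded_op_iff in HB. destruct HB as (HL & c & Hc & HT).
  assert (Hx : forall n, nbound p (xs n) (Rabs M)).
  { intros n. apply nbound_le_norm; trivial. eapply Rle_trans; [apply HM|apply Rle_abs]. }
  set (dec := fun q => match excluded_middle_informative (exists j, enc j = q) with
     | left H => Some (proj1_sig (constructive_indefinite_description _ H)) | right _ => None end).
  assert (Hdec : forall j, dec (enc j) = Some j).
  { intros j. unfold dec. destruct excluded_middle_informative as [H|H]; [|exfalso; eauto].
    f_equal. apply Henc. exact (proj2_sig (constructive_indefinite_description _ H)). }
  set (re := fun n q => match dec q with Some j => fst (T (xs n) j) | None => 0 end).
  set (im := fun n q => match dec q with Some j => snd (T (xs n) j) | None => 0 end).
  assert (HTb : forall n j, Cmod (T (xs n) j) <= c * Rabs M) by (intros; apply (nbound_coord p Hp), HT, Hx).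
  assert (Hre : forall n q, Rabs (re n q) <= c * Rabs M).
  { intros n q. unfold re. destruct (dec q); [eapply Rle_trans; [apply Cmod_fst|auto]|].
    rewrite Rabs_R0. pose proof (Rabs_pos M). nra. }
  assert (Him : forall n q, Rabs (im n q) <= c * Rabs M).
  { intros n q. unfold im. destruct (dec q); [eapply Rle_trans; [apply Cmod_snd|auto]|].
    rewrite Rabs_R0. pose proof (Rabs_pos M). nra. }
  destruct (diagonal_subsequence re _ Hre) as (phi1 & Hphi1 & Hcv1).
  destruct (diagonal_subsequence (fun n => im (phi1 n)) (c * Rabs M)) as (phi2 & Hphi2 & Hcv2); [auto|].
  set (phi := fun n => phi1 (phi2 n)).
  assert (Hphi : subseq phi) by (intros n; apply (subseq_lt _ Hphi1), Hphi2).
  assert (Hlim : forall j, exists z : Defs.C, forall eps, 0 < eps -> exists N, forall n, (N <= n)%nat ->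
     Cmod (Csub (T (xs (phi n)) j) z) < eps).
  { intros j. destruct (Hcv1 (enc j)) as [a Ha]. destruct (Hcv2 (enc j)) as [b Hb].
    unfold re in Ha. unfold im in Hb. rewrite Hdec in Ha, Hb.
    exists (a, b). intros eps He.
    destruct (Ha (eps / 2) ltac:(lra)) as [N1 H1]. destruct (Hb (eps / 2) ltac:(lra)) as [N2 H2].
    exists (max N1 N2). intros n Hn. eapply Rle_lt_trans; [apply Cmod_le_parts|].
    pose proof (subseq_ge _ Hphi2 n).
    specialize (H1 (phi2 n) ltac:(lia)). specialize (H2 n ltac:(lia)).
    unfold Rdist in *. unfold phi, Csub, Cadd, Copp. simpl. unfold Rminus in *. lra. }
  set (y := fun j => proj1_sig (constructive_indefinite_description _ (Hlim j))).
  assert (Hy : coord_cv (fun n => T (xs (phi n))) y).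
  { intros j. exact (proj2_sig (constructive_indefinite_description _ (Hlim j))). }
  assert (Hyb : nbound p y (c * Rabs M)) by (apply (nbound_coord_cv _ _ _ Hy); intros; apply HT, Hx).
  exists phi, y. split; [exact Hphi|]. split; [eapply nbound_in_lp; eauto|].
  intros eps He. pose proof (Rabs_pos M) as HM0.
  (* Three contributions of [eps / 4] will arise: finitely many coordinates, the tail of the image
     and the tail of the limit. The summand 1 guards against a zero denominator. *)
  assert (He' : 0 < eps / (4 * (Rabs M + 1))).
  { apply Rmult_lt_0_compat; [trivial|]. apply Rinv_0_lt_compat. lra. }
  destruct (HS _ He') as [l Hl].
  assert (Hsm : eps / (4 * (Rabs M + 1)) * Rabs M <= eps / 4).
  { apply Rle_trans with (eps / (4 * (Rabs M + 1)) * (Rabs M + 1)); [nra|]. right. field. lra. }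
  assert (Hlt : forall n, nbound p (restr (fun j => ~ In j l) (T (xs (phi n)))) (eps / 4)).
  { intros n. eapply nbound_weaken; [trivial|apply Hsm|]. apply Hl, Hx. }
  assert (Hly : nbound p (restr (fun j => ~ In j l) y) (eps / 4)).
  { apply (nbound_coord_cv _ _ _ (coord_cv_restr _ _ _ Hy)). auto. }
  destruct (coord_cv_list _ y l (eps / 4) Hy ltac:(lra)) as [N HN].
  exists N. intros n Hn. unfold Rdist. rewrite Rminus_0_r, Rabs_right by apply Rle_ge, lp_norm_nonneg.
  apply Rle_lt_trans with (eps / 4 + (eps / 4 + eps / 4)); [|lra].
  apply nbound_norm_le; trivial.
  rewrite <- (restr_compl (fun j => In j l) (vsub _ y)). apply nbound_vadd; trivial.
  - eapply nbound_weaken; [trivial| |apply nbound_list]. specialize (HN n Hn). simpl in HN. unfold vsub. lra.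
  - rewrite restr_vsub. apply nbound_vsub; trivial.
Qed.

(** Makes the set in [calkin_norm] nonempty, so that its [rsup] is a genuine supremum. *)
Lemma zero_compact {I} : is_compact_op p (fun (_ : vec I) (_ : I) => C0).
Proof.
  split.
  - apply bounded_op_iff. split.
    + intros c x y _ _. extensionality i. unfold vadd, vscale. apply Ceq; simpl; ring.
    + exists 0. split; [lra|]. intros x m Hx. apply nbound_zero; trivial. lra.
  - intros xs _ _. exists (fun n => n), (fun _ => C0). split; [intros; lia|]. split; [apply in_lp_zero|].
    intros eps He. exists 0%nat. intros n _. unfold Rdist. rewrite Rminus_0_r.
    rewrite Rabs_right by apply Rle_ge, lp_norm_nonneg.
    apply Rle_lt_trans with 0; [|trivial]. apply nbound_norm_le; trivial. apply nbound_zero; trivial; [lra|].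
    intros i. apply Ceq; simpl; ring.
Qed.

Lemma calkin_norm_lt {I} (A : op I I) eps :
  is_bounded_op p A -> calkin_norm p A < eps -> exists K, is_compact_op p K /\ opbound (opsub A K) eps.
Proof.
  intros HA H. apply NNPP. intros Hn.
  assert (HB : forall K, is_compact_op p K -> is_bounded_op p (opsub A K)).
  { intros K [HK _]. apply bounded_op_iff in HA, HK. apply bounded_op_iff.
    destruct HA as (L1 & c1 & B1), HK as (L2 & c2 & B2). split; [now apply linear_opsub|].
    eexists. apply opbound_opsub; eauto. }
  assert (Hb : forall K, is_compact_op p K -> eps <= opnorm p (opsub A K)).
  { intros K HK. apply Rnot_lt_le. intros Hlt. apply Hn. exists K. split; trivial.
    eapply opbound_weaken; [|apply opbound_opnorm, HB; trivial]. lra. }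
  assert (Hlub : is_lub (fun r => exists K : op I I, is_compact_op p K /\ r = - opnorm p (opsub A K)) (- calkin_norm p A)).
  { unfold calkin_norm. rewrite Ropp_involutive. apply rsup_lub.
    - eexists. exists (fun _ _ => C0). split; [apply zero_compact|reflexivity].
    - exists 0. intros r (K & HK & ->). destruct (opbound_opnorm _ (HB K HK)). lra. }
  assert (- calkin_norm p A <= - eps).
  { apply Hlub. intros r (K & HK & ->). specialize (Hb K HK). lra. }
  lra.
Qed.

End Operators.

(** * Rotations *)

Definition rot {I} (al be : I -> R) (ptn : I -> I) (y : vec I) : vec I :=
  fun i => Cadd (Cmul (al i, 0) (y i)) (Cmul (be i, 0) (y (ptn i))).

(** A rotation in each plane spanned by [i] and [ptn i]. Fixed points of [ptn] are included: there
    the conditions force [be i = 0]. *)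
Definition rot_data {I} (al be : I -> R) (ptn : I -> I) : Prop :=
  forall i, ptn (ptn i) = i /\ al (ptn i) = al i /\ be (ptn i) = - be i /\ al i ^ 2 + be i ^ 2 = 1.

Lemma rot_data_opp {I} (al be : I -> R) ptn : rot_data al be ptn -> rot_data al (fun i => - be i) ptn.
Proof. intros H i. destruct (H i) as (H1 & H2 & H3 & H4). repeat split; trivial; [rewrite H3; ring|rewrite <- H4; ring]. Qed.

Lemma rot_rot_opp {I} (al be : I -> R) ptn y :
  rot_data al be ptn -> rot al (fun i => - be i) ptn (rot al be ptn y) = y.
Proof.
  intros H. extensionality i. destruct (H i) as (H1 & H2 & H3 & H4). unfold rot. rewrite H1, H2, H3.
  destruct (y i) as [a b], (y (ptn i)) as [a' b']. apply Ceq; simpl.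
  - transitivity (a * (al i ^ 2 + be i ^ 2)); [ring|rewrite H4; ring].
  - transitivity (b * (al i ^ 2 + be i ^ 2)); [ring|rewrite H4; ring].
Qed.

Lemma rot_opp_rot {I} (al be : I -> R) ptn y :
  rot_data al be ptn -> rot al be ptn (rot al (fun i => - be i) ptn y) = y.
Proof.
  intros H. rewrite <- (rot_rot_opp al (fun i => - be i) ptn y) at 2 by now apply rot_data_opp.
  f_equal. extensionality i. ring.
Qed.

Lemma Rabs_le_1_of_sq a b : a ^ 2 + b ^ 2 = 1 -> Rabs a <= 1.
Proof. intros H. apply Rabs_le. nra. Qed.

(** Both coefficients have modulus at most 1 and [ptn] permutes the coordinates, so the triangle
    inequality gives 2 for every p. *)
Lemma rot_opbound {I} p (Hp : 1 < p) (al be : I -> R) ptn : rot_data al be ptn -> opbound p (rot al be ptn) 2.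
Proof.
  intros H. split; [lra|]. intros x m Hx. replace (2 * m) with (m + m) by ring.
  apply (nbound_add_dom p Hp x (fun i => x (ptn i))); trivial.
  - intros i. unfold rot. eapply Rle_trans; [apply Cmod_add|]. rewrite !Cmod_mul, !Cmod_real.
    destruct (H i) as (_ & _ & _ & H4).
    pose proof (Rabs_le_1_of_sq _ _ H4). rewrite Rplus_comm in H4. pose proof (Rabs_le_1_of_sq _ _ H4).
    pose proof (Cmod_nonneg (x i)). pose proof (Cmod_nonneg (x (ptn i))). nra.
  - apply nbound_inj; trivial. intros j j' E. rewrite <- (proj1 (H j)), E. apply H.
Qed.

Lemma lsum_perm {I} (f : I -> R) l l' : Permutation l l' -> lsum f l = lsum f l'.
Proof. induction 1; simpl; unfold lsum in *; lra. Qed.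

Lemma pmod_2 {I} (x : vec I) i : pmod 2 x i = fst (x i) ^ 2 + snd (x i) ^ 2.
Proof.
  unfold pmod. rewrite rpow_2 by apply Cmod_nonneg. unfold Cmod. apply pow2_sqrt. nra.
Qed.

(* The cross terms are antisymmetric under [ptn], hence cancel on a [ptn]-stable finite set. *)
Lemma rot_contraction {I} (al be : I -> R) ptn : rot_data al be ptn -> opbound 2 (rot al be ptn) 1.
Proof.
  intros H. split; [lra|]. intros x m [Hm Hx]. split; [lra|]. intros l Nl. rewrite Rmult_1_l.
  set (l' := nodup (fun a b => excluded_middle_informative (a = b)) (l ++ map ptn l)).
  assert (N' : NoDup l') by apply NoDup_nodup.
  assert (Hin : forall i, In i l' <-> In i l \/ In (ptn i) l).
  { intros i. unfold l'. rewrite nodup_In, in_app_iff, in_map_iff. split; (intros [?|Hi]; [auto|right]).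
    - destruct Hi as (j & <- & Hj). destruct (H j) as (-> & _). trivial.
    - exists (ptn i). split; trivial. apply H. }
  assert (Hp : Permutation (map ptn l') l').
  { apply NoDup_Permutation; trivial.
    - apply FinFun.Injective_map_NoDup; trivial. intros j j' E. rewrite <- (proj1 (H j)), E. apply H.
    - intros i. rewrite in_map_iff. split.
      + intros (j & <- & Hj). apply Hin in Hj. apply Hin. rewrite (proj1 (H j)). tauto.
      + intros Hi. exists (ptn i). split; [apply H|]. apply Hin. rewrite (proj1 (H i)). apply Hin in Hi. tauto. }
  apply Rle_trans with (lsum (pmod 2 (rot al be ptn x)) l').
  { apply lsum_incl; trivial; [apply pmod_nonneg|]. intros i Hi _. apply Hin. auto. }
  apply Rle_trans with (lsum (pmod 2 x) l'); [|auto].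
  assert (E1 : forall f, lsum (fun i => f (ptn i)) l' = lsum f l').
  { intros f. rewrite <- lsum_map. now apply lsum_perm. }
  pose proof (E1 (pmod 2 (rot al be ptn x))) as F1. pose proof (E1 (pmod 2 x)) as F2.
  assert (E2 : lsum (fun i => pmod 2 (rot al be ptn x) i + pmod 2 (rot al be ptn x) (ptn i)) l'
             = lsum (fun i => pmod 2 x i + pmod 2 x (ptn i)) l').
  { apply lsum_ext. intros i _. rewrite !pmod_2. unfold rot. destruct (H i) as (-> & -> & -> & H4).
    destruct (x i) as [a b], (x (ptn i)) as [a' b']. simpl.
    transitivity ((al i ^ 2 + be i ^ 2) * (a ^ 2 + b ^ 2 + a' ^ 2 + b' ^ 2)); [ring|rewrite H4; ring]. }
  rewrite !lsum_plus in E2. unfold lsum in *. lra.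
Qed.

(** * Weights *)

(* The node [nd n j] is the [j]-th entry of the [n]-th chain. *)
Definition row (k : nat) : nat := fst (Cantor.of_nat k).
Definition col (k : nat) : nat := snd (Cantor.of_nat k).
Definition nd (n j : nat) : nat := Cantor.to_nat (n, j).

Lemma row_nd n j : row (nd n j) = n.
Proof. unfold row, nd. now rewrite Cantor.cancel_of_to. Qed.

Lemma col_nd n j : col (nd n j) = j.
Proof. unfold col, nd. now rewrite Cantor.cancel_of_to. Qed.

Lemma nd_row_col k : nd (row k) (col k) = k.
Proof. unfold nd, row, col. rewrite <- surjective_pairing. apply Cantor.cancel_to_of. Qed.

(* In block [i], column [j] is placed at height [max (sqrt i) j]; the weights of the two nodes
   [mu i j] and [mu i j + 1] next to it have squares adding up to 1.  The maximum with [j] makes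
   the chains merge into the common tail of nodes [(j, j)]. *)
Definition mu (i j : nat) : nat := Nat.max (Nat.sqrt i) j.
Definition place (i j : nat) : R := Rmax (sqrt (INR i)) (INR j).
Definition hat (n : nat) (t : R) : R := Rmax 0 (1 - Rabs (t - INR n)).
Definition wt (i k : nat) : R := sqrt (hat (row k) (place i (col k))).

Lemma Nat_sqrt_INR i : INR (Nat.sqrt i) <= sqrt (INR i) < INR (Nat.sqrt i) + 1.
Proof.
  pose proof (Nat.sqrt_specif i) as [H1 H2].
  apply le_INR in H1. apply lt_INR in H2. rewrite mult_INR in H1, H2. rewrite S_INR in H2.
  pose proof (pos_INR (Nat.sqrt i)). pose proof (pos_INR i). split.
  - rewrite <- (sqrt_square (INR (Nat.sqrt i))) at 1 by trivial. now apply sqrt_le_1_alt.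
  - rewrite <- (sqrt_square (INR (Nat.sqrt i) + 1)) by lra. now apply sqrt_lt_1_alt.
Qed.

Lemma mu_pos i j : INR (mu i j) <= place i j < INR (mu i j) + 1.
Proof.
  unfold mu, place. pose proof (Nat_sqrt_INR i).
  destruct (Nat.max_spec (Nat.sqrt i) j) as [[H1 ->]|[H1 ->]].
  - apply le_INR in H1. rewrite S_INR in H1. rewrite Rmax_right; lra.
  - apply le_INR in H1. rewrite Rmax_left; lra.
Qed.

Lemma hat_range n t : 0 <= hat n t <= 1.
Proof. unfold hat. pose proof (Rabs_pos (t - INR n)). split; [apply Rmax_l|apply Rmax_lub; lra]. Qed.

Lemma wt_range i k : 0 <= wt i k <= 1.
Proof.
  pose proof (hat_range (row k) (place i (col k))) as H. split; [apply sqrt_pos|].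
  rewrite <- sqrt_1. apply sqrt_le_1_alt. apply H.
Qed.

Lemma wt_support i k : wt i k <> 0 -> row k = mu i (col k) \/ row k = S (mu i (col k)).
Proof.
  intros H. assert (Hh : 0 < 1 - Rabs (place i (col k) - INR (row k))).
  { apply Rnot_le_lt. intros Hle. apply H. unfold wt, hat. rewrite Rmax_left by trivial. apply sqrt_0. }
  pose proof (mu_pos i (col k)) as [H1 H2].
  assert (Hab : - 1 < place i (col k) - INR (row k) < 1).
  { apply and_comm, Rabs_def2. lra. }
  assert (H3 : INR (row k) < INR (S (S (mu i (col k))))) by (rewrite !S_INR; lra).
  assert (H4 : INR (mu i (col k)) < INR (S (row k))) by (rewrite !S_INR; lra).
  apply INR_lt in H3, H4. lia.
Qed.

Lemma wt_sq i j : wt i (nd (mu i j) j) ^ 2 + wt i (nd (S (mu i j)) j) ^ 2 = 1.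
Proof.
  unfold wt. rewrite !row_nd, !col_nd.
  rewrite !pow2_sqrt by apply hat_range. unfold hat.
  pose proof (mu_pos i j) as [H1 H2]. rewrite S_INR.
  rewrite (Rabs_right (_ - INR _)) by lra. rewrite (Rabs_left (_ - (INR _ + 1))) by lra.
  rewrite !Rmax_right by lra. ring.
Qed.

(** The weights are square roots of tent functions that reach 0, so they are only Hoelder continuous
    of exponent 1/2. *)
Lemma sqrt_diff a b : 0 <= a -> 0 <= b -> Rabs (sqrt a - sqrt b) <= sqrt (Rabs (a - b)).
Proof.
  assert (G : forall a b, 0 <= b <= a -> sqrt a - sqrt b <= sqrt (a - b)).
  { intros x y H. pose proof (sqrt_pos (x - y)). pose proof (sqrt_pos y).
    assert (sqrt x <= sqrt (x - y) + sqrt y); [|lra].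
    rewrite <- (sqrt_square (sqrt (x - y) + sqrt y)) by lra. apply sqrt_le_1_alt.
    pose proof (sqrt_sqrt (x - y) ltac:(lra)). pose proof (sqrt_sqrt y ltac:(lra)). nra. }
  intros Ha Hb. destruct (Rle_lt_dec b a).
  - pose proof (sqrt_le_1_alt b a ltac:(lra)). rewrite !Rabs_right by lra. apply G; lra.
  - pose proof (sqrt_le_1_alt a b ltac:(lra)). rewrite (Rabs_minus_sym a b), (Rabs_minus_sym (sqrt a)).
    rewrite !Rabs_right by lra. apply G; lra.
Qed.

Lemma hat_lip n t t' : Rabs (hat n t - hat n t') <= Rabs (t - t').
Proof.
  unfold hat, Rmax, Rabs. repeat destruct Rle_dec; repeat destruct Rcase_abs; lra.
Qed.

(** The block enters [place] only through [sqrt (INR i)], and both the maximum and the tent are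
    1-Lipschitz; hence a bound uniform in the node [k]. *)
Lemma wt_slow i i' k : Rabs (wt i k - wt i' k) <= sqrt (Rabs (sqrt (INR i) - sqrt (INR i'))).
Proof.
  unfold wt. eapply Rle_trans; [apply sqrt_diff; apply hat_range|].
  apply sqrt_le_1_alt. eapply Rle_trans; [apply hat_lip|].
  unfold place, Rmax, Rabs. repeat destruct Rle_dec; repeat destruct Rcase_abs; lra.
Qed.

(** * The implementing operator *)

Section Implement.
Context (blk : nat -> nat).

(* In block [i] the nodes [(mu i j, j)] and [(mu i j + 1, j)] are partners; [al] and [be] are the
   cosine and sine of their rotation, which stores the moving component at [(mu i j, j)]. *)
Definition ptn (i k : nat) : nat :=
  if Nat.eq_dec (row k) (mu i (col k)) then nd (S (mu i (col k))) (col k)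
  else if Nat.eq_dec (row k) (S (mu i (col k))) then nd (mu i (col k)) (col k) else k.

Definition al (i k : nat) : R :=
  if Nat.eq_dec (row k) (mu i (col k)) then wt i k
  else if Nat.eq_dec (row k) (S (mu i (col k))) then wt i (nd (mu i (col k)) (col k)) else 1.

Definition be (i k : nat) : R :=
  if Nat.eq_dec (row k) (mu i (col k)) then wt i (nd (S (mu i (col k))) (col k))
  else if Nat.eq_dec (row k) (S (mu i (col k))) then - wt i k else 0.

Lemma node_cases i k :
  k = nd (mu i (col k)) (col k) \/ k = nd (S (mu i (col k))) (col k) \/
  (row k <> mu i (col k) /\ row k <> S (mu i (col k))).
Proof.
  destruct (Nat.eq_dec (row k) (mu i (col k))) as [E|N].
  { left. now rewrite <- E, nd_row_col. }
  destruct (Nat.eq_dec (row k) (S (mu i (col k)))) as [E|N'].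
  { right; left. now rewrite <- E, nd_row_col. }
  auto.
Qed.

Lemma ptn_lo i j : ptn i (nd (mu i j) j) = nd (S (mu i j)) j.
Proof. unfold ptn. rewrite row_nd, col_nd. destruct Nat.eq_dec; congruence. Qed.
Lemma ptn_hi i j : ptn i (nd (S (mu i j)) j) = nd (mu i j) j.
Proof. unfold ptn. rewrite row_nd, col_nd. destruct Nat.eq_dec; [lia|]. destruct Nat.eq_dec; congruence. Qed.
Lemma al_lo i j : al i (nd (mu i j) j) = wt i (nd (mu i j) j).
Proof. unfold al. rewrite row_nd, col_nd. destruct Nat.eq_dec; congruence. Qed.
Lemma al_hi i j : al i (nd (S (mu i j)) j) = wt i (nd (mu i j) j).
Proof. unfold al. rewrite row_nd, col_nd. destruct Nat.eq_dec; [lia|]. destruct Nat.eq_dec; congruence. Qed.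
Lemma be_lo i j : be i (nd (mu i j) j) = wt i (nd (S (mu i j)) j).
Proof. unfold be. rewrite row_nd, col_nd. destruct Nat.eq_dec; congruence. Qed.
Lemma be_hi i j : be i (nd (S (mu i j)) j) = - wt i (nd (S (mu i j)) j).
Proof. unfold be. rewrite row_nd, col_nd. destruct Nat.eq_dec; [lia|]. destruct Nat.eq_dec; congruence. Qed.

Lemma node_rot_data i : rot_data (al i) (be i) (ptn i).
Proof.
  intros k. destruct (node_cases i k) as [E|[E|[N N']]].
  - rewrite E. rewrite !ptn_lo, !ptn_hi, !al_lo, !al_hi, !be_lo, !be_hi. repeat split. apply wt_sq.
  - rewrite E. rewrite !ptn_hi, !ptn_lo, !al_lo, !al_hi, !be_lo, !be_hi. repeat split; [ring|].
    rewrite <- (wt_sq i (col k)). ring.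
  - assert (E : ptn i k = k) by (unfold ptn; do 2 (destruct Nat.eq_dec; [contradiction|]); trivial).
    rewrite !E. unfold al, be. do 2 (destruct Nat.eq_dec; [contradiction|]). repeat split; ring.
Qed.

Definition alI (i : nat * (nat + nat)) : R := match i with (k, inl e) => al (blk e) k | (_, inr _) => 1 end.
Definition beI (i : nat * (nat + nat)) : R := match i with (k, inl e) => be (blk e) k | (_, inr _) => 0 end.
Definition ptnI (i : nat * (nat + nat)) : nat * (nat + nat) :=
  match i with (k, inl e) => (ptn (blk e) k, inl e) | (_, inr _) => i end.

Lemma rot_data_I : rot_data alI beI ptnI.
Proof.
  intros [k [e|e]]; simpl; [|repeat split; ring].
  destruct (node_rot_data (blk e) k) as (-> & -> & -> & H). repeat split; trivial.
Qed.

Definition alJ (j : nat + nat * (nat + nat)) : R := match j with inl _ => 1 | inr i => alI i end.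
Definition beJ (j : nat + nat * (nat + nat)) : R := match j with inl _ => 0 | inr i => beI i end.
Definition ptnJ (j : nat + nat * (nat + nat)) : nat + nat * (nat + nat) :=
  match j with inl _ => j | inr i => inr (ptnI i) end.

Lemma rot_data_J : rot_data alJ beJ ptnJ.
Proof.
  intros [e|i]; simpl; [repeat split; ring|].
  destruct (rot_data_I i) as (-> & -> & -> & H). repeat split; trivial.
Qed.

(** Position [j] of the target is filled from [sg j]. The storing node of a column reads that of the
    next column and the summand of psi_1 reads the head, so [impl] empties the chains and [impl_inv]
    is the map that pushes psi_1 into them. *)
Definition sg (j : nat + nat * (nat + nat)) : nat * (nat + nat) :=
  match j with
  | inl e => (nd (mu (blk e) 0) 0, inl e)
  | inr (k, inl e) =>
      if Nat.eq_dec (row k) (mu (blk e) (col k)) then (nd (mu (blk e) (S (col k))) (S (col k)), inl e)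
      else (k, inl e)
  | inr (k, inr e) => (k, inr e)
  end.

Definition tg (i : nat * (nat + nat)) : nat + nat * (nat + nat) :=
  match i with
  | (k, inl e) =>
      if Nat.eq_dec (row k) (mu (blk e) (col k))
      then match col k with O => inl e | S j => inr (nd (mu (blk e) j) j, inl e) end
      else inr (k, inl e)
  | (k, inr e) => inr (k, inr e)
  end.

Lemma tg_sg j : tg (sg j) = j.
Proof.
  destruct j as [e|[k [e|e]]]; simpl; trivial.
  - rewrite row_nd, col_nd. destruct Nat.eq_dec; [trivial|congruence].
  - destruct Nat.eq_dec as [E|N]; simpl.
    + rewrite row_nd, col_nd. destruct Nat.eq_dec; [|congruence]. now rewrite <- E, nd_row_col.
    + destruct Nat.eq_dec; [contradiction|trivial].
Qed.

Lemma sg_tg i : sg (tg i) = i.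
Proof.
  destruct i as [k [e|e]]; simpl; trivial.
  destruct Nat.eq_dec as [E|N]; simpl.
  - destruct (col k) as [|j] eqn:Ec; simpl.
    + rewrite <- E, <- Ec. now rewrite nd_row_col.
    + rewrite row_nd, col_nd. destruct Nat.eq_dec; [|congruence]. rewrite <- E, <- Ec. now rewrite nd_row_col.
  - destruct Nat.eq_dec; [contradiction|trivial].
Qed.

(** The first rotation collects the moving component of each column at its storing node; the second,
    with the opposite sign, spreads the shifted components again over their pairs. *)
Definition impl : op (nat * (nat + nat)) (nat + nat * (nat + nat)) :=
  fun y => rot alJ (fun j => - beJ j) ptnJ (fun j => rot alI beI ptnI y (sg j)).
Definition impl_inv : op (nat + nat * (nat + nat)) (nat * (nat + nat)) :=
  fun x => rot alI (fun i => - beI i) ptnI (fun i => rot alJ beJ ptnJ x (tg i)).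

Lemma impl_inv_impl y : impl_inv (impl y) = y.
Proof.
  unfold impl_inv, impl. rewrite (rot_opp_rot alJ beJ ptnJ) by apply rot_data_J.
  replace (fun i => rot alI beI ptnI y (sg (tg i))) with (rot alI beI ptnI y).
  - apply rot_rot_opp, rot_data_I.
  - extensionality i. now rewrite sg_tg.
Qed.

Lemma impl_impl_inv x : impl (impl_inv x) = x.
Proof.
  unfold impl_inv, impl. rewrite (rot_opp_rot alI beI ptnI) by apply rot_data_I.
  replace (fun j => rot alJ beJ ptnJ x (tg (sg j))) with (rot alJ beJ ptnJ x).
  - apply rot_rot_opp, rot_data_J.
  - extensionality j. now rewrite tg_sg.
Qed.

Lemma sg_inj j j' : sg j = sg j' -> j = j'.
Proof. intros E. rewrite <- (tg_sg j), E. apply tg_sg. Qed.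
Lemma tg_inj i i' : tg i = tg i' -> i = i'.
Proof. intros E. rewrite <- (sg_tg i), E. apply sg_tg. Qed.

Lemma impl_linear p : linear_op p impl.
Proof. intros c x y _ _. extensionality j. unfold impl, rot, vadd, vscale. apply Ceq; simpl; ring. Qed.

Lemma impl_inv_linear p : linear_op p impl_inv.
Proof. intros c x y _ _. extensionality j. unfold impl_inv, rot, vadd, vscale. apply Ceq; simpl; ring. Qed.

(** The bound [r] for rotations is left open to serve twice: 2 for general p, and 1 for p = 2. *)
Lemma impl_opbound_gen p (Hp : 1 < p) r :
  (forall (I : Type) (a b : I -> R) f, rot_data a b f -> opbound p (rot a b f) r) ->
  opbound p impl (r * r) /\ opbound p impl_inv (r * r).
Proof.
  intros H. pose proof (H _ _ _ _ rot_data_I) as H1. pose proof (H _ _ _ _ (rot_data_opp _ _ _ rot_data_I)) as H2.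
  pose proof (H _ _ _ _ rot_data_J) as H3. pose proof (H _ _ _ _ (rot_data_opp _ _ _ rot_data_J)) as H4.
  assert (0 <= r) by apply H1.
  split; (split; [nra|]); intros x m Hx; rewrite Rmult_assoc; unfold impl, impl_inv.
  - apply H4. apply (nbound_inj p Hp sg); [apply sg_inj|]. now apply H1.
  - apply H2. apply (nbound_inj p Hp tg); [apply tg_inj|]. now apply H3.
Qed.

Lemma impl_opbound p (Hp : 1 < p) : opbound p impl 4 /\ opbound p impl_inv 4.
Proof.
  replace 4 with (2 * 2) by ring. apply impl_opbound_gen; trivial. intros; now apply rot_opbound.
Qed.

Lemma impl_contraction : opbound 2 impl 1 /\ opbound 2 impl_inv 1.
Proof.
  replace 1 with (1 * 1) by ring. apply impl_opbound_gen; [lra|]. intros; now apply rot_contraction.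
Qed.

(** * An explicit formula for the implementing operator *)

Definition rsc (r : R) (z : Defs.C) : Defs.C := Cmul (r, 0) z.

(** The coefficient of [y] along the unit vector of weights of column [j]: the moving component of
    that column in block [i]. *)
Definition csum (i j : nat) (y : nat -> Defs.C) : Defs.C :=
  Cadd (rsc (wt i (nd (mu i j) j)) (y (nd (mu i j) j)))
       (rsc (wt i (nd (S (mu i j)) j)) (y (nd (S (mu i j)) j))).

Lemma impl_inl y e : impl y (inl e) = csum (blk e) 0 (fun k => y (k, inl e)).
Proof.
  unfold impl, rot, csum, rsc. simpl. rewrite ptn_lo, al_lo, be_lo. apply Ceq; simpl; ring.
Qed.

Lemma impl_inr_inr y k e : impl y (inr (k, inr e)) = y (k, inr e).
Proof. unfold impl, rot. simpl. apply Ceq; simpl; ring. Qed.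

(** Rotations and shift combine into one correction: the component along the weight vector of a
    column is replaced by the component of the next column. Only weights appear, so their slow
    variation becomes usable, and nodes outside a pair are covered by weight 0. *)
Lemma impl_inr_inl y k e :
  impl y (inr (k, inl e)) =
  Cadd (y (k, inl e)) (rsc (wt (blk e) k)
    (Csub (csum (blk e) (S (col k)) (fun k' => y (k', inl e))) (csum (blk e) (col k) (fun k' => y (k', inl e))))).
Proof.
  set (i := blk e). unfold impl. unfold rot at 1. simpl alJ. simpl beJ. simpl ptnJ. fold i.
  pose proof (wt_sq i (col k)) as Hsq.
  set (w := rot alI beI ptnI y).
  assert (Hlo : forall j, w (nd (mu i j) j, inl e) = csum i j (fun k => y (k, inl e))).
  { intros j. unfold w, rot, csum, rsc. simpl. fold i. rewrite ptn_lo, al_lo, be_lo. reflexivity. }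
  assert (Hhi : w (nd (S (mu i (col k))) (col k), inl e) =
     Csub (rsc (wt i (nd (mu i (col k)) (col k))) (y (nd (S (mu i (col k))) (col k), inl e)))
          (rsc (wt i (nd (S (mu i (col k))) (col k))) (y (nd (mu i (col k)) (col k), inl e)))).
  { unfold w, rot, rsc. simpl. fold i. rewrite ptn_hi, al_hi, be_hi. apply Ceq; simpl; ring. }
  destruct (node_cases i k) as [E|[E|[N N']]].
  - assert (Er : row k = mu i (col k)) by (rewrite E at 1; apply row_nd).
    assert (S1 : sg (inr (k, inl e)) = (nd (mu i (S (col k))) (S (col k)), inl e)).
    { simpl. fold i. destruct Nat.eq_dec; [trivial|contradiction]. }
    assert (S2 : sg (inr (ptn i k, inl e)) = (nd (S (mu i (col k))) (col k), inl e)).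
    { rewrite E, ptn_lo. rewrite col_nd. simpl. rewrite row_nd, col_nd. fold i. destruct Nat.eq_dec; [lia|trivial]. }
    rewrite S1, S2, Hlo, Hhi.
    assert (Ea : al i k = wt i k) by (rewrite E, al_lo; trivial).
    assert (Eb : be i k = wt i (nd (S (mu i (col k))) (col k))) by (rewrite E at 1; rewrite be_lo; trivial).
    rewrite Ea, Eb. rewrite <- E in Hsq |- *. unfold csum at 3. rewrite <- E. unfold rsc.
    set (c' := csum _ _ _). set (h0 := wt i k) in *. set (h1 := wt i (nd (S _) _)) in *.
    destruct (y (k, inl e)) as [a b], (y (nd (S (mu i (col k))) (col k), inl e)) as [a' b'], c' as [s s'].
    (* The part [h1 ^ 2 * a] left by the rotations is [a] minus its share in the moving
       component. *)
    assert (Hq : h1 ^ 2 = 1 - h0 ^ 2) by lra.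
    apply Ceq; simpl.
    + transitivity (h0 * s - h0 * h1 * a' + h1 ^ 2 * a); [ring|rewrite Hq; ring].
    + transitivity (h0 * s' - h0 * h1 * b' + h1 ^ 2 * b); [ring|rewrite Hq; ring].
  - assert (Er : row k = S (mu i (col k))) by (rewrite E at 1; apply row_nd).
    assert (S1 : sg (inr (k, inl e)) = (k, inl e)).
    { simpl. fold i. destruct Nat.eq_dec; [lia|trivial]. }
    assert (S2 : sg (inr (ptn i k, inl e)) = (nd (mu i (S (col k))) (S (col k)), inl e)).
    { rewrite E, ptn_hi. rewrite col_nd. simpl. rewrite row_nd, col_nd. fold i. destruct Nat.eq_dec; [trivial|congruence]. }
    rewrite S1, S2, Hlo. rewrite <- E in Hhi. rewrite Hhi.
    assert (Ea : al i k = wt i (nd (mu i (col k)) (col k))) by (rewrite E at 1; rewrite al_hi; trivial).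
    assert (Eb : be i k = - wt i k) by (rewrite E, be_hi; trivial).
    rewrite Ea, Eb. rewrite <- E in Hsq. unfold csum at 3. rewrite <- E. unfold rsc.
    set (c' := csum _ _ _). set (h0 := wt i (nd _ _)) in *. set (h1 := wt i k) in *.
    destruct (y (k, inl e)) as [a b], (y (nd (mu i (col k)) (col k), inl e)) as [a' b'], c' as [s s'].
    assert (Hq : h0 ^ 2 = 1 - h1 ^ 2) by lra.
    apply Ceq; simpl.
    + transitivity (h1 * s - h0 * h1 * a' + h0 ^ 2 * a); [ring|rewrite Hq; ring].
    + transitivity (h1 * s' - h0 * h1 * b' + h0 ^ 2 * b); [ring|rewrite Hq; ring].
  - assert (Hz : wt i k = 0).
    { apply NNPP. intros H. apply wt_support in H. tauto. }
    rewrite Hz.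
    assert (E : ptn i k = k) by (unfold ptn; do 2 (destruct Nat.eq_dec; [contradiction|]); trivial).
    assert (Ea : al i k = 1) by (unfold al; do 2 (destruct Nat.eq_dec; [contradiction|]); trivial).
    assert (Eb : be i k = 0) by (unfold be; do 2 (destruct Nat.eq_dec; [contradiction|]); trivial).
    assert (S1 : sg (inr (k, inl e)) = (k, inl e)).
    { simpl. fold i. destruct Nat.eq_dec; [contradiction|trivial]. }
    rewrite E, Ea, Eb, S1.
    assert (Ew : w (k, inl e) = y (k, inl e)).
    { unfold w, rot. simpl. fold i. rewrite E, Ea, Eb. apply Ceq; simpl; ring. }
    rewrite Ew. unfold rsc. apply Ceq; simpl; ring.
Qed.

End Implement.

(** * Finite combinations *)

Definition lcomb {E} (l : list nat) (g : nat -> R) (u : nat -> vec E) : vec E :=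
  fun e => (lsum (fun k => g k * fst (u k e)) l, lsum (fun k => g k * snd (u k e)) l).

Lemma lcomb_cons {E} a l g (u : nat -> vec E) :
  lcomb (a :: l) g u = vadd (vscale (g a, 0) (u a)) (lcomb l g u).
Proof. extensionality e. unfold lcomb, vadd, vscale. apply Ceq; simpl; unfold lsum; ring. Qed.

Lemma lin_lcomb {E E'} p (Hp : 1 < p) (T : op E E') l g (u : nat -> vec E) :
  linear_op p T -> (forall k, in_lp p (u k)) ->
  T (lcomb l g u) = lcomb l g (fun k => T (u k)) /\ in_lp p (lcomb l g u).
Proof.
  intros HT Hu. induction l as [|a l [IH1 IH2]].
  - split; [|apply in_lp_zero; trivial]. apply (lin_0 p T HT).
  - rewrite !lcomb_cons. rewrite HT, IH1 by trivial. split; trivial.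
    apply in_lp_vadd; trivial. apply in_lp_vscale; trivial.
Qed.

Lemma lcomb_vadd_vscale {E} l g c (u v : nat -> vec E) :
  lcomb l g (fun k => vadd (vscale c (u k)) (v k)) = vadd (vscale c (lcomb l g u)) (lcomb l g v).
Proof.
  induction l as [|a l IH].
  - extensionality e. apply Ceq; simpl; ring.
  - rewrite !lcomb_cons, IH. extensionality e. unfold vadd, vscale. apply Ceq; simpl; ring.
Qed.

Lemma lsum_superset {I} (f : I -> R) l l' :
  NoDup l -> NoDup l' -> incl l l' -> (forall i, In i l' -> ~ In i l -> f i = 0) -> lsum f l = lsum f l'.
Proof.
  intros Nl. revert l'. induction Nl as [|a l Ha Nl IH]; intros l' Nl' Hi Hz.
  - symmetry. apply lsum_zero. intros; apply Hz; auto.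
  - destruct (in_split a l') as (l1 & l2 & ->); [apply Hi; simpl; auto|].
    pose proof (NoDup_remove _ _ _ Nl') as [N1 N2].
    rewrite lsum_app. simpl. change (fold_right (fun i acc => f i + acc) 0 l2) with (lsum f l2).
    change (fold_right (fun i acc => f i + acc) 0 l) with (lsum f l).
    rewrite (IH (l1 ++ l2)); trivial; [rewrite lsum_app; ring| |].
    + intros i Hil. assert (H : In i (l1 ++ a :: l2)) by (apply Hi; simpl; auto).
      rewrite in_app_iff in *. simpl in H. destruct H as [|[<-|]]; auto. contradiction.
    + intros i Hil Hn. apply Hz; [rewrite in_app_iff in *; simpl; tauto|].
      intros [<-|]; contradiction.
Qed.

(** Brings combinations with the coefficients of two different blocks onto a common list. *)
Lemma lcomb_superset {E} l l' g (u : nat -> vec E) :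
  NoDup l -> NoDup l' -> incl l l' -> (forall i, In i l' -> ~ In i l -> g i = 0) -> lcomb l g u = lcomb l' g u.
Proof.
  intros H1 H2 H3 H4. extensionality e. unfold lcomb.
  f_equal; apply lsum_superset; trivial; intros i Hi Hn; rewrite H4 by trivial; ring.
Qed.

Lemma lcomb_sub_le {E} l g g' (u u' : nat -> vec E) e :
  Cmod (Csub (lcomb l g u e) (lcomb l g' u' e)) <=
  lsum (fun k => Cmod (vsub (vscale (g k, 0) (u k)) (vscale (g' k, 0) (u' k)) e)) l.
Proof.
  induction l as [|a l IH].
  - simpl. replace (Csub _ _) with C0 by (apply Ceq; simpl; ring). rewrite Cmod_C0. lra.
  - rewrite !lcomb_cons. simpl.
    change (fold_right (fun i acc => ?f i + acc) 0 l) with (lsum (fun k => Cmod (vsub (vscale (g k, 0) (u k)) (vscale (g' k, 0) (u' k)) e)) l).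
    eapply Rle_trans; [|apply Rplus_le_compat_l, IH].
    eapply Rle_trans; [|apply Cmod_add]. right. f_equal. unfold vadd, vscale, vsub. apply Ceq; simpl; ring.
Qed.

Lemma lcomb_ext {E} l g (u u' : nat -> vec E) e : (forall k, In k l -> u k e = u' k e) -> lcomb l g u e = lcomb l g u' e.
Proof. intros H. unfold lcomb. f_equal; apply lsum_ext; intros k Hk; now rewrite H. Qed.

Lemma nbound_exhaust {I} p (ev : I -> nat) (x : vec I) c :
  (forall L, nbound p (restr (fun i => ev i < L)%nat x) c) -> nbound p x c.
Proof.
  intros H. split; [apply (H 0%nat)|]. intros l Nl. destruct (list_rank_bound ev l) as [N HN].
  erewrite lsum_ext; [apply (H N); trivial|]. intros i Hi. unfold pmod. now rewrite restr_in by auto.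
Qed.

Lemma lsum_list_prod {A B} (f : A -> R) (g : B -> R) l l' :
  lsum (fun q => f (fst q) * g (snd q)) (list_prod l l') = lsum f l * lsum g l'.
Proof.
  induction l as [|a l IH]; simpl; [unfold lsum; simpl; ring|].
  rewrite lsum_app, lsum_map, IH. simpl. rewrite lsum_scale.
  change (lsum (fun j => g j) l') with (lsum g l'). unfold lsum. ring.
Qed.

Lemma half_pow_range n : 0 < (1 / 2) ^ n <= 1.
Proof.
  split; [apply pow_lt; lra|]. apply Rle_trans with (1 ^ n); [apply pow_incr; lra|rewrite pow1; lra].
Qed.

Lemma lsum_half_pow n : 0 <= lsum (fun i => (1 / 2) ^ i) (seq 0 n) <= 2.
Proof.
  assert (H : forall s, lsum (fun i => (1 / 2) ^ i) (seq s n) = 2 * (1 / 2) ^ s - 2 * (1 / 2) ^ (s + n)).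
  { induction n as [|n IH]; intros s.
    - rewrite Nat.add_0_r. simpl. ring.
    - simpl. change (fold_right _ 0 (seq (S s) n)) with (lsum (fun i => (1 / 2) ^ i) (seq (S s) n)).
      rewrite IH. replace (s + S n)%nat with (S s + n)%nat by lia. simpl. field. }
  pose proof (half_pow_range n) as Hn.
  rewrite H, pow_O, Nat.add_0_l. set (t := (1 / 2) ^ n) in *. clearbody t. lra.
Qed.

(** * The commutation error as a sparse operator matrix *)

Section Error.
Context (p : R) (Hp : 1 < p) (blk : nat -> nat).
Context (Rop : option nat -> op (nat + nat) (nat + nat)) (B : R).
Context (HRl : forall k, linear_op p (Rop k)) (HRb : forall k, opbound p (Rop k) B).

Definition bz (z : nat + nat) : nat := match z with inl e => blk e | inr e => blk e end.
Definition isl (z : nat + nat) : Prop := match z with inl _ => True | inr _ => False end.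

(** The coefficients in [impl_inl] and [impl_inr_inl] once the identity is removed: products of two
    weights, positive towards the next column and negative within the own column. *)
Definition gc (i : nat) (k : option nat) (l : nat) : R :=
  match k with
  | None => if Nat.eq_dec (col l) 0 then wt i l else 0
  | Some k => wt i k * wt i l *
      ((if Nat.eq_dec (col l) (S (col k)) then 1 else 0) - (if Nat.eq_dec (col l) (col k) then 1 else 0))
  end.

Definition pair_at (i j : nat) : list nat := nd (mu i j) j :: nd (S (mu i j)) j :: nil.

(** A list containing the support of row [k] of [gc i]. It is empty when [k] is off the pair of its
    column, which bounds the columns of the matrix as well as its rows. *)
Definition near_nodes (i : nat) (k : option nat) : list nat :=
  match k with
  | None => pair_at i 0
  | Some k => if excluded_middle_informative (In k (pair_at i (col k)))
              then pair_at i (col k) ++ pair_at i (S (col k)) else nil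
  end.

Lemma in_pair_at i j l : In l (pair_at i j) <-> col l = j /\ (row l = mu i j \/ row l = S (mu i j)).
Proof.
  simpl. split.
  - intros [<-|[<-|[]]]; rewrite row_nd, col_nd; auto.
  - intros [<- [E|E]]; rewrite <- E, nd_row_col; auto.
Qed.

Lemma NoDup_pair_at i j : NoDup (pair_at i j).
Proof.
  constructor; [|repeat constructor; intros []].
  intros [E|[]]. apply (f_equal row) in E. rewrite !row_nd in E. lia.
Qed.

Lemma NoDup_near_nodes i k : NoDup (near_nodes i k).
Proof.
  destruct k as [k|]; simpl; [|apply NoDup_pair_at].
  destruct excluded_middle_informative; [|constructor].
  change (NoDup (pair_at i (col k) ++ pair_at i (S (col k)))).
  apply NoDup_app; try apply NoDup_pair_at.
  intros l H1 H2. apply in_pair_at in H1, H2. lia.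
Qed.

Lemma wt_pair_at i l : wt i l <> 0 -> In l (pair_at i (col l)).
Proof. intros H. apply in_pair_at. split; trivial. now apply wt_support. Qed.

Lemma gc_near i k l : gc i k l <> 0 -> In l (near_nodes i k).
Proof.
  destruct k as [k|]; unfold gc, near_nodes.
  - intros H. assert (H1 : wt i k <> 0) by (intros E; apply H; rewrite E; ring).
    assert (H2 : wt i l <> 0) by (intros E; apply H; rewrite E; ring).
    apply wt_pair_at in H1, H2. destruct excluded_middle_informative; [|contradiction].
    apply in_app_iff. destruct (Nat.eq_dec (col l) (S (col k))) as [E|]; [rewrite <- E; auto|].
    destruct (Nat.eq_dec (col l) (col k)) as [E|]; [rewrite <- E; auto|]. exfalso. apply H. ring.
  - intros H. destruct Nat.eq_dec as [E|]; [|congruence]. apply wt_pair_at in H. now rewrite E in H.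
Qed.

(* [Wop] is the operator [impl] minus the inclusion, with the summand of [psi_1] as node [None]; on
   block [i] it is the scalar matrix [gc i]. *)
Definition Wop : op (nat * (nat + nat)) (option nat * (nat + nat)) :=
  fun x kz => match snd kz with
    | inl e => lcomb (near_nodes (blk e) (fst kz)) (gc (blk e) (fst kz)) (fun l z => x (l, z)) (inl e)
    | inr _ => C0 end.

(* The commutator of [impl] with the direct sum of the [Rop k]; the inclusion drops out. *)
Definition Dop : op (nat * (nat + nat)) (option nat * (nat + nat)) :=
  fun x kz => Csub (Rop (fst kz) (fun z => Wop x (fst kz, z)) (snd kz))
                   (Wop (dsumN (fun k => Rop (Some k)) x) kz).

Lemma csum_lcomb i j (y : nat -> vec (nat + nat)) (g : nat -> R) (c : R) z :
  (forall l, In l (pair_at i j) -> g l = c * wt i l) ->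
  lcomb (pair_at i j) g y z = rsc c (csum i j (fun k => y k z)).
Proof.
  intros H. unfold lcomb, csum, rsc, pair_at, lsum. simpl fold_right. rewrite !H by (simpl; auto).
  apply Ceq; simpl; ring.
Qed.

Lemma lcomb_app {E} l l' g (u : nat -> vec E) : lcomb (l ++ l') g u = vadd (lcomb l g u) (lcomb l' g u).
Proof. extensionality e. unfold lcomb, vadd. rewrite !lsum_app. reflexivity. Qed.

Lemma impl_Wop_inl x e : impl blk x (inl e) = Wop x (None, inl e).
Proof.
  rewrite impl_inl. unfold Wop. simpl fst. simpl snd. cbv iota.
  change (near_nodes (blk e) None) with (pair_at (blk e) 0).
  rewrite (csum_lcomb _ _ _ _ 1).
  - unfold rsc. apply Ceq; simpl; ring.
  - intros l Hl. apply in_pair_at in Hl. unfold gc. destruct Nat.eq_dec; [ring|lia].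
Qed.

Lemma impl_Wop_inr x k z : impl blk x (inr (k, z)) = Cadd (x (k, z)) (Wop x (Some k, z)).
Proof.
  destruct z as [e|e].
  2:{ rewrite impl_inr_inr. apply Ceq; simpl; ring. }
  rewrite impl_inr_inl. f_equal. unfold Wop, near_nodes. simpl fst. simpl snd. cbv iota.
  destruct excluded_middle_informative as [Hin|Hn].
  - rewrite lcomb_app. unfold vadd.
    rewrite (csum_lcomb _ (col k) _ _ (- wt (blk e) k)), (csum_lcomb _ (S (col k)) _ _ (wt (blk e) k)).
    + unfold rsc. apply Ceq; simpl; ring.
    + intros l Hl. apply in_pair_at in Hl. unfold gc.
      destruct Nat.eq_dec; [|lia]. destruct Nat.eq_dec; [lia|ring].
    + intros l Hl. apply in_pair_at in Hl. unfold gc.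
      destruct Nat.eq_dec; [lia|]. destruct Nat.eq_dec; [ring|lia].
  - assert (Hz : wt (blk e) k = 0) by (apply NNPP; intros H; apply Hn, wt_pair_at, H).
    rewrite Hz. unfold rsc, lcomb. simpl. apply Ceq; simpl; ring.
Qed.

Lemma Wop_linear : linear_op p Wop.
Proof.
  intros c x y _ _. extensionality kz. destruct kz as [k [e|e]]; unfold Wop; simpl fst; simpl snd; cbv iota.
  - exact (f_equal (fun f => f (inl e)) (lcomb_vadd_vscale (near_nodes (blk e) k) (gc (blk e) k) c
      (fun l z => x (l, z)) (fun l z => y (l, z)))).
  - unfold vadd, vscale. simpl. apply Ceq; simpl; ring.
Qed.

(** 4 for [impl] plus 1 for the inclusion. *)
Lemma Wop_opbound : opbound p Wop 5.
Proof.
  split; [lra|]. intros x m Hx. pose proof (impl_opbound blk p Hp) as [[_ Hi] _]. specialize (Hi x m Hx).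
  set (ix := (fun j => match j with inl _ => C0 | inr i => x i end) : vec (nat + nat * (nat + nat))).
  assert (Hx' : nbound p ix m).
  { rewrite <- (Rmult_1_l m). apply (nbound_reindex p Hp x _ (fun j : nat + nat * (nat + nat) => match j with inl _ => (0%nat, inl 0%nat) | inr i => i end)); trivial; [lra| |].
    - intros [e|i] H; [exfalso; now apply H|simpl; lra].
    - intros [e|i] [e'|i'] H H'; try (exfalso; now apply H); try (exfalso; now apply H'). congruence. }
  replace (5 * m) with (1 * (4 * m + m)) by ring.
  apply (nbound_reindex p Hp (vsub (impl blk x) ix) _
    (fun kz => match kz with (None, inl e) => inl e | (None, inr e) => inl e | (Some k, z) => inr (k, z) end)); [lra| | |].
  - intros [[k|] [e|e]] H.
    + unfold vsub, ix. rewrite impl_Wop_inr. rewrite Rmult_1_l. right. f_equal. apply Ceq; simpl; ring.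
    + unfold vsub, ix. rewrite impl_Wop_inr. rewrite Rmult_1_l. right. f_equal. apply Ceq; simpl; ring.
    + unfold vsub, ix. rewrite impl_Wop_inl. rewrite Rmult_1_l. right. f_equal. apply Ceq; simpl; ring.
    + exfalso. apply H. reflexivity.
  - intros [[k|] [e|e]] [[k'|] [e'|e']] H H'; try congruence; try (exfalso; apply H; reflexivity); try (exfalso; apply H'; reflexivity).
  - apply nbound_vsub; trivial.
Qed.

Lemma fiber_in_lp {K} (x : vec (K * (nat + nat))) k : in_lp p x -> in_lp p (fun z => x (k, z)).
Proof. intros H. apply (in_lp_inj p Hp (pair k) x); [congruence|trivial]. Qed.

Lemma B_nonneg : 0 <= B.
Proof. apply (HRb None). Qed.

Lemma Dop_linear : linear_op p Dop.
Proof.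
  intros c x y Hx Hy. extensionality kz. destruct kz as [k z]. unfold Dop. simpl fst; simpl snd.
  rewrite (linear_dsumN p Hp (fun k => Rop (Some k))) by trivial.
  assert (H1 : opbound p (dsumN (fun k => Rop (Some k))) B) by (apply opbound_dsumN; trivial; apply B_nonneg).
  rewrite !Wop_linear; trivial; try (eapply in_lp_opbound; eauto).
  change (fun z0 => vadd (vscale c (Wop x)) (Wop y) (k, z0)) with
    (vadd (vscale c (fun z0 => Wop x (k, z0))) (fun z0 => Wop y (k, z0))).
  rewrite HRl; [|apply fiber_in_lp; eapply in_lp_opbound; eauto using Wop_opbound..].
  unfold vadd, vscale. apply Ceq; simpl; ring.
Qed.

Lemma Dop_opbound : opbound p Dop (B * 5 + 5 * B).
Proof.
  pose proof B_nonneg as HB.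
  assert (H1 : opbound p (dsumN (fun k => Rop (Some k))) B) by (apply opbound_dsumN; trivial).
  assert (H2 : opbound p (fun x kz => Rop (fst kz) (fun z => Wop x (fst kz, z)) (snd kz)) (B * 5)).
  { split; [nra|]. intros x m Hx. rewrite Rmult_assoc.
    apply (nbound_prod p Hp (Wop x)); trivial; [|now apply Wop_opbound].
    intros k m' Hm'. simpl. apply (HRb k). trivial. }
  exact (opbound_opsub p Hp _ _ _ _ H2 (opbound_comp p _ _ _ _ Wop_opbound H1)).
Qed.

(** A commutator entry from block [i'] to block [i] has the weights of [i'] in one term and those of
    [i] in the other, so both supports are listed. *)
Definition nbr (i i' : nat) (k : option nat) : list nat := nodup Nat.eq_dec (near_nodes i k ++ near_nodes i' k).

Definition back_at (i l : nat) : list (option nat) :=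
  None :: map Some (pair_at i (col l)) ++ map Some (pair_at i (pred (col l))).

Lemma near_nodes_back i k l : In l (near_nodes i k) -> In k (back_at i l).
Proof.
  destruct k as [k|]; [|simpl; auto]. unfold near_nodes, back_at. intros H. right.
  destruct excluded_middle_informative as [Hk|]; [|destruct H].
  apply in_app_iff in H. apply in_app_iff.
  destruct H as [H|H]; apply in_pair_at in H; destruct H as [E _]; [left|right]; apply in_map; rewrite E; trivial.
Qed.

(** Bounds one commutator entry with input block [i'] and output block [i]. The scalar matrix acts
    before [Rop k] in one term and after [Rop (Some l)] in the other; [restr isl] is the projection
    onto the psi-components. *)
Definition entry_bound (i i' : nat) (k : option nat) (l : nat) (c : R) : Prop :=
  forall u m, nbound p u m -> (forall z, bz z <> i' -> u z = C0) ->
    nbound p (restr (fun z => bz z = i)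
      (vsub (vscale (gc i' k l, 0) (Rop k (restr isl u)))
            (vscale (gc i k l, 0) (restr isl (Rop (Some l) u))))) (c * m).

Lemma Dop_entries i i' x k z :
  in_lp p x -> (forall l z', bz z' <> i' -> x (l, z') = C0) -> bz z = i ->
  Dop x (k, z) = Csub (lcomb (nbr i i' k) (gc i' k) (fun l => Rop k (restr isl (fun z => x (l, z)))) z)
                      (lcomb (nbr i i' k) (gc i k) (fun l => restr isl (Rop (Some l) (fun z => x (l, z)))) z).
Proof.
  intros Hx Hs Hz. unfold Dop. simpl fst; simpl snd.
  assert (Hl : forall l, in_lp p (restr isl (fun z => x (l, z)))) by (intros; apply in_lp_restr; trivial; now apply fiber_in_lp).
  assert (Hsup : forall j, j = i \/ j = i' -> forall E (u : nat -> vec E),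
     lcomb (near_nodes j k) (gc j k) u = lcomb (nbr i i' k) (gc j k) u).
  { intros j Hj E u. apply lcomb_superset; [apply NoDup_near_nodes|apply NoDup_nodup| |].
    - intros l Hin. unfold nbr. rewrite nodup_In, in_app_iff. destruct Hj; subst; auto.
    - intros l _ Hn. apply NNPP. intros Hg. apply Hn, gc_near, Hg. }
  f_equal.
  - rewrite <- (Hsup i' (or_intror eq_refl)).
    rewrite <- (proj1 (lin_lcomb p Hp (Rop k) _ _ _ (HRl k) Hl)). f_equal. extensionality z'.
    unfold Wop. simpl fst; simpl snd. destruct z' as [e|e].
    + destruct (Nat.eq_dec (blk e) i') as [E|N].
      * rewrite E. apply lcomb_ext. intros l _. now rewrite restr_in by exact I.
      * assert (H0 : forall (g : nat -> R) l (u : nat -> vec (nat + nat)), (forall l, u l (inl e) = C0) -> lcomb l g u (inl e) = C0).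
        { intros g l u Hu. unfold lcomb. unfold C0. f_equal; apply lsum_zero; intros; rewrite Hu; simpl; ring. }
        rewrite !H0; trivial.
        -- intros l. rewrite restr_in by exact I. apply Hs; trivial.
        -- intros l. apply Hs; trivial.
    + unfold lcomb, C0. f_equal; symmetry; apply lsum_zero; intros; rewrite restr_out by (intros []); simpl; ring.
  - unfold Wop. simpl fst; simpl snd. destruct z as [e|e].
    + simpl in Hz. rewrite Hz, <- (Hsup i (or_introl eq_refl)). apply lcomb_ext. intros l _. now rewrite restr_in by exact I.
    + unfold lcomb, C0. f_equal; symmetry; apply lsum_zero; intros; rewrite restr_out by (intros []); simpl; ring.
Qed.

(** 100 is the square of 10: with two blocks, a row has at most 4 + 4 entries and a column at most 5
    + 5. [Q] selects the nodes at which entry bounds are available. *)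
Lemma pair_block_bound (Q : option nat -> Prop) i i' x m c :
  0 <= c -> nbound p x m -> (forall l z, bz z <> i' -> x (l, z) = C0) ->
  (forall k l, Q k -> In l (nbr i i' k) -> entry_bound i i' k l c) ->
  nbound p (restr (fun kz => Q (fst kz) /\ bz (snd kz) = i) (Dop x)) (100 * c * m).
Proof.
  intros Hc Hx Hs HE.
  replace (100 * c * m) with (INR 10 * (INR 10 * (c * m))) by (simpl; ring).
  assert (Hlen : forall i k, (length (near_nodes i k) <= 4)%nat).
  { intros j [k|]; simpl; [|lia]. destruct excluded_middle_informative; simpl; lia. }
  apply (nbound_sparse p Hp
    (fun k => if excluded_middle_informative (Q k) then nbr i i' k else nil)
    (fun l => back_at i l ++ back_at i' l) 10 x _
    (fun k l => restr (fun z => bz z = i)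
      (vsub (vscale (gc i' k l, 0) (Rop k (restr isl (fun z => x (l, z)))))
            (vscale (gc i k l, 0) (restr isl (Rop (Some l) (fun z => x (l, z)))))))); trivial.
  - intros k. destruct excluded_middle_informative; [|simpl; lia]. unfold nbr.
    assert (H : (length (nodup Nat.eq_dec (near_nodes i k ++ near_nodes i' k)) <= length (near_nodes i k ++ near_nodes i' k))%nat).
    { apply NoDup_incl_length; [apply NoDup_nodup|]. intros a Ha. now apply nodup_In in Ha. }
    rewrite length_app in H. pose proof (Hlen i k). pose proof (Hlen i' k). lia.
  - intros k l. destruct excluded_middle_informative; [|intros []].
    unfold nbr. rewrite nodup_In, !in_app_iff. intros [H|H]; apply near_nodes_back in H; auto.
  - intros k l m' Hin Hm'. destruct excluded_middle_informative; [|destruct Hin].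
    apply HE; trivial. intros z Hz. now apply Hs.
  - intros k z. unfold restr at 1. destruct excluded_middle_informative as [[HQ Hz]|].
    2:{ rewrite Cmod_C0. apply lsum_nonneg. intros; apply Cmod_nonneg. }
    simpl in HQ, Hz. destruct excluded_middle_informative; [|contradiction].
    rewrite (Dop_entries i i'); trivial; [|eapply nbound_in_lp; eauto].
    eapply Rle_trans; [apply lcomb_sub_le|]. apply lsum_le. intros l _. rewrite restr_in by trivial. lra.
Qed.

Lemma Dop_blocks L x :
  in_lp p x -> forall kz,
  Cmod (Dop (restr (fun i => bz (snd i) < L)%nat x) kz) <=
  lsum (fun i' => Cmod (Dop (restr (fun i => bz (snd i) = i') x) kz)) (seq 0 L).
Proof.
  intros Hx kz. induction L as [|L IH].
  - replace (restr _ x) with (fun _ : nat * (nat + nat) => C0).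
    + rewrite lin_0 with (p := p); trivial; [|apply Dop_linear]. rewrite Cmod_C0. simpl. lra.
    + extensionality i. rewrite restr_out; trivial. lia.
  - rewrite seq_S, lsum_app. simpl.
    replace (restr (fun i => bz (snd i) < S L)%nat x) with
      (vadd (restr (fun i => bz (snd i) < L)%nat x) (restr (fun i => bz (snd i) = L) x)).
    + rewrite lin_vadd with (p := p); trivial; [|apply Dop_linear|now apply in_lp_restr..].
      eapply Rle_trans; [apply Cmod_add|]. lra.
    + extensionality i. unfold vadd, restr.
      repeat destruct excluded_middle_informative; try lia; apply Ceq; simpl; ring.
Qed.

Section NearFar.
(** Three regimes for a pair of blocks: neighbours far out have small, but not summable, entries;
    distant pairs have summable entries; and below any [N] only finitely many nodes have nonzero
    entries. *)
Context (Hnear : forall eps, 0 < eps -> exists N, forall i i' k l,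
  (N <= Nat.max i i')%nat -> (i <= S i')%nat -> (i' <= S i)%nat -> In l (nbr i i' k) -> entry_bound i i' k l eps).
Context (N0 : nat) (c0 : R) (Hc0 : 0 <= c0).
Context (Hfar : forall i i' k l, (N0 <= Nat.max i i')%nat -> (S i < i' \/ S i' < i)%nat ->
  In l (nbr i i' k) -> entry_bound i i' k l (c0 * (1 / 8) ^ Nat.max i i')).
Context (Hzero : forall N, exists F : list (option nat), forall k, ~ In k F -> forall i i' l,
  (Nat.max i i' < N)%nat -> In l (nbr i i' k) -> entry_bound i i' k l 0).
Context (Hfin : forall N, exists l : list (nat + nat), forall z, (bz z < N)%nat -> In z l).

(** [sigma] describes one diagonal of the block matrix. By injectivity it matches distinct input
    blocks with disjoint output blocks, so the bound is not summed over infinitely many pairs. *)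
Lemma near_diagonal_bound (sigma : nat -> option nat) N eps x m :
  0 <= eps ->
  (forall i j i', sigma i = Some i' -> sigma j = Some i' -> i = j) ->
  (forall i i', sigma i = Some i' -> (i <= S i')%nat /\ (i' <= S i)%nat) ->
  (forall i i' k l, (N <= Nat.max i i')%nat -> (i <= S i')%nat -> (i' <= S i)%nat ->
     In l (nbr i i' k) -> entry_bound i i' k l eps) ->
  nbound p x m ->
  nbound p (fun kz => match sigma (bz (snd kz)) with
     | Some i' => if excluded_middle_informative (N <= Nat.max (bz (snd kz)) i')%nat
                  then Dop (restr (fun i => bz (snd i) = i') x) kz else C0
     | None => C0 end : Defs.C) (100 * eps * m).
Proof.
  intros He Hinj Hclose Hent Hx.
  apply (nbound_blocks p Hp (fun i => Some (bz (snd i))) (fun kz => sigma (bz (snd kz))) x); trivial; [lra|].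
  intros [i'|] m' Hm'.
  2:{ apply nbound_zero; [destruct Hm'; nra|]. intros kz. unfold restr. destruct excluded_middle_informative as [E|]; trivial.
      now rewrite E. }
  destruct (classic (exists i, sigma i = Some i' /\ (N <= Nat.max i i')%nat)) as [(i & Ei & HN)|Hno].
  - assert (E : restr (fun i => Some (bz (snd i)) = Some i') x = restr (fun i => bz (snd i) = i') x).
    { apply restr_ext. intros j. split; congruence. }
    rewrite E in Hm'. destruct (Hclose _ _ Ei) as [C1 C2].
    assert (Hpb := pair_block_bound (fun _ => True) i i' _ _ eps He Hm'
      ltac:(intros l z Hz; apply restr_out; exact Hz) ltac:(intros k l _; now apply Hent)).
    revert Hpb. apply nbound_le; trivial. intros [k z]. unfold restr at 1.
    destruct excluded_middle_informative as [Ez|Ez].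
    + rewrite Ez. destruct excluded_middle_informative; [|rewrite Cmod_C0; apply Cmod_nonneg].
      rewrite restr_in; [lra|]. split; trivial. apply (Hinj _ _ i'); trivial.
    + rewrite Cmod_C0. apply Cmod_nonneg.
  - apply nbound_zero; [destruct Hm'; nra|]. intros [k z]. unfold restr. destruct excluded_middle_informative as [E|]; trivial.
    rewrite E. destruct excluded_middle_informative; trivial. exfalso. apply Hno. simpl in *. eauto.
Qed.

(** Since [1 / 8] is the cube of [1 / 2], one factor gives smallness in [N] and the other two keep
    the double sum below 4, uniformly in the cut-offs [L] and [L2]. *)
Lemma far_pair_sum N L L2 m :
  0 <= m ->
  lsum (fun q => if excluded_middle_informative
       ((N <= Nat.max (fst q) (snd q))%nat /\ (S (fst q) < snd q \/ S (snd q) < fst q)%nat)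
     then 100 * (c0 * (1 / 8) ^ Nat.max (fst q) (snd q)) * m else 0) (list_prod (seq 0 L2) (seq 0 L))
  <= 400 * c0 * (1 / 2) ^ N * m.
Proof.
  intros Hm. set (K := 100 * c0 * (1 / 2) ^ N * m).
  assert (HK : 0 <= K).
  { unfold K. pose proof (pow_le (1 / 2) N ltac:(lra)). apply Rmult_le_pos; trivial. apply Rmult_le_pos; [lra|trivial]. }
  apply Rle_trans with (lsum (fun q => K * ((1 / 2) ^ fst q * (1 / 2) ^ snd q)) (list_prod (seq 0 L2) (seq 0 L))).
  - apply lsum_le. intros [i i'] _. simpl fst; simpl snd.
    assert (Hpos : forall n, 0 < (1 / 2) ^ n) by (intros; apply pow_lt; lra).
    destruct excluded_middle_informative as [[H1 _]|_].
    + assert (Hmon : forall a b, (a <= b)%nat -> (1 / 2) ^ b <= (1 / 2) ^ a).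
      { intros a b Hab. replace b with (a + (b - a))%nat by lia. rewrite pow_add. pose proof (Hpos a).
        pose proof (half_pow_range (b - a)). nra. }
      assert (E : (1 / 8) ^ Nat.max i i' <= (1 / 2) ^ N * ((1 / 2) ^ i * (1 / 2) ^ i')).
      { replace (1 / 8) with ((1 / 2) * ((1 / 2) * (1 / 2))) by field. rewrite !Rpow_mult_distr.
        pose proof (Hmon N _ H1). pose proof (Hmon i (Nat.max i i') ltac:(lia)). pose proof (Hmon i' (Nat.max i i') ltac:(lia)).
        pose proof (Hpos N). pose proof (Hpos i). pose proof (Hpos i'). pose proof (Hpos (Nat.max i i')).
        apply Rmult_le_compat; try lra; [nra|]. apply Rmult_le_compat; lra. }
      unfold K. apply Rle_trans with (100 * (c0 * ((1 / 2) ^ N * ((1 / 2) ^ i * (1 / 2) ^ i'))) * m); [|right; ring].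
      apply Rmult_le_compat_r; trivial. apply Rmult_le_compat_l; [lra|]. apply Rmult_le_compat_l; trivial.
    + apply Rmult_le_pos; trivial. pose proof (Hpos i). pose proof (Hpos i'). nra.
  - rewrite lsum_scale.
    rewrite (lsum_list_prod (fun i => (1 / 2) ^ i) (fun i => (1 / 2) ^ i)).
    pose proof (lsum_half_pow L). pose proof (lsum_half_pow L2).
    replace (400 * c0 * (1 / 2) ^ N * m) with (K * 4) by (unfold K; ring).
    apply Rmult_le_compat_l; trivial. nra.
Qed.

Lemma Dop_small_tails : small_tails p Dop.
Proof.
  (* Three diagonals with factor 100 contribute [eps / 6] each; the distant pairs get the remaining
     [eps / 2]. *)
  intros eps He. destruct (Hnear (eps / 600) ltac:(lra)) as [N1 HN1].
  assert (Hh : exists n, 400 * c0 * (1 / 2) ^ n <= eps / 2).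
  { destruct (pow_lt_1_zero (1 / 2) ltac:(rewrite Rabs_right; lra) (eps / (800 * (c0 + 1)))) as [n Hn].
    - apply Rmult_lt_0_compat; [trivial|]. apply Rinv_0_lt_compat. lra.
    - exists n. specialize (Hn n ltac:(lia)). rewrite Rabs_right in Hn by (apply Rle_ge, pow_le; lra).
      apply Rle_trans with (400 * (c0 + 1) * (eps / (800 * (c0 + 1)))); [|right; field; lra].
      pose proof (pow_le (1 / 2) n ltac:(lra)). apply Rmult_le_compat; lra. }
  destruct Hh as [N2 HN2].
  set (N := Nat.max N0 (Nat.max N1 N2)).
  assert (HN : 400 * c0 * (1 / 2) ^ N <= eps / 2).
  { eapply Rle_trans; [|apply HN2]. apply Rmult_le_compat_l; [lra|].
    replace N with (N2 + (N - N2))%nat by (unfold N; lia). rewrite pow_add.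
    pose proof (pow_le (1 / 2) N2 ltac:(lra)).
    pose proof (half_pow_range (N - N2)). nra. }
  destruct (Hzero N) as [F HF]. destruct (Hfin N) as [zs Hzs].
  exists (list_prod F zs). intros x m Hx.
  assert (Hm : 0 <= m) by apply Hx.
  assert (Hxl : in_lp p x) by (eapply nbound_in_lp; eauto).
  (* Cut-offs to finitely many input and output blocks make all sums finite, with a bound that does
     not depend on them. *)
  assert (Hblk : forall L L2, nbound p (restr (fun kz => bz (snd kz) < L2)%nat
     (restr (fun kz => ~ In kz (list_prod F zs)) (Dop (restr (fun i => bz (snd i) < L)%nat x)))) (eps * m)).
  { intros L L2.
    set (Q := fun i' => Dop (restr (fun i => bz (snd i) = i') x)).
    set (nf := fun sigma : nat -> option nat => (fun kz => match sigma (bz (snd kz)) with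
     | Some i' => if excluded_middle_informative (N <= Nat.max (bz (snd kz)) i')%nat then Q i' kz else C0
     | None => C0 end) : vec (option nat * (nat + nat))).
    (* The three diagonals: output block [i] is paired with input block [i - 1], [i] or [i + 1]. *)
    set (s0 := fun i : nat => match i with O => None | S i => Some i end).
    set (s1 := fun i : nat => Some i). set (s2 := fun i : nat => Some (S i)).
    assert (Hent : forall i i' k l, (N <= Nat.max i i')%nat -> (i <= S i')%nat -> (i' <= S i)%nat ->
     In l (nbr i i' k) -> entry_bound i i' k l (eps / 600)).
    { intros. apply HN1; trivial. unfold N in *. lia. }
    assert (Hs0 : nbound p (nf s0) (100 * (eps / 600) * m)).
    { apply near_diagonal_bound; trivial; [lra| |].
      - intros [|i] [|j] i'; simpl; congruence.
      - intros [|i] i' E; simpl in E; [discriminate|]. injection E as ->. lia. }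
    assert (Hs1 : nbound p (nf s1) (100 * (eps / 600) * m)).
    { apply near_diagonal_bound; trivial; [lra| |].
      - unfold s1. congruence.
      - intros i i' E. injection E as ->. lia. }
    assert (Hs2 : nbound p (nf s2) (100 * (eps / 600) * m)).
    { apply near_diagonal_bound; trivial; [lra| |].
      - unfold s2. congruence.
      - intros i i' E. injection E as <-. lia. }
    set (fq := fun (q : nat * nat) (kz : option nat * (nat + nat)) =>
      if excluded_middle_informative
        ((N <= Nat.max (fst q) (snd q))%nat /\ (S (fst q) < snd q \/ S (snd q) < fst q)%nat)
      then restr (fun kz => bz (snd kz) = fst q) (Q (snd q)) kz else C0).
    set (fv := (fun kz => (lsum (fun q => Cmod (fq q kz)) (list_prod (seq 0 L2) (seq 0 L)), 0)) : vec (option nat * (nat + nat))).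
    assert (Hfv : nbound p fv (eps / 2 * m)).
    { eapply nbound_weaken; [trivial| |apply (nbound_lsum_dom p Hp (list_prod (seq 0 L2) (seq 0 L)) fq)].
      - eapply Rle_trans; [apply (far_pair_sum N L L2 m Hm)|]. apply Rmult_le_compat_r; trivial.
      - intros kz. unfold fv. rewrite Cmod_real, Rabs_right; [lra|]. apply Rle_ge, lsum_nonneg. intros; apply Cmod_nonneg.
      - intros [i i'] _. unfold fq. simpl fst; simpl snd. destruct excluded_middle_informative as [[H1 H2]|_].
        2:{ apply nbound_zero; trivial. lra. }
        assert (Hc : 0 <= c0 * (1 / 8) ^ Nat.max i i').
        { apply Rmult_le_pos; trivial. apply pow_le. lra. }
        assert (Hpb := pair_block_bound (fun _ => True) i i' (restr (fun i => bz (snd i) = i') x) m _ Hc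
          (nbound_restr p Hp _ _ _ Hx)
          ltac:(intros l z Hz; apply restr_out; exact Hz) ltac:(intros k l _; apply Hfar; trivial; unfold N in *; lia)).
        revert Hpb. apply nbound_le; trivial. intros kz. unfold restr at 1.
        destruct excluded_middle_informative; [|rewrite Cmod_C0; apply Cmod_nonneg].
        rewrite restr_in by auto. unfold Q. lra. }
    replace (eps * m) with ((100 * (eps / 600) * m + 100 * (eps / 600) * m) + (100 * (eps / 600) * m + eps / 2 * m)) by field.
    set (u1 := (fun kz => (Cmod (nf s0 kz) + Cmod (nf s1 kz), 0)) : vec (option nat * (nat + nat))).
    set (u2 := (fun kz => (Cmod (nf s2 kz) + Cmod (fv kz), 0)) : vec (option nat * (nat + nat))).
    assert (Hu1 : forall kz, Cmod (u1 kz) = Cmod (nf s0 kz) + Cmod (nf s1 kz)).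
    { intros. unfold u1. rewrite Cmod_real, Rabs_right; trivial.
      pose proof (Cmod_nonneg (nf s0 kz)). pose proof (Cmod_nonneg (nf s1 kz)). lra. }
    assert (Hu2 : forall kz, Cmod (u2 kz) = Cmod (nf s2 kz) + Cmod (fv kz)).
    { intros. unfold u2. rewrite Cmod_real, Rabs_right; trivial.
      pose proof (Cmod_nonneg (nf s2 kz)). pose proof (Cmod_nonneg (fv kz)). lra. }
    apply (nbound_add_dom p Hp u1 u2).
    2:{ apply (nbound_add_dom p Hp (nf s0) (nf s1)); trivial. intros. rewrite Hu1. lra. }
    2:{ apply (nbound_add_dom p Hp (nf s2) fv); trivial. intros. rewrite Hu2. lra. }
    intros [k z]. rewrite Hu1, Hu2.
    pose proof (Cmod_nonneg (nf s0 (k, z))). pose proof (Cmod_nonneg (nf s1 (k, z))).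
    pose proof (Cmod_nonneg (nf s2 (k, z))). pose proof (Cmod_nonneg (fv (k, z))).
    unfold restr at 1. destruct excluded_middle_informative as [HL2|]; [|rewrite Cmod_C0; lra].
    unfold restr at 1. destruct excluded_middle_informative as [Hout|]; [|rewrite Cmod_C0; lra].
    simpl in HL2.
    eapply Rle_trans; [apply Dop_blocks; trivial|].
    set (i := bz z) in *.
    set (a1 := fun i' => if excluded_middle_informative ((N <= Nat.max i i')%nat /\ (i <= S i')%nat /\ (i' <= S i)%nat)
                         then Cmod (Q i' (k, z)) else 0).
    set (a2 := fun i' => if excluded_middle_informative ((N <= Nat.max i i')%nat /\ (S i < i' \/ S i' < i)%nat)
                         then Cmod (Q i' (k, z)) else 0).
    assert (Ha1 : forall i', 0 <= a1 i').
    { intros. unfold a1. destruct excluded_middle_informative; [apply Cmod_nonneg|lra]. }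
    apply Rle_trans with (lsum (fun i' => a1 i' + a2 i') (seq 0 L)).
    { apply lsum_le. intros i' _. fold (Q i'). unfold a1, a2.
      destruct (Nat.le_gt_cases N (Nat.max i i')) as [HNm|HNm].
      - destruct excluded_middle_informative as [H3|H3], excluded_middle_informative as [H4|H4];
          pose proof (Cmod_nonneg (Q i' (k, z))); try lra. exfalso. lia.
      - (* both blocks are below [N], so [k] lies outside [F] *)
        assert (HkF : ~ In k F).
        { intros Hk. apply Hout. apply in_prod; trivial. apply Hzs. fold i. lia. }
        assert (Hpb := pair_block_bound (fun k => ~ In k F) i i' (restr (fun i => bz (snd i) = i') x) m 0 ltac:(lra)
          (nbound_restr p Hp _ _ _ Hx)
          ltac:(intros l z' Hz; apply restr_out; exact Hz) ltac:(intros k' l Hk'; apply HF; trivial; lia)).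
        apply (nbound_coord p Hp) with (i := (k, z)) in Hpb. rewrite restr_in in Hpb by (split; trivial).
        fold (Q i') in Hpb.
        assert (0 <= a1 i' + a2 i').
        { specialize (Ha1 i'). unfold a2. destruct excluded_middle_informative; pose proof (Cmod_nonneg (Q i' (k, z))); lra. }
        unfold a1, a2 in H3. lra. }
    rewrite lsum_plus.
    change (lsum (fun i' => a1 i') (seq 0 L)) with (lsum a1 (seq 0 L)). change (lsum (fun i' => a2 i') (seq 0 L)) with (lsum a2 (seq 0 L)).
    assert (S1 : lsum a1 (seq 0 L) <= Cmod (nf s0 (k, z)) + Cmod (nf s1 (k, z)) + Cmod (nf s2 (k, z))).
    { apply Rle_trans with (lsum a1 ((match i with O => nil | S j => j :: nil end) ++ i :: S i :: nil)).
      - apply lsum_incl; trivial; [apply seq_NoDup|]. intros i' _ Hne. unfold a1 in Hne.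
        destruct excluded_middle_informative as [(H3 & H4 & H5)|]; [|congruence].
        apply in_app_iff. simpl. destruct i as [|j]; simpl; lia.
      - rewrite lsum_app. simpl. rewrite Rplus_0_r.
        assert (G : forall i', a1 i' <= Cmod (if excluded_middle_informative (N <= Nat.max i i')%nat then Q i' (k, z) else C0)).
        { intros i'. unfold a1. destruct excluded_middle_informative as [(H3 & _)|], excluded_middle_informative;
            try lra; try contradiction; rewrite ?Cmod_C0; try lra. apply Cmod_nonneg. }
        assert (G0 : lsum a1 match i with O => nil | S j => j :: nil end <= Cmod (nf s0 (k, z))).
        { unfold nf, s0. simpl snd. fold i. destruct i as [|j] eqn:Ei; simpl; [apply Cmod_nonneg|].
          rewrite Rplus_0_r. apply G. }
        assert (G1 : a1 i <= Cmod (nf s1 (k, z))) by (unfold nf, s1; simpl snd; fold i; apply G).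
        assert (G2 : a1 (S i) <= Cmod (nf s2 (k, z))) by (unfold nf, s2; simpl snd; fold i; apply G).
        lra. }
    assert (S2 : lsum a2 (seq 0 L) <= Cmod (fv (k, z))).
    { unfold fv. rewrite Cmod_real. eapply Rle_trans; [|apply Rle_abs].
      apply Rle_trans with (lsum (fun q => Cmod (fq q (k, z))) (map (pair i) (seq 0 L))).
      - rewrite lsum_map. apply lsum_le. intros i' _. unfold a2, fq. simpl fst; simpl snd.
        destruct excluded_middle_informative; [|apply Cmod_nonneg]. rewrite restr_in by reflexivity. lra.
      - apply lsum_incl; [intros; apply Cmod_nonneg| |].
        + apply FinFun.Injective_map_NoDup; [congruence|apply seq_NoDup].
        + intros q Hq _. apply in_map_iff in Hq. destruct Hq as (i' & <- & Hi'). apply in_prod; trivial.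
          apply in_seq. lia. }
    lra. }
  (* The output cut-off is removed by exhaustion. The input beyond block [L] is so small that the
     crude bound [C1] of [Dop] leaves at most [eta]. *)
  apply nbound_closed; trivial. intros eta Heta.
  destruct Dop_opbound as [HC0 HC]. set (C1 := B * 5 + 5 * B) in *.
  destruct (nbound_rank_tail p Hp (fun i => bz (snd i)) x m (eta / (C1 + 1)) Hx) as [L HL].
  { apply Rmult_lt_0_compat; [trivial|]. apply Rinv_0_lt_compat. lra. }
  specialize (HL L ltac:(lia)).
  assert (Ex : x = vadd (restr (fun i => bz (snd i) < L)%nat x) (restr (fun i => L <= bz (snd i))%nat x)).
  { extensionality i. unfold vadd, restr. repeat destruct excluded_middle_informative; try lia; apply Ceq; simpl; ring. }
  rewrite Ex, lin_vadd with (p := p); trivial; [|apply Dop_linear|apply in_lp_restr; trivial..].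
  rewrite restr_vadd. apply nbound_vadd; trivial.
  - apply (nbound_exhaust p (fun kz => bz (snd kz))). intros L2. apply Hblk.
  - apply nbound_restr; trivial. eapply nbound_weaken; [trivial| |apply HC, HL].
    apply Rle_trans with ((C1 + 1) * (eta / (C1 + 1))); [|right; field; lra].
    apply Rmult_le_compat_r; [apply HL|lra].
Qed.

End NearFar.
End Error.

(** * The dyadic parameters *)

(* A dyadic approximation of [1 - col / row]; truncated subtraction makes it [0] when [row <= col]. *)
Definition vv (k : nat) : R :=
  INR ((row k - col k) * 2 ^ row k / row k) / 2 ^ row k.

Lemma pow_INR_2 n : 2 ^ n = INR (2 ^ n).
Proof. rewrite pow_INR. reflexivity. Qed.

Lemma vv_dyadic k : dyadic (vv k).
Proof. eexists _, _. reflexivity. Qed.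

Lemma vv_zero k : (row k <= col k)%nat -> vv k = 0.
Proof.
  intros H. unfold vv. replace (row k - col k)%nat with 0%nat by lia. rewrite Nat.mul_0_l.
  replace (0 / row k)%nat with 0%nat; [simpl; unfold Rdiv; ring|]. destruct (row k); [reflexivity|now rewrite Nat.Div0.div_0_l].
Qed.

Lemma vv_one k : col k = 0%nat -> (0 < row k)%nat -> vv k = 1.
Proof.
  intros E H. unfold vv. rewrite E, Nat.sub_0_r, Nat.mul_comm, Nat.div_mul by lia.
  rewrite pow_INR_2. field. apply not_0_INR. apply Nat.pow_nonzero. lia.
Qed.

(** Rounding down to denominator [2 ^ row k] loses at most its inverse, which is at most
    [/ INR (row k)]. *)
Lemma vv_approx k : (0 < row k)%nat -> (col k <= row k)%nat ->
  1 - INR (col k) / INR (row k) - / INR (row k) <= vv k <= 1 - INR (col k) / INR (row k).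
Proof.
  intros Hn Hc. unfold vv. set (n := row k) in *. set (c := col k) in *.
  set (q := ((n - c) * 2 ^ n / n)%nat).
  assert (Hq1 : (n * q <= (n - c) * 2 ^ n)%nat) by (apply Nat.Div0.mul_div_le).
  assert (Hq2 : ((n - c) * 2 ^ n < n * S q)%nat) by (apply Nat.mul_succ_div_gt; lia).
  assert (Hp : (n < 2 ^ n)%nat) by (apply Nat.pow_gt_lin_r; lia).
  apply le_INR in Hq1. apply lt_INR in Hq2, Hp. rewrite !mult_INR, minus_INR in Hq1, Hq2 by trivial.
  rewrite S_INR in Hq2. rewrite pow_INR_2. set (P := INR (2 ^ n)) in *. apply lt_0_INR in Hn.
  assert (HP : 0 < / P) by (apply Rinv_0_lt_compat; lra).
  assert (HN : 0 < / INR n) by (apply Rinv_0_lt_compat; lra).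
  assert (HPn : / P <= / INR n) by (apply Rinv_le_contravar; lra).
  replace (1 - INR c / INR n) with ((INR n - INR c) * P * (/ INR n * / P)) by (field; lra).
  assert (H2 : 0 < / INR n * / P) by (apply Rmult_lt_0_compat; trivial).
  split.
  - apply Rle_trans with ((INR n - INR c) * P * (/ INR n * / P) - / P); [lra|].
    replace (INR q / P) with (INR n * (INR q + 1) * (/ INR n * / P) - / P) by (field; lra).
    apply Rplus_le_compat_r. apply Rmult_le_compat_r; lra.
  - replace (INR q / P) with (INR n * INR q * (/ INR n * / P)) by (field; lra).
    apply Rmult_le_compat_r; lra.
Qed.

Lemma vv_range k : 0 <= vv k <= 1.
Proof.
  split.
  - unfold vv. apply Rmult_le_pos; [apply pos_INR|]. left. apply Rinv_0_lt_compat, pow_lt. lra.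
  - destruct (Nat.le_gt_cases (row k) (col k)) as [H|H]; [rewrite vv_zero by trivial; lra|].
    destruct (vv_approx k) as [_ H1]; [lia|lia|]. eapply Rle_trans; [apply H1|].
    assert (0 <= INR (col k) / INR (row k)); [|lra].
    apply Rmult_le_pos; [apply pos_INR|]. left. apply Rinv_0_lt_compat, lt_0_INR. lia.
Qed.

(** A change of the row by at most 2 and of the column by at most 1 moves the quotient by at most 3
    over the row; the rest of the 5 covers rounding. *)
Lemma vv_close k l s :
  (0 < s)%nat -> (s <= row k)%nat -> (s <= row l)%nat -> (col k <= row k)%nat -> (col l <= row l)%nat ->
  (row k <= row l + 2)%nat -> (row l <= row k + 2)%nat -> (col l = col k \/ col l = S (col k)) ->
  Rabs (vv k - vv l) <= 5 / INR s.
Proof.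
  intros Hs Hk Hl Hck Hcl H1 H2 Hc.
  pose proof (vv_approx k ltac:(lia) Hck) as Ak. pose proof (vv_approx l ltac:(lia) Hcl) as Al.
  set (n := INR (row k)) in *. set (m := INR (row l)) in *.
  assert (Hs' : 0 < INR s) by now apply lt_0_INR.
  assert (Hn : INR s <= n) by now apply le_INR. assert (Hm : INR s <= m) by now apply le_INR.
  assert (In : / n <= / INR s) by (apply Rinv_le_contravar; lra).
  assert (Im : / m <= / INR s) by (apply Rinv_le_contravar; lra).
  assert (Hck' : 0 <= INR (col k) <= n) by (split; [apply pos_INR|now apply le_INR]).
  assert (Hmn : n <= m + 2 /\ m <= n + 2).
  { split; [apply le_INR in H1; rewrite plus_INR in H1|apply le_INR in H2; rewrite plus_INR in H2]; simpl in *; unfold n, m; lra. }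
  assert (Hd : exists d, 0 <= d <= 1 /\ INR (col l) = INR (col k) + d).
  { destruct Hc as [->| ->]; [exists 0|exists 1; rewrite S_INR]; lra. }
  destruct Hd as (d & Hd & Ed). rewrite Ed in Al.
  set (c := INR (col k)) in *.
  assert (Hx : Rabs (c / n - (c + d) / m) <= 3 * / m).
  { replace (c / n - (c + d) / m) with ((c / n * (m - n) - d) * / m) by (field; lra).
    rewrite Rabs_mult, (Rabs_right (/ m)) by (left; apply Rinv_0_lt_compat; lra).
    apply Rmult_le_compat_r; [left; apply Rinv_0_lt_compat; lra|].
    assert (Hcn : 0 <= c / n <= 1).
    { split; [apply Rmult_le_pos; [lra|left; apply Rinv_0_lt_compat; lra]|].
      apply Rmult_le_reg_r with n; [lra|]. unfold Rdiv. rewrite Rmult_assoc, Rinv_l by lra. lra. }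
    apply Rabs_le. nra. }
  apply Rabs_le. assert (Hy : - (3 * / m) <= c / n - (c + d) / m <= 3 * / m).
  { revert Hx. unfold Rabs. destruct Rcase_abs; lra. }
  unfold Rdiv in *. lra.
Qed.

(** * Estimates for the matrix entries *)

(** Past column [sqrt j] the maximum in [place] is the column itself: here the chains have merged
    and the block no longer matters. *)
Lemma wt_big j k : (Nat.sqrt j < col k)%nat -> wt j k = sqrt (hat (row k) (INR (col k))).
Proof.
  intros H. unfold wt, place. rewrite Rmax_right; trivial. pose proof (Nat_sqrt_INR j) as [_ H1].
  apply le_INR in H. rewrite S_INR in H. lra.
Qed.

(** The height is now an integer, and the tent centred at [row k] vanishes at every other
    integer. *)
Lemma wt_big_diag j k : (Nat.sqrt j < col k)%nat -> wt j k <> 0 -> row k = col k.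
Proof.
  intros H Hn. rewrite wt_big in Hn by trivial.
  assert (Hh : 0 < 1 - Rabs (INR (col k) - INR (row k))).
  { apply Rnot_le_lt. intros Hle. apply Hn. unfold hat. rewrite Rmax_left by trivial. apply sqrt_0. }
  assert (Hab : INR (col k) - INR (row k) < 1 /\ - 1 < INR (col k) - INR (row k)) by (apply Rabs_def2; lra).
  assert (H1 : INR (col k) < INR (S (row k))) by (rewrite S_INR; lra).
  assert (H2 : INR (row k) < INR (S (col k))) by (rewrite S_INR; lra).
  apply INR_lt in H1, H2. lia.
Qed.

Lemma gc_big i i' k l :
  (Nat.sqrt i < col k)%nat -> (Nat.sqrt i' < col k)%nat ->
  (gc i (Some k) l = 0 /\ gc i' (Some k) l = 0) \/
  (gc i (Some k) l = gc i' (Some k) l /\ row k = col k /\ row l = col l).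
Proof.
  intros Hi Hi'.
  destruct (classic (col l = col k \/ col l = S (col k))) as [Hc|Hc].
  2:{ left. unfold gc. do 2 (destruct Nat.eq_dec; [tauto|]). split; ring. }
  assert (E : gc i (Some k) l = gc i' (Some k) l).
  { unfold gc. rewrite (wt_big i k), (wt_big i l), (wt_big i' k), (wt_big i' l) by lia. reflexivity. }
  destruct (Req_dec (gc i (Some k) l) 0) as [Z|Z]; [left; split; congruence|right].
  assert (H1 : wt i k <> 0) by (intros E1; apply Z; unfold gc; rewrite E1; ring).
  assert (H2 : wt i l <> 0) by (intros E1; apply Z; unfold gc; rewrite E1; ring).
  split; trivial. split; [apply (wt_big_diag i)|apply (wt_big_diag i)]; trivial; lia.
Qed.

Lemma gc_range i k l : Rabs (gc i k l) <= 1.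
Proof.
  destruct k as [k|]; unfold gc; pose proof (wt_range i l).
  - pose proof (wt_range i k). assert (0 <= wt i k * wt i l <= 1) by nra.
    do 2 destruct Nat.eq_dec; apply Rabs_le; lra.
  - destruct Nat.eq_dec; apply Rabs_le; lra.
Qed.

Lemma gc_slow i i' k l : Rabs (gc i' k l - gc i k l) <= 2 * sqrt (Rabs (sqrt (INR i') - sqrt (INR i))).
Proof.
  pose proof (wt_slow i' i l) as Hl. pose proof (wt_range i l). pose proof (wt_range i' l).
  set (s := sqrt _) in *. assert (Hs : 0 <= s) by apply sqrt_pos.
  destruct k as [k|]; unfold gc.
  - pose proof (wt_slow i' i k) as Hk. fold s in Hk. pose proof (wt_range i k). pose proof (wt_range i' k).
    assert (Hm : Rabs (wt i' k * wt i' l - wt i k * wt i l) <= 2 * s).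
    { replace (wt i' k * wt i' l - wt i k * wt i l) with
        (wt i' k * (wt i' l - wt i l) + (wt i' k - wt i k) * wt i l) by ring.
      eapply Rle_trans; [apply Rabs_triang|]. rewrite !Rabs_mult, (Rabs_right (wt i' k)), (Rabs_right (wt i l)) by lra.
      pose proof (Rabs_pos (wt i' l - wt i l)). pose proof (Rabs_pos (wt i' k - wt i k)). nra. }
    set (b := (if Nat.eq_dec (col l) (S (col k)) then 1 else 0) - (if Nat.eq_dec (col l) (col k) then 1 else 0)).
    replace (_ * _ * _ - _ * _ * _) with ((wt i' k * wt i' l - wt i k * wt i l) * b) by (unfold b; ring).
    rewrite Rabs_mult. assert (Hb : Rabs b <= 1) by (unfold b; do 2 destruct Nat.eq_dec; apply Rabs_le; lra).
    pose proof (Rabs_pos b). pose proof (Rabs_pos (wt i' k * wt i' l - wt i k * wt i l)). nra.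
  - destruct Nat.eq_dec; [lra|]. rewrite Rminus_0_r, Rabs_R0. lra.
Qed.

(** A step of the square root is 1 over the sum of two roots; it is pushed below [eta ^ 2] to make
    up for the outer square root. *)
Lemma sqrt_step_small eta : 0 < eta -> exists N, forall i i', (N <= Nat.max i i')%nat -> (i <= S i')%nat -> (i' <= S i)%nat ->
  sqrt (Rabs (sqrt (INR i') - sqrt (INR i))) <= eta.
Proof.
  intros He. set (t := / eta ^ 2).
  assert (Ht : 0 < t) by (apply Rinv_0_lt_compat; nra).
  destruct (INR_unbounded (t * t)) as [N HN]. exists N.
  assert (G : forall i, (N <= S i)%nat -> sqrt (INR (S i)) - sqrt (INR i) <= eta ^ 2).
  { intros i Hi. apply le_INR in Hi.
    assert (H1 : t <= sqrt (INR (S i))).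
    { rewrite <- (sqrt_square t) by lra. apply sqrt_le_1_alt. lra. }
    pose proof (sqrt_sqrt (INR (S i)) (pos_INR _)) as S1. pose proof (sqrt_sqrt (INR i) (pos_INR _)) as S2.
    pose proof (sqrt_pos (INR i)) as P2. rewrite S_INR in S1 at 3.
    set (a := sqrt (INR (S i))) in *. set (b := sqrt (INR i)) in *.
    assert (Hab : (a - b) * (a + b) = 1) by nra.
    assert (Hab' : 0 <= a - b) by nra.
    assert (H2 : (a - b) * t <= 1) by nra.
    apply Rmult_le_reg_r with t; trivial. replace (eta ^ 2 * t) with 1 by (unfold t; field; lra). trivial. }
  intros i i' HNi H1 H2. rewrite <- (sqrt_square eta) by lra. apply sqrt_le_1_alt.
  assert (Hpos : 0 <= eta ^ 2) by nra.
  assert (Hcase : i = i' \/ i' = S i \/ i = S i') by lia.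
  destruct Hcase as [<-|[->| ->]].
  - rewrite Rminus_diag, Rabs_R0. nra.
  - assert (sqrt (INR i) <= sqrt (INR (S i))) by (apply sqrt_le_1_alt, le_INR; lia).
    rewrite Rabs_right by lra. specialize (G i ltac:(lia)). lra.
  - assert (sqrt (INR i') <= sqrt (INR (S i'))) by (apply sqrt_le_1_alt, le_INR; lia).
    rewrite Rabs_minus_sym, Rabs_right by lra. specialize (G i' ltac:(lia)). lra.
Qed.

Lemma nbr_some_cases i i' k l :
  In l (nbr i i' (Some k)) -> exists j, (j = i \/ j = i') /\
    (row k = mu j (col k) \/ row k = S (mu j (col k))) /\
    ((col l = col k /\ (row l = mu j (col k) \/ row l = S (mu j (col k)))) \/
     (col l = S (col k) /\ (row l = mu j (S (col k)) \/ row l = S (mu j (S (col k)))))).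
Proof.
  unfold nbr. rewrite nodup_In, in_app_iff. unfold near_nodes.
  assert (G : forall j, In l (if excluded_middle_informative (In k (pair_at j (col k)))
              then pair_at j (col k) ++ pair_at j (S (col k)) else nil) ->
    (row k = mu j (col k) \/ row k = S (mu j (col k))) /\
    ((col l = col k /\ (row l = mu j (col k) \/ row l = S (mu j (col k)))) \/
     (col l = S (col k) /\ (row l = mu j (S (col k)) \/ row l = S (mu j (S (col k))))))).
  { intros j H. destruct excluded_middle_informative as [Hk|]; [|destruct H].
    apply in_pair_at in Hk. apply in_app_iff in H. rewrite !in_pair_at in H. tauto. }
  intros [H|H]; [exists i|exists i']; auto.
Qed.

Lemma nbr_none_cases i i' l :
  In l (nbr i i' None) -> exists j, (j = i \/ j = i') /\ col l = 0%nat /\ (row l = Nat.sqrt j \/ row l = S (Nat.sqrt j)).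
Proof.
  unfold nbr. rewrite nodup_In, in_app_iff. unfold near_nodes. rewrite !in_pair_at. unfold mu. rewrite !Nat.max_0_r.
  intros [H|H]; [exists i|exists i']; tauto.
Qed.

Section Entries.
Context (p : R) (Hp : 1 < p) (E blk : nat -> nat).
Context (HE : forall i, (E i < E (S i))%nat) (Hblk : forall e, (E (blk e) <= e < E (S (blk e)))%nat).
Context (Rop : option nat -> op (nat + nat) (nat + nat)) (B : R).
Context (HRl : forall k, linear_op p (Rop k)) (HRb : forall k, opbound p (Rop k) B).

Definition ev (z : nat + nat) : nat := match z with inl e => e | inr e => e end.
Definition val (k : option nat) : R := match k with None => 1 | Some k => vv k end.

(* The finitely many operators that are taken care of from block [i] on. *)
Definition stage (i : nat) (k : option nat) : Prop :=
  match k with None => True | Some k => (row k <= i + 6)%nat /\ (col k <= row k)%nat end.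

Context (N0 : nat).
(** Node operators are block tridiagonal up to a geometric error ([Htri]), intertwined by the
    projection onto the psi-components up to [eps] at close parameters ([Hclose]), and exactly so at
    parameter 0 ([Hdiag]). *)
Context (Htri : forall i k u m, (N0 <= S i)%nat -> stage (S i) k -> nbound p u m ->
  nbound p (restr (fun z => E (S i) <= ev z)%nat (Rop k (restr (fun z => ev z < E i)%nat u))) ((1 / 8) ^ S i * m) /\
  nbound p (restr (fun z => ev z < E i)%nat (Rop k (restr (fun z => E (S i) <= ev z)%nat u))) ((1 / 8) ^ S i * m)).
Context (Hclose : forall eps, 0 < eps -> exists delta N, 0 < delta /\ forall i k l, (N <= i)%nat ->
  stage i k -> stage i (Some l) -> Rabs (val k - vv l) < delta -> forall u m, nbound p u m ->
  nbound p (restr (fun z => E i <= ev z)%nat (vsub (Rop k (restr isl u)) (restr isl (Rop (Some l) u)))) (eps * m)).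
Context (Hdiag : forall k l u, vv k = 0 -> vv l = 0 -> in_lp p u ->
  Rop (Some k) (restr isl u) = restr isl (Rop (Some l) u)).

Lemma E_mono i j : (i <= j)%nat -> (E i <= E j)%nat.
Proof. intros H. induction H; [lia|]. specialize (HE m). lia. Qed.

Lemma bz_ev z : (E (bz blk z) <= ev z < E (S (bz blk z)))%nat.
Proof. destruct z; apply Hblk. Qed.

Lemma bz_finite N : exists l : list (nat + nat), forall z, (bz blk z < N)%nat -> In z l.
Proof.
  exists (map inl (seq 0 (E N)) ++ map inr (seq 0 (E N))). intros z Hz.
  pose proof (bz_ev z). pose proof (E_mono (S (bz blk z)) N ltac:(lia)).
  apply in_app_iff. destruct z as [e|e]; simpl in *; [left|right]; apply in_map, in_seq; lia.
Qed.

Lemma entry_zero i i' k l :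
  (Nat.sqrt i < col k)%nat -> (Nat.sqrt i' < col k)%nat -> entry_bound p blk Rop i i' (Some k) l 0.
Proof.
  intros Hi Hi' u m Hu _. apply nbound_zero; [destruct Hu; lra|]. intros z.
  unfold restr at 1. destruct excluded_middle_informative as [_|_]; trivial.
  destruct (gc_big i i' k l Hi Hi') as [[-> ->]|(-> & Hk & Hl)].
  - unfold vsub, vscale. apply Ceq; simpl; ring.
  - rewrite (Hdiag k l); [|apply vv_zero; lia|apply vv_zero; lia|eapply nbound_in_lp; eauto].
    unfold vsub, vscale. apply Ceq; simpl; ring.
Qed.

(** Columns past the merging point contribute 0; the other nodes with nonempty neighbour lists lie
    in a finite square. *)
Lemma entry_zero_outside N : exists F : list (option nat), forall k, ~ In k F -> forall i i' l,
  (Nat.max i i' < N)%nat -> In l (nbr i i' k) -> entry_bound p blk Rop i i' k l 0.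
Proof.
  exists (None :: map (fun q => Some (nd (fst q) (snd q))) (list_prod (seq 0 (N + 3)) (seq 0 (N + 3)))).
  intros [k|] Hk i i' l HN Hl; [|exfalso; apply Hk; simpl; auto].
  pose proof (Nat.sqrt_le_lin i). pose proof (Nat.sqrt_le_lin i').
  destruct (Nat.le_gt_cases (col k) (Nat.max (Nat.sqrt i) (Nat.sqrt i'))) as [Hc|Hc].
  - exfalso. apply Hk. right. apply in_map_iff. exists (row k, col k). simpl. rewrite nd_row_col. split; trivial.
    destruct (nbr_some_cases i i' k l Hl) as (j & Hj & Hr & _). unfold mu in Hr.
    apply in_prod; apply in_seq; [destruct Hj; subst; lia|lia].
  - apply entry_zero; lia.
Qed.

(** No cancellation is involved: each of the two terms is small by itself, hence the factor 2. *)
Lemma entry_far i i' k l :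
  (N0 <= Nat.max i i')%nat -> (S i < i' \/ S i' < i)%nat -> In l (nbr i i' k) ->
  entry_bound p blk Rop i i' k l (2 * (1 / 8) ^ Nat.max i i').
Proof.
  intros HN Hf Hl. set (M := Nat.max i i') in *.
  pose proof (Nat.sqrt_le_lin i). pose proof (Nat.sqrt_le_lin i').
  (* Either the column is past the merging point of both blocks, or the rows involved are at most
     [M + 2] and so within stage [M]. *)
  assert (Hc : (exists k', k = Some k' /\ (Nat.sqrt i < col k')%nat /\ (Nat.sqrt i' < col k')%nat) \/ (stage M k /\ stage M (Some l))).
  { destruct k as [k|].
    - destruct (Nat.le_gt_cases (col k) (Nat.max (Nat.sqrt i) (Nat.sqrt i'))) as [Hc|Hc].
      + right. destruct (nbr_some_cases i i' k l Hl) as (j & Hj & Hr & Hr'). unfold mu in *.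
        assert (Nat.sqrt j <= M)%nat by (unfold M; destruct Hj; subst; lia). simpl. unfold M in *. lia.
      + left. exists k. split; trivial. lia.
    - right. destruct (nbr_none_cases i i' l Hl) as (j & Hj & E0 & Hr). simpl. split; trivial. unfold M. destruct Hj; subst; lia. }
  destruct Hc as [(k' & -> & H1 & H2)|[S1 S2]].
  { intros u m Hu Hs. eapply nbound_weaken; [trivial| |exact (entry_zero i i' k' l H1 H2 u m Hu Hs)].
    rewrite Rmult_0_l. assert (0 < (1 / 8) ^ M) by (apply pow_lt; lra). destruct Hu. nra. }
  intros u m Hu Hs.
  assert (Hone : forall k, stage M k -> forall u, nbound p u m -> (forall z, bz blk z <> i' -> u z = C0) ->
     nbound p (restr (fun z => bz blk z = i) (Rop k u)) ((1 / 8) ^ M * m)).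
  { clear u Hu Hs k l S1 S2 Hl. intros k Hk u Hu Hs. destruct M as [|M'] eqn:EM; [lia|].
    destruct (Htri M' k u m ltac:(lia) Hk Hu) as [T1 T2].
    (* The larger block is [S M']; as the blocks differ by at least 2, the smaller one lies entirely
       below [E M']. *)
    destruct Hf as [Hf|Hf].
    - assert (EM' : i' = S M') by lia.
      replace (restr (fun z => E (S M') <= ev z)%nat u) with u in T2.
      2:{ extensionality z. unfold restr. destruct excluded_middle_informative as [_|Hz]; trivial.
          apply Hs. intros Ez. apply Hz. pose proof (bz_ev z). rewrite Ez, EM' in H1. lia. }
      revert T2. apply nbound_le; trivial. intros z. unfold restr.
      destruct excluded_middle_informative as [Ez|]; [|rewrite Cmod_C0; apply Cmod_nonneg].
      destruct excluded_middle_informative as [_|Hz]; [lra|]. exfalso. apply Hz.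
      pose proof (bz_ev z) as Hb. rewrite Ez in Hb. pose proof (E_mono (S i) M' ltac:(lia)). lia.
    - assert (EM' : i = S M') by lia.
      replace (restr (fun z => ev z < E M')%nat u) with u in T1.
      2:{ extensionality z. unfold restr. destruct excluded_middle_informative as [_|Hz]; trivial.
          apply Hs. intros Ez. apply Hz. pose proof (bz_ev z). rewrite Ez in H1. pose proof (E_mono (S i') M' ltac:(lia)). lia. }
      revert T1. apply nbound_le; trivial. intros z. unfold restr.
      destruct excluded_middle_informative as [Ez|]; [|rewrite Cmod_C0; apply Cmod_nonneg].
      destruct excluded_middle_informative as [_|Hz]; [lra|]. exfalso. apply Hz.
      pose proof (bz_ev z) as Hb. rewrite Ez, EM' in Hb. lia. }
  assert (Hsc : forall g (x : vec (nat + nat)) c, Rabs g <= 1 -> nbound p x c -> nbound p (vscale (g, 0) x) c).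
  { intros g x c Hg Hx. eapply nbound_weaken; [trivial| |apply nbound_vscale; [trivial|apply Hx]].
    rewrite Cmod_real. destruct Hx. pose proof (Rabs_pos g). nra. }
  rewrite restr_vsub, !restr_vscale.
  replace (2 * (1 / 8) ^ M * m) with ((1 / 8) ^ M * m + (1 / 8) ^ M * m) by ring.
  apply nbound_vsub; trivial; apply Hsc; try apply gc_range.
  - apply Hone; trivial; [now apply nbound_restr|]. intros z Hz. unfold restr. destruct excluded_middle_informative; auto.
  - assert (Hu2 := Hone _ S2 u Hu Hs). revert Hu2. apply nbound_le; trivial. intros z. unfold restr.
    repeat destruct excluded_middle_informative; rewrite ?Cmod_C0; try lra. apply Cmod_nonneg.
Qed.

(** The entry is the change of coefficient times [Rop k], small by slow variation of the weights,
    plus a coefficient times the failure of intertwining, small because neighbouring parameters are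
    close. *)
Lemma entry_near eps : 0 < eps -> exists N, forall i i' k l,
  (N <= Nat.max i i')%nat -> (i <= S i')%nat -> (i' <= S i)%nat -> In l (nbr i i' k) -> entry_bound p blk Rop i i' k l eps.
Proof.
  intros He. assert (HB : 0 <= B) by apply (HRb None).
  destruct (Hclose (eps / 2) ltac:(lra)) as (delta & N1 & Hd & HN1).
  destruct (sqrt_step_small (eps / (4 * (B + 1)))) as [N2 HN2].
  { apply Rmult_lt_0_compat; [trivial|]. apply Rinv_0_lt_compat. lra. }
  (* [s] will bound the rows in use from below, so that neighbouring parameters differ by at most
     [5 / s < delta]. *)
  destruct (INR_unbounded (5 / delta)) as [s Hs].
  assert (H5 : 0 < 5 / delta) by (apply Rmult_lt_0_compat; [lra|now apply Rinv_0_lt_compat]).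
  assert (Hs0 : (0 < s)%nat) by (apply INR_lt; simpl; lra).
  assert (Hs' : 5 / INR s < delta).
  { apply Rmult_lt_reg_r with (INR s); [lra|]. unfold Rdiv. rewrite Rmult_assoc, Rinv_l by lra.
    apply Rmult_lt_reg_r with (/ delta); [now apply Rinv_0_lt_compat|].
    replace (delta * INR s * / delta) with (INR s) by (field; lra). unfold Rdiv in Hs. lra. }
  (* The successor allows for [i] or [i'] being one less than the maximum. *)
  exists (S (Nat.max N1 (Nat.max N2 (s * s)))). intros i i' k l HN Hi Hi' Hl u m Hu Hsu.
  assert (Hm : 0 <= m) by apply Hu.
  assert (Hsi : forall j, j = i \/ j = i' -> (s <= Nat.sqrt j)%nat).
  { intros j Hj. apply Nat.sqrt_le_square. destruct Hj; subst; lia. }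
  pose proof (Nat.sqrt_le_lin i). pose proof (Nat.sqrt_le_lin i').
  assert (Hc : (exists k', k = Some k' /\ (Nat.sqrt i < col k')%nat /\ (Nat.sqrt i' < col k')%nat) \/
     (stage i k /\ stage i (Some l) /\ Rabs (val k - vv l) < delta)).
  { destruct k as [k|].
    - destruct (Nat.le_gt_cases (col k) (Nat.max (Nat.sqrt i) (Nat.sqrt i'))) as [Hc|Hc].
      + right. destruct (nbr_some_cases i i' k l Hl) as (j & Hj & Hr & Hr'). specialize (Hsi j Hj). unfold mu in *.
        assert (Nat.sqrt j <= S i)%nat by (destruct Hj; subst; lia). simpl.
        split; [lia|]. split; [lia|]. eapply Rle_lt_trans; [|apply Hs']. apply vv_close; lia.
      + left. exists k. split; trivial. lia.
    - right. destruct (nbr_none_cases i i' l Hl) as (j & Hj & E0 & Hr). specialize (Hsi j Hj).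
      assert (Nat.sqrt j <= S i)%nat by (destruct Hj; subst; lia). simpl.
      rewrite vv_one by lia. rewrite Rminus_diag, Rabs_R0. split; trivial. split; [lia|trivial]. }
  destruct Hc as [(k' & -> & H1 & H2)|(S1 & S2 & Hdl)].
  { eapply nbound_weaken; [trivial| |exact (entry_zero i i' k' l H1 H2 u m Hu Hsu)]. nra. }
  specialize (HN1 i k l ltac:(lia) S1 S2 Hdl u m Hu).
  specialize (HN2 i i' ltac:(lia) Hi Hi').
  pose proof (gc_slow i i' k l) as Hg. pose proof (gc_range i k l) as Hg1.
  set (g := gc i k l) in *. set (g' := gc i' k l) in *.
  replace (vsub (vscale (g', 0) (Rop k (restr isl u))) (vscale (g, 0) (restr isl (Rop (Some l) u)))) with
    (vadd (vscale (g' - g, 0) (Rop k (restr isl u)))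
          (vscale (g, 0) (vsub (Rop k (restr isl u)) (restr isl (Rop (Some l) u))))).
  2:{ extensionality z. unfold vadd, vsub, vscale. apply Ceq; simpl; ring. }
  rewrite restr_vadd. replace (eps * m) with (eps / 2 * m + eps / 2 * m) by field.
  apply nbound_vadd; trivial.
  - apply nbound_restr; trivial. eapply nbound_weaken; [trivial| |apply nbound_vscale; [trivial|apply (HRb k), (nbound_restr p Hp isl _ _ Hu)]].
    rewrite Cmod_real, <- Rmult_assoc. apply Rmult_le_compat_r; trivial.
    apply Rle_trans with (2 * (eps / (4 * (B + 1))) * (B + 1)); [|right; field; lra].
    pose proof (Rabs_pos (g' - g)). apply Rmult_le_compat; lra.
  - rewrite restr_vscale. eapply nbound_weaken; [trivial| |apply (nbound_vscale p Hp _ _ (eps / 2 * m))].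
    2:{ revert HN1. apply nbound_le; trivial. intros z. unfold restr at 1.
        destruct excluded_middle_informative as [Ez|]; [|rewrite Cmod_C0; apply Cmod_nonneg].
        rewrite restr_in; [lra|]. pose proof (bz_ev z) as Hb. rewrite Ez in Hb. lia. }
    rewrite Cmod_real. pose proof (Rabs_pos g). assert (0 <= eps / 2 * m) by nra. nra.
Qed.

Lemma error_small_tails : small_tails p (Dop blk Rop).
Proof.
  apply (Dop_small_tails p Hp blk Rop B HRl HRb entry_near N0 2 ltac:(lra) entry_far entry_zero_outside bz_finite).
Qed.

End Entries.

(** * Properties that hold from some index on *)

Definition evt (P : nat -> Prop) : Prop := exists N, forall n, (N <= n)%nat -> P n.

Lemma evt_and P Q : evt P -> evt Q -> evt (fun n => P n /\ Q n).
Proof.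
  intros [N HN] [M HM]. exists (Nat.max N M). intros n Hn. split; [apply HN|apply HM]; lia.
Qed.

Lemma evt_imp (A : Prop) P : (A -> evt P) -> evt (fun n => A -> P n).
Proof.
  intros H. destruct (classic A) as [HA|HA].
  - destruct (H HA) as [N HN]. exists N. auto.
  - exists 0%nat. tauto.
Qed.

Lemma evt_list {A} (l : list A) (P : A -> nat -> Prop) :
  (forall a, In a l -> evt (P a)) -> evt (fun n => forall a, In a l -> P a n).
Proof.
  induction l as [|a l IH]; intros H; [exists 0%nat; intros n _ a []|].
  destruct (H a ltac:(simpl; auto)) as [N HN]. destruct (IH ltac:(simpl in H; auto)) as [M HM].
  exists (Nat.max N M). intros n Hn b [<-|Hb]; [apply HN|apply HM]; trivial; lia.
Qed.

Lemma code_list {A} (f : A -> nat) (Hf : forall a b, f a = f b -> a = b) c :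
  exists l, forall a, (f a <= c)%nat -> In a l.
Proof.
  assert (G : forall c, exists l, forall a, (f a < c)%nat -> In a l).
  { clear c. induction c as [|c [l Hl]]; [exists nil; lia|].
    destruct (classic (exists a, f a = c)) as [[a Ha]|Hn].
    - exists (a :: l). intros b Hb. destruct (Nat.eq_dec (f b) c) as [E|N].
      + left. apply Hf. congruence.
      + right. apply Hl. lia.
    - exists l. intros b Hb. apply Hl. assert (f b <> c) by eauto. lia. }
  destruct (G (S c)) as [l Hl]. exists l. intros a Ha. apply Hl. lia.
Qed.

Lemma stage_list i : exists l, forall k, stage i k -> In k l.
Proof.
  exists (None :: map (fun q => Some (nd (fst q) (snd q))) (list_prod (seq 0 (i + 7)) (seq 0 (i + 7)))).
  intros [k|] H; [right|left; trivial]. simpl in H. apply in_map_iff. exists (row k, col k). simpl.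
  rewrite nd_row_col. split; trivial. apply in_prod; apply in_seq; lia.
Qed.

Lemma blk_exists (E : nat -> nat) : E 0%nat = 0%nat -> (forall i, (E i < E (S i))%nat) ->
  exists blk, forall e, (E (blk e) <= e < E (S (blk e)))%nat.
Proof.
  intros H0 HE.
  assert (G : forall e n, (e < E n)%nat -> exists i, (E i <= e < E (S i))%nat).
  { intros e n. induction n as [|n IH]; intros Hn; [lia|].
    destruct (Nat.le_gt_cases (E n) e) as [H|H]; [exists n; lia|auto]. }
  assert (Hge : forall n, (n <= E n)%nat) by (induction n; [lia|specialize (HE n); lia]).
  assert (H : forall e, exists i, (E i <= e < E (S i))%nat).
  { intros e. apply (G e (S e)). specialize (Hge (S e)). lia. }
  exists (fun e => proj1_sig (constructive_indefinite_description _ (H e))).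
  intros e. exact (proj2_sig (constructive_indefinite_description _ (H e))).
Qed.

Definition idx_below (m : nat) : list (nat + nat) := map inl (seq 0 m) ++ map inr (seq 0 m).

Lemma in_idx_below m z : In z (idx_below m) <-> (ev z < m)%nat.
Proof.
  unfold idx_below. rewrite in_app_iff, !in_map_iff. split.
  - intros [(e & <- & H)|(e & <- & H)]; apply in_seq in H; simpl; lia.
  - intros H. destruct z as [e|e]; simpl in H; [left|right]; exists e; (split; [trivial|apply in_seq; lia]).
Qed.

Lemma tri_evt p (Hp : 1 < p) (T : op (nat + nat) (nat + nat)) c m eps :
  linear_op p T -> opbound p T c -> 0 < eps ->
  evt (fun n => forall u b, nbound p u b ->
    nbound p (restr (fun z => n <= ev z)%nat (T (restr (fun z => ev z < m)%nat u))) (eps * b) /\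
    nbound p (restr (fun z => ev z < m)%nat (T (restr (fun z => n <= ev z)%nat u))) (eps * b)).
Proof.
  intros HL HT He.
  destruct (cols_rank_tail p Hp T ev (idx_below m) c eps HL HT He) as [N1 H1].
  destruct (rows_rank_tail p Hp T ev (idx_below m) c eps HL HT He) as [N2 H2].
  exists (Nat.max N1 N2). intros n Hn u b Hu.
  specialize (H1 n ltac:(lia) u b Hu). specialize (H2 n ltac:(lia) u b Hu).
  rewrite (restr_ext (fun z => In z (idx_below m)) (fun z => ev z < m)%nat) in H1, H2 by apply in_idx_below.
  split; trivial.
Qed.

(** * Closeness modulo tails *)

(** A concrete substitute for distance in the Calkin algebra: the difference is small on all outputs
    beyond some rank. *)
Definition tail_close (p : R) (S T : op nat nat) (eps : R) : Prop :=
  evt (fun n => forall u m, nbound p u m -> nbound p (restr (fun e => n <= e)%nat (vsub (S u) (T u))) (eps * m)).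

Section Closeness.
Context (p : R) (Hp : 1 < p).

Lemma tail_close_sym S T eps : tail_close p S T eps -> tail_close p T S eps.
Proof.
  intros [N H]. exists N. intros n Hn u m Hu. generalize (H n Hn u m Hu). apply nbound_le; trivial.
  intros e. unfold restr. destruct excluded_middle_informative; [|lra].
  unfold vsub. rewrite <- Cmod_opp. right. f_equal. apply Ceq; simpl; ring.
Qed.

Lemma tail_close_trans S T U a b : tail_close p S T a -> tail_close p T U b -> tail_close p S U (a + b).
Proof.
  intros [N1 H1] [N2 H2]. exists (Nat.max N1 N2). intros n Hn u m Hu.
  replace (vsub (S u) (U u)) with (vadd (vsub (S u) (T u)) (vsub (T u) (U u))).
  - rewrite restr_vadd, Rmult_plus_distr_r. apply nbound_vadd; trivial; [apply H1|apply H2]; trivial; lia.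
  - extensionality e. unfold vadd, vsub. apply Ceq; simpl; ring.
Qed.

(** One [eps] for the norm of [S - T - K], the other for the tail of the compact operator [K]. *)
Lemma tail_close_calkin S T eps :
  is_bounded_op p S -> is_bounded_op p T -> 0 < eps -> calkin_norm p (opsub S T) < eps -> tail_close p S T (eps + eps).
Proof.
  intros HS HT He H.
  assert (HB : is_bounded_op p (opsub S T)).
  { apply bounded_op_iff in HS, HT; trivial. apply bounded_op_iff; trivial.
    destruct HS as (L1 & c1 & B1), HT as (L2 & c2 & B2). split; [now apply linear_opsub|].
    eexists. apply opbound_opsub; eauto. }
  destruct (calkin_norm_lt p Hp _ eps HB H) as (K & HK & HAK).
  destruct (compact_rank_tail p Hp K (fun e => e) eps HK He) as [N HN].
  exists N. intros n Hn u m Hu.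
  replace (vsub (S u) (T u)) with (vadd (opsub (opsub S T) K u) (K u)).
  - rewrite restr_vadd, Rmult_plus_distr_r. apply nbound_vadd; trivial; [|now apply HN].
    apply nbound_restr; trivial. now apply HAK.
  - extensionality e. unfold opsub, vadd, vsub. apply Ceq; simpl; ring.
Qed.

(** Heine-Cantor by sequences: counterexamples at distance below [/ INR (S n)] accumulate at a
    common point [l], and continuity there refutes them. *)
Lemma tail_close_uniform (F : R -> op nat nat) eps :
  (forall t, 0 <= t <= 1 -> is_bounded_op p (F t)) -> calkin_continuous p F -> 0 < eps ->
  exists delta, 0 < delta /\ forall s t, 0 <= s <= 1 -> 0 <= t <= 1 -> Rabs (s - t) < delta -> tail_close p (F s) (F t) eps.
Proof.
  intros HF HC He. apply NNPP. intros Hn.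
  assert (Hst : forall n, exists st : R * R, (0 <= fst st <= 1) /\ (0 <= snd st <= 1) /\
     Rabs (fst st - snd st) < / INR (S n) /\ ~ tail_close p (F (fst st)) (F (snd st)) eps).
  { intros n. apply NNPP. intros H. apply Hn. exists (/ INR (S n)). split.
    - apply Rinv_0_lt_compat, lt_0_INR. lia.
    - intros s t Hs Ht Hd. apply NNPP. intros Hc. apply H. exists (s, t). auto. }
  set (st := fun n => proj1_sig (constructive_indefinite_description _ (Hst n))).
  assert (Hst' : forall n, (0 <= fst (st n) <= 1) /\ (0 <= snd (st n) <= 1) /\
     Rabs (fst (st n) - snd (st n)) < / INR (S n) /\ ~ tail_close p (F (fst (st n))) (F (snd (st n))) eps).
  { intros n. exact (proj2_sig (constructive_indefinite_description _ (Hst n))). }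
  destruct (bounded_subsequence (fun n => fst (st n)) 1) as (phi & l & Hphi & Hl).
  { intros n. apply Rabs_le. destruct (Hst' n). lra. }
  assert (Hl01 : 0 <= l <= 1).
  { split; apply Rnot_lt_le; intros Hlt.
    - destruct (Hl (- l) ltac:(lra)) as [N HN]. specialize (HN N ltac:(lia)). unfold Rdist in HN.
      apply Rabs_def2 in HN. destruct (Hst' (phi N)). lra.
    - destruct (Hl (l - 1) ltac:(lra)) as [N HN]. specialize (HN N ltac:(lia)). unfold Rdist in HN.
      apply Rabs_def2 in HN. destruct (Hst' (phi N)). lra. }
  destruct (HC l Hl01 (eps / 4) ltac:(lra)) as (d & Hd & HdC).
  destruct (Hl (d / 2) ltac:(lra)) as [N1 HN1].
  destruct (archimed_cor1 (d / 2) ltac:(lra)) as (N2 & HN2 & HN20).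
  set (n := Nat.max N1 N2). specialize (HN1 n ltac:(unfold n; lia)). unfold Rdist in HN1.
  destruct (Hst' (phi n)) as (Hs & Ht & Hstd & Hc). apply Hc.
  assert (Hsm : / INR (S (phi n)) < d / 2).
  { eapply Rle_lt_trans; [|apply HN2]. apply Rinv_le_contravar; [now apply lt_0_INR|].
    apply le_INR. pose proof (subseq_ge phi Hphi n). unfold n in *. lia. }
  assert (H1 : Rabs (fst (st (phi n)) - l) < d) by lra.
  assert (H2 : Rabs (snd (st (phi n)) - l) < d).
  { replace (snd (st (phi n)) - l) with ((fst (st (phi n)) - l) - (fst (st (phi n)) - snd (st (phi n)))) by ring.
    eapply Rle_lt_trans; [apply Rabs_triang|]. rewrite Rabs_Ropp. lra. }
  (* Passing through [F l] doubles the error, and so does each passage from Calkin norms to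
     tails. *)
  replace eps with ((eps / 4 + eps / 4) + (eps / 4 + eps / 4)) by field.
  apply tail_close_trans with (F l).
  - apply tail_close_calkin; auto; lra.
  - apply tail_close_sym. apply tail_close_calkin; auto; lra.
Qed.

(** Compares [A] after the projection onto the psi-components with that projection after [T], so
    that the unrelated phi-parts of the two operators do not interfere. *)
Definition block_close (A T : op (nat + nat) (nat + nat)) (eps : R) (n : nat) : Prop :=
  forall u m, nbound p u m ->
    nbound p (restr (fun z => n <= ev z)%nat (vsub (A (restr isl u)) (restr isl (T u)))) (eps * m).

Definition rank_tails (K : op (nat + nat) (nat + nat)) : Prop :=
  forall eps, 0 < eps -> evt (fun n => forall u m, nbound p u m -> nbound p (restr (fun z => n <= ev z)%nat (K u)) (eps * m)).

(** The block diagonal parts contribute [S - S'] only: the phi-component is projected away before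
    [A] and after [T]. The two corrections share [eta]. *)
Lemma block_close_of_tail_close (A T K K' : op (nat + nat) (nat + nat)) (S S' P P' : op nat nat) eps eta :
  linear_op p P ->
  (forall u, in_lp p u -> A u = vadd (dsum2 S P u) (K u)) ->
  (forall u, in_lp p u -> T u = vadd (dsum2 S' P' u) (K' u)) ->
  rank_tails K -> rank_tails K' -> tail_close p S S' eps -> 0 < eta ->
  evt (block_close A T (eps + eta)).
Proof.
  intros HP HA HT HK HK' [N1 H1] He.
  destruct (HK (eta / 2) ltac:(lra)) as [N2 H2]. destruct (HK' (eta / 2) ltac:(lra)) as [N3 H3].
  exists (Nat.max N1 (Nat.max N2 N3)). intros n Hn u m Hu.
  assert (Hul : in_lp p u) by (eapply nbound_in_lp; eauto).
  assert (Hui : nbound p (fun e => u (inl e)) m) by (apply (nbound_inj p Hp inl); [congruence|trivial]).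
  specialize (H1 n ltac:(lia) _ m Hui). specialize (H2 n ltac:(lia) _ m (nbound_restr p Hp isl u m Hu)).
  specialize (H3 n ltac:(lia) u m Hu).
  set (mid := (fun z => match z with inl e => vsub (S (fun e => u (inl e))) (S' (fun e => u (inl e))) e | inr _ => C0 end) : vec (nat + nat)).
  assert (E : vsub (A (restr isl u)) (restr isl (T u)) = vadd mid (vsub (K (restr isl u)) (restr isl (K' u)))).
  { rewrite HA, HT by (trivial; now apply in_lp_restr). extensionality z. unfold vsub, vadd.
    destruct z as [e|e].
    - rewrite !restr_in by exact I. unfold dsum2.
      replace (fun i => restr isl u (inl i)) with (fun i => u (inl i)) by (extensionality i; now rewrite restr_in by exact I).
      unfold mid, vsub. apply Ceq; simpl; ring.
    - rewrite !restr_out by (intros []). unfold dsum2.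
      replace (fun i => restr isl u (inr i)) with (fun _ : nat => C0) by (extensionality i; now rewrite restr_out by (intros [])).
      rewrite (lin_0 p P HP). unfold mid. apply Ceq; simpl; ring. }
  rewrite E, restr_vadd, restr_vsub.
  replace ((eps + eta) * m) with (1 * (eps * m) + (eta / 2 * m + eta / 2 * m)) by field.
  apply nbound_vadd; trivial.
  - apply (nbound_reindex p Hp (restr (fun e => n <= e)%nat (vsub (S (fun e => u (inl e))) (S' (fun e => u (inl e))))) _ ev); trivial; [lra| |].
    + intros [e|e] Hz.
      * rewrite Rmult_1_l. right. reflexivity.
      * exfalso. apply Hz. unfold restr. destruct excluded_middle_informative; reflexivity.
    + intros [e|e] [e'|e'] Hz Hz' Ee; simpl in Ee; try (subst; reflexivity); exfalso;
        [apply Hz'|apply Hz]; unfold restr; destruct excluded_middle_informative; reflexivity.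
  - apply nbound_vsub; trivial. revert H3. apply nbound_le; trivial. intros z. unfold restr.
    repeat destruct excluded_middle_informative; rewrite ?Cmod_C0; try lra. apply Cmod_nonneg.
Qed.

End Closeness.

(** * Compactness of the commutation error *)

Section Assembly.
Context (p : R) (Hp : 1 < p) (blk : nat -> nat).
Context (psi1 : op nat nat) (r : nat -> op (nat + nat) (nat + nat)) (B : R).
Context (Hpl : linear_op p psi1) (Hpb : opbound p psi1 B).
Context (Hrl : forall k, linear_op p (r k)) (Hrb : forall k, opbound p (r k) B).

(** psi_1 is padded with a zero phi-part so that all nodes act on the same space. *)
Definition node_op (k : option nat) : op (nat + nat) (nat + nat) :=
  match k with None => dsum2 psi1 (fun _ _ => C0) | Some k => r k end.

Lemma zero_linear {I J} : linear_op p (fun (_ : vec I) (_ : J) => C0).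
Proof. intros c x y _ _. extensionality j. unfold vadd, vscale. apply Ceq; simpl; ring. Qed.

Lemma zero_opbound {I J} c : 0 <= c -> opbound p (fun (_ : vec I) (_ : J) => C0) c.
Proof. intros Hc. split; trivial. intros x m Hx. apply nbound_zero; trivial. destruct Hx; nra. Qed.

Lemma node_op_linear k : linear_op p (node_op k).
Proof. destruct k; simpl; trivial. apply linear_dsum2; trivial. apply zero_linear. Qed.

Lemma node_op_opbound k : opbound p (node_op k) B.
Proof. destruct k; simpl; trivial. apply opbound_dsum2; trivial. apply zero_opbound. apply Hpb. Qed.

Definition emb (j : nat + nat * (nat + nat)) : option nat * (nat + nat) :=
  match j with inl e => (None, inl e) | inr (k, z) => (Some k, z) end.

(** List-valued because the padded coordinates [(None, inr _)] have no preimage under [emb]. *)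
Definition unemb (q : option nat * (nat + nat)) : list (nat + nat * (nat + nat)) :=
  match q with (None, inl e) => inl e :: nil | (None, inr _) => nil | (Some k, z) => inr (k, z) :: nil end.

(** Evaluation at [impl blk x] removes the inverse. With [impl] written as inclusion plus [Wop], the
    terms from the inclusion cancel. *)
Lemma error_Dop x : in_lp p x -> forall j,
  opsub (dsum2 psi1 (dsumN r)) (fun y => impl blk (dsumN r (impl_inv blk y))) (impl blk x) j
  = Dop blk node_op x (emb j).
Proof.
  intros Hx j. unfold opsub, vsub. rewrite impl_inv_impl. unfold Dop.
  destruct j as [e|[k z]]; simpl emb; simpl fst; simpl snd.
  - rewrite impl_Wop_inl. f_equal. unfold dsum2, node_op. simpl.
    f_equal. extensionality e'. apply impl_Wop_inl.
  - rewrite impl_Wop_inr. unfold dsum2, dsumN, node_op. simpl.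
    replace (fun i => impl blk x (inr (k, i))) with (vadd (fun z => x (k, z)) (fun z => Wop blk x (Some k, z))).
    2:{ extensionality i. symmetry. apply impl_Wop_inr. }
    pose proof (Wop_opbound p Hp blk) as HW.
    rewrite (lin_vadd p) by (trivial; apply fiber_in_lp; trivial; eapply in_lp_opbound; eauto).
    unfold vadd. apply Ceq; simpl; ring.
Qed.

Lemma error_compact :
  small_tails p (Dop blk node_op) ->
  is_compact_op p (opsub (dsum2 psi1 (dsumN r)) (fun y => impl blk (dsumN r (impl_inv blk y)))).
Proof.
  intros HS. pose proof (impl_opbound blk p Hp) as [B1 B2].
  assert (HB : 0 <= B) by apply Hpb.
  assert (HN : opbound p (dsumN r) B) by now apply opbound_dsumN.
  set (enc := fun j : nat + nat * (nat + nat) => match j with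
    | inl e => nd 0 e | inr (k, inl e) => nd 1 (nd k e) | inr (k, inr e) => nd 2 (nd k e) end).
  assert (Hnd : forall a b a' b', nd a b = nd a' b' -> a = a' /\ b = b').
  { intros a b a' b' E. pose proof (f_equal row E) as E1. pose proof (f_equal col E) as E2.
    rewrite !row_nd in E1. rewrite !col_nd in E2. auto. }
  apply (small_tails_compact p Hp enc).
  - intros j j' E. unfold enc in E.
    destruct j as [e|[k [e|e]]], j' as [e'|[k' [e'|e']]]; apply Hnd in E; destruct E as [E0 E]; try discriminate;
      try (apply Hnd in E; destruct E); congruence.
  - apply bounded_op_iff; trivial. split.
    + apply linear_opsub; [apply linear_dsum2; trivial; now apply linear_dsumN|].
      apply (linear_comp p Hp (impl blk) (fun y => dsumN r (impl_inv blk y)) (B * 4)).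
      * apply impl_linear; trivial.
      * apply (linear_comp p Hp _ _ 4); trivial; [now apply linear_dsumN|apply impl_inv_linear; trivial].
      * now apply opbound_comp.
    + eexists. apply opbound_opsub; trivial; [apply opbound_dsum2; [trivial|apply Hpb|exact HN]|].
      apply (opbound_comp p (impl blk) (fun y => dsumN r (impl_inv blk y)) 4 (B * 4)); trivial. now apply opbound_comp.
  (* Every vector is the image under [impl] of one with norm at most 4 times as large. *)
  - intros eps He. destruct (HS (eps / 4) ltac:(lra)) as [l Hl].
    exists (flat_map unemb l). intros x m Hx.
    pose proof (proj2 B2 x m Hx) as Hy. specialize (Hl _ _ Hy).
    replace (eps / 4 * (4 * m)) with (eps * m) in Hl by field.
    apply (nbound_le p Hp (fun j => restr (fun kz => ~ In kz l) (Dop blk node_op (impl_inv blk x)) (emb j))).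
    + intros j. unfold restr at 1. destruct excluded_middle_informative as [H|H]; [|rewrite Cmod_C0; apply Cmod_nonneg].
      rewrite restr_in.
      * rewrite <- error_Dop by (eapply nbound_in_lp; eauto). rewrite impl_impl_inv. lra.
      * intros Hin. apply H. apply in_flat_map. exists (emb j). split; trivial.
        destruct j as [e|[k z]]; simpl; auto.
    + apply nbound_inj; trivial. intros [e|[k z]] [e'|[k' z']]; simpl; congruence.
Qed.

End Assembly.

(** * Choice of the sparse blocks and conclusion *)

(** Given [E i], only finitely many conditions are imposed on [E (S i)], each true from some index
    on. Closeness is required only where it eventually holds, so the blocks can be chosen before it
    is known which parameters are close within which tolerance. Each [a] and each [q] is included at
    all late stages. *)
Lemma block_sequence {A} p (Hp : 1 < p) (f : A -> nat) (Hf : forall a b, f a = f b -> a = b)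
  (T : A -> option nat -> op (nat + nat) (nat + nat)) (B : A -> R) :
  (forall a k, linear_op p (T a k)) -> (forall a k, opbound p (T a k) (B a)) ->
  exists E : nat -> nat, E 0%nat = 0%nat /\ (forall i, (E i < E (S i))%nat) /\
  forall i a k, (f a <= S i)%nat -> stage (S i) k ->
  (forall u m, nbound p u m ->
    nbound p (restr (fun z => E (S i) <= ev z)%nat (T a k (restr (fun z => ev z < E i)%nat u))) ((1 / 8) ^ S i * m) /\
    nbound p (restr (fun z => ev z < E i)%nat (T a k (restr (fun z => E (S i) <= ev z)%nat u))) ((1 / 8) ^ S i * m)) /\
  forall l q, stage (S i) (Some l) -> (q <= S i)%nat ->
    evt (block_close p (T a k) (T a (Some l)) (/ INR (S q))) ->
    block_close p (T a k) (T a (Some l)) (/ INR (S q)) (E (S i)).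
Proof.
  intros HL HB.
  set (good := fun i m n => (m < n)%nat /\ forall a k, (f a <= S i)%nat -> stage (S i) k ->
    (forall u b, nbound p u b ->
      nbound p (restr (fun z => n <= ev z)%nat (T a k (restr (fun z => ev z < m)%nat u))) ((1 / 8) ^ S i * b) /\
      nbound p (restr (fun z => ev z < m)%nat (T a k (restr (fun z => n <= ev z)%nat u))) ((1 / 8) ^ S i * b)) /\
    forall l q, stage (S i) (Some l) -> (q <= S i)%nat ->
      evt (block_close p (T a k) (T a (Some l)) (/ INR (S q))) ->
      block_close p (T a k) (T a (Some l)) (/ INR (S q)) n).
  assert (Hg : forall i m, exists n, good i m n).
  { intros i m. destruct (code_list f Hf (S i)) as [la Hla]. destruct (stage_list (S i)) as [lk Hlk].
    assert (He : evt (fun n => (m < n)%nat /\ forall a, In a la -> forall k, In k lk ->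
      (forall u b, nbound p u b ->
        nbound p (restr (fun z => n <= ev z)%nat (T a k (restr (fun z => ev z < m)%nat u))) ((1 / 8) ^ S i * b) /\
        nbound p (restr (fun z => ev z < m)%nat (T a k (restr (fun z => n <= ev z)%nat u))) ((1 / 8) ^ S i * b)) /\
      forall l, In l lk -> forall q, In q (seq 0 (S (S i))) -> forall l', l = Some l' ->
        evt (block_close p (T a k) (T a (Some l')) (/ INR (S q))) ->
        block_close p (T a k) (T a (Some l')) (/ INR (S q)) n)).
    { apply evt_and; [exists (S m); intros; lia|].
      apply evt_list. intros a _. apply evt_list. intros k _. apply evt_and.
      - apply (tri_evt p Hp _ (B a)); trivial. apply pow_lt. lra.
      - apply evt_list. intros l _. apply evt_list. intros q _. destruct l as [l|].
        + assert (G : evt (fun n => evt (block_close p (T a k) (T a (Some l)) (/ INR (S q))) ->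
             block_close p (T a k) (T a (Some l)) (/ INR (S q)) n)) by (apply evt_imp; auto).
          destruct G as [N HN]. exists N. intros n Hn l' E. injection E as <-. auto.
        + exists 0%nat. intros n _ l' E. discriminate. }
    destruct He as [n Hn]. exists n. destruct (Hn n ltac:(lia)) as [H1 H2]. split; trivial.
    intros a k Ha Hk. destruct (H2 a (Hla a Ha) k (Hlk k Hk)) as [H3 H4]. split; trivial.
    intros l q Hl Hq. apply (H4 (Some l) (Hlk _ Hl) q); trivial. apply in_seq. lia. }
  set (next := fun i m => proj1_sig (constructive_indefinite_description _ (Hg i m))).
  assert (Hnext : forall i m, good i m (next i m)).
  { intros i m. exact (proj2_sig (constructive_indefinite_description _ (Hg i m))). }
  exists (fix E i := match i with O => O | S i => next i (E i) end). split; [reflexivity|].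
  set (E := fix E i := match i with O => O | S i => next i (E i) end).
  split; [intros i; apply Hnext|]. intros i. apply (Hnext i (E i)).
Qed.

Theorem theorem7p17 (p : R) (Lam : Type)
  (psi phi : R -> Lam -> op nat nat)
  (rho : R -> Lam -> op (nat + nat) (nat + nat)) :
  1 < p ->
  (exists f : Lam -> nat, forall a b, f a = f b -> a = b) ->
  (forall t a, 0 <= t <= 1 ->
     is_bounded_op p (psi t a) /\ is_bounded_op p (phi t a) /\
     is_bounded_op p (rho t a)) ->
  (forall a x, in_lp p x -> forall j,
     rho 0 a x j = dsum2 (psi 0 a) (phi 0 a) x j) ->
  (forall t a, 0 <= t <= 1 ->
     is_compact_op p (opsub (rho t a) (dsum2 (psi t a) (phi t a)))) ->
  (forall a, calkin_continuous p (fun t => psi t a)) ->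
  (forall a, exists M, forall t, 0 <= t <= 1 -> opnorm p (rho t a) <= M) ->
  exists v : nat -> R,
    (forall k, 0 <= v k <= 1 /\ dyadic (v k)) /\
    similar_mod_compact p 16
      (fun a => dsumN (fun k => rho (v k) a))
      (fun a => dsum2 (psi 1 a) (dsumN (fun k => rho (v k) a))) /\
    (p = 2 ->
     unitarily_equiv_mod_compact p
      (fun a => dsumN (fun k => rho (v k) a))
      (fun a => dsum2 (psi 1 a) (dsumN (fun k => rho (v k) a)))).
Proof.
  intros Hp [f Hf] Hbd H0 Hcomp Hcont Hunif.
  assert (H01 : forall k, 0 <= vv k <= 1) by apply vv_range.
  (* The direct sum needs one bound for all nodes at once, supplied by [Hunif]. *)
  assert (HB : forall a, exists B, opbound p (psi 1 a) B /\ forall k, opbound p (rho (vv k) a) B).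
  { intros a. destruct (Hunif a) as [M HM].
    destruct (Hbd 1 a ltac:(lra)) as (H1 & _ & _). apply bounded_op_iff in H1; trivial. destruct H1 as (_ & c & Hc).
    exists (Rmax M c). split.
    - eapply opbound_weaken; [trivial|apply Rmax_r|trivial].
    - intros k. eapply opbound_weaken; [trivial| |apply opbound_opnorm; trivial; now apply Hbd].
      eapply Rle_trans; [now apply HM|apply Rmax_l]. }
  set (B := fun a => proj1_sig (constructive_indefinite_description _ (HB a))).
  assert (HB' : forall a, opbound p (psi 1 a) (B a) /\ forall k, opbound p (rho (vv k) a) (B a)).
  { intros a. exact (proj2_sig (constructive_indefinite_description _ (HB a))). }
  assert (Hpsl : forall t a, 0 <= t <= 1 -> linear_op p (psi t a) /\ linear_op p (phi t a) /\ linear_op p (rho t a)).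
  { intros t a Ht. destruct (Hbd t a Ht) as (H1 & H2 & H3).
    apply bounded_op_iff in H1, H2, H3; trivial. tauto. }
  set (T := fun a => node_op (psi 1 a) (fun k => rho (vv k) a)).
  assert (HTl : forall a k, linear_op p (T a k)).
  { intros a k. apply node_op_linear; [trivial|apply Hpsl; lra|intros; now apply Hpsl]. }
  assert (HTb : forall a k, opbound p (T a k) (B a)).
  { intros a k. destruct (HB' a). now apply node_op_opbound. }
  destruct (block_sequence p Hp f Hf T B HTl HTb) as (E & E0 & HE & HEs).
  destruct (blk_exists E E0 HE) as [blk Hblk].
  (* For the node [None] the decomposition is exact, with zero phi-part, zero correction and
     parameter 1. *)
  assert (Hdec : forall a k, exists P K, linear_op p P /\ rank_tails p K /\
     forall u, in_lp p u -> T a k u = vadd (dsum2 (psi (val k) a) P u) (K u)).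
  { intros a [k|].
    - exists (phi (vv k) a), (opsub (rho (vv k) a) (dsum2 (psi (vv k) a) (phi (vv k) a))).
      split; [now apply Hpsl|]. split.
      + intros eps He. apply (compact_rank_tail p Hp _ ev eps); auto.
      + intros u _. extensionality z. unfold vadd, opsub, vsub. apply Ceq; simpl; ring.
    - exists (fun _ _ => C0), (fun _ _ => C0). split; [apply zero_linear|]. split.
      + intros eps He. exists 0%nat. intros n _ u m Hu. apply nbound_zero; [destruct Hu; nra|].
        intros z. unfold restr. destruct excluded_middle_informative; trivial.
      + intros u _. simpl. now rewrite vadd_0_r. }
  assert (Hcl : forall a eps, 0 < eps -> exists delta, 0 < delta /\ forall k l, Rabs (val k - vv l) < delta ->
     evt (block_close p (T a k) (T a (Some l)) eps)).
  { intros a eps He.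
    destruct (tail_close_uniform p Hp (fun t => psi t a) (eps / 2)) as (delta & Hd & Hdl); [intros; now apply Hbd|trivial|lra|].
    exists delta. split; trivial. intros k l Hkl.
    destruct (Hdec a k) as (P & K & HP & HK & EK). destruct (Hdec a (Some l)) as (P' & K' & _ & HK' & EK').
    replace eps with (eps / 2 + eps / 2) by field.
    apply (block_close_of_tail_close p Hp _ _ K K' (psi (val k) a) (psi (vv l) a) P P'); trivial; [|lra].
    apply Hdl; trivial. destruct k; simpl; [apply H01|lra]. }
  assert (Hst : forall a, small_tails p (Dop blk (T a))).
  (* The blocks take [a] into account from stage [f a] on, which is therefore the threshold. *)
  { intros a. apply (error_small_tails p Hp E blk HE Hblk (T a) (B a) (HTl a) (HTb a) (f a)).
    - intros i k u m Hi Hk Hu. apply (HEs i a k Hi Hk); trivial.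
    (* [q] replaces [eps] by one of the countably many tolerances for which the blocks were
       prepared. *)
    - intros eps He. destruct (archimed_cor1 eps He) as (q & Hq & Hq0).
      assert (Hq' : 0 < / INR (S q)) by (apply Rinv_0_lt_compat, lt_0_INR; lia).
      destruct (Hcl a (/ INR (S q)) Hq') as (delta & Hd & Hdl).
      exists delta, (S (Nat.max q (f a))). split; trivial.
      intros [|i] k l Hi Hk Hl Hkl u m Hu; [lia|].
      destruct (HEs i a k ltac:(lia) Hk) as [_ H2].
      eapply nbound_weaken; [trivial| |apply (H2 l q Hl ltac:(lia) (Hdl k l Hkl) u m Hu)].
      apply Rmult_le_compat_r; [apply Hu|]. left. eapply Rle_lt_trans; [|apply Hq].
      apply Rinv_le_contravar; [now apply lt_0_INR|apply le_INR; lia].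
    - intros k l u Hk Hl Hu. unfold T, node_op. rewrite Hk, Hl. extensionality z.
      rewrite H0 by now apply in_lp_restr.
      destruct z as [e|e].
      + rewrite restr_in by exact I. rewrite H0 by trivial. unfold dsum2.
        replace (fun i => restr isl u (inl i)) with (fun i => u (inl i)); trivial.
        extensionality i. now rewrite restr_in by exact I.
      + rewrite restr_out by (intros []). unfold dsum2.
        replace (fun i => restr isl u (inr i)) with (fun _ : nat => C0) by (extensionality i; now rewrite restr_out by (intros [])).
        rewrite (lin_0 p (phi 0 a)); trivial. apply Hpsl. lra. }
  assert (Hcp : forall a, is_compact_op p (opsub (dsum2 (psi 1 a) (dsumN (fun k => rho (vv k) a)))
     (fun y => impl blk (dsumN (fun k => rho (vv k) a) (impl_inv blk y))))).
  { intros a. destruct (HB' a). apply (error_compact p Hp blk (psi 1 a) (fun k => rho (vv k) a) (B a)); trivial.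
    - apply Hpsl. lra.
    - intros k. now apply Hpsl.
    - apply Hst. }
  pose proof (impl_opbound blk p Hp) as [B1 B2].
  assert (Hinv : invertible_pair p (impl blk) (impl_inv blk)).
  { split; [|split; [|split]].
    - apply bounded_op_iff; trivial. split; [now apply impl_linear|eauto].
    - apply bounded_op_iff; trivial. split; [now apply impl_inv_linear|eauto].
    - intros x _ i. now rewrite impl_inv_impl.
    - intros y _ j. now rewrite impl_impl_inv. }
  exists vv. split; [|split].
  - intros k. split; [apply H01|apply vv_dyadic].
  - exists (impl blk), (impl_inv blk). split; [trivial|]. split; [|exact Hcp].
    pose proof (opnorm_le p Hp _ _ B1). pose proof (opnorm_le p Hp _ _ B2).
    destruct (opbound_opnorm p Hp _ (proj1 Hinv)) as [P1 _].
    destruct (opbound_opnorm p Hp _ (proj1 (proj2 Hinv))) as [P2 _].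
    replace 16 with (4 * 4) by ring. apply Rmult_le_compat; trivial.
  - intros ->. exists (impl blk), (impl_inv blk). split; [trivial|]. split; [|exact Hcp].
    (* A contraction whose inverse is also a contraction is isometric. *)
    destruct (impl_contraction blk) as [[_ C1] [_ C2]].
    intros x Hx. pose proof (nbound_lp_norm 2 Hp x Hx) as Hn.
    pose proof (C1 x _ Hn) as Hi. rewrite Rmult_1_l in Hi. apply Rle_antisym.
    + now apply nbound_norm_le.
    + pose proof (nbound_lp_norm 2 Hp _ (nbound_in_lp 2 _ _ Hi)) as Hn'.
      apply C2 in Hn'. rewrite impl_inv_impl, Rmult_1_l in Hn'. now apply nbound_norm_le.
Qed.
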